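(* Let $d\ge1$ be an integer, $s>\frac d4+\frac{d}{2(d+2)}$ and $1\le\alpha'\le2$. Then there is a constant $C$ (depending only on $d,s,\alpha'$) such that $$\Big\|\sum_{j=1}^\infty\lambda_j\,|e^{it\Delta}f_j|^2\Big\|_{L^2_xL^\infty_t(\mathbb T^{d}\times\mathbb T)}\le C\,\|\lambda\|_{\ell^{\alpha'}}$$ holds for every orthonormal system $(f_j)_j$ in $H^s(\mathbb T^d)$ and every sequence $\lambda=(\lambda_j)_j\in\ell^{\alpha'}$.
   Context: $\mathbb T=\mathbb R/\mathbb Z$. For $f$ on $\mathbb T^d$, $\widehat f(k)=\int_{\mathbb T^d}f(x)e^{-2\pi ix\cdot k}dx$, $k\in\mathbb Z^d$. $H^s(\mathbb T^d)$ is the Hilbert space with norm $\|f\|_{H^s}=\|(1+|k|^2)^{s/2}\widehat f\|_{\ell^2(\mathbb Z^d)}$ and the corresponding inner product. The Schrödinger propagator is the Fourier multiplier with symbol $e^{2\pi it|k|^2}$, i.e. $e^{it\Delta}f(x)=\sum_{k\in\mathbb Z^d}e^{2\pi i(x\cdot k+t|k|^2)}\widehat f(k)$, which is $1$-periodic in $t$. Mixed norm: $\|F\|_{L^2_xL^\infty_t}=\big\|\,\|F(x,\cdot)\|_{L^\infty_t(\mathbb T)}\big\|_{L^2_x(\mathbb T^d)}$. *)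

(* Defs.v *)
From HB Require Import structures.
From mathcomp Require Import all_boot all_order all_algebra.
From mathcomp Require Import complex.
From mathcomp Require Import finmap.
From mathcomp Require Import all_classical all_reals all_analysis.

Set Implicit Arguments.
Unset Strict Implicit.
Unset Printing Implicit Defensive.

Import Order.TTheory GRing.Theory Num.Theory.
Import numFieldNormedType.Exports.
Import ComplexField.Normc.

Local Open Scope classical_set_scope.
Local Open Scope complex_scope.
Local Open Scope ring_scope.

Section power_probability.
Context d (T : measurableType d) (R : realType) (P : probability T R).

Definition tuple_cons n (z : T * n.-tuple T) : n.+1.-tuple T :=
  [tuple of z.1 :: z.2].

Lemma measurable_tuple_cons n : measurable_fun setT (@tuple_cons n).
Proof. by apply: measurable_cons. Qed.

HB.instance Definition _ n :=
  isMeasurableFun.Build _ _ _ _ (@tuple_cons n) (@measurable_tuple_cons n).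

(* The n-fold product measure: the library only has binary products, so
   T^n.+1 is obtained by transporting P \x P^n along [tuple_cons]. *)
Fixpoint power_prob n : probability (n.-tuple T) R :=
  match n with
  | 0 => \d_([tuple] : 0.-tuple T)
  | m.+1 => distribution (P \x power_prob m)%E (@tuple_cons m)
  end.

End power_probability.

Section sums.
Context (R : realType) (I : choiceType).

Definition rsum (a : I -> R) : R :=
  fine (\esum_(i in [set: I]) (EFin \o a)^\+ i
        - \esum_(i in [set: I]) (EFin \o a)^\- i)%E.

Definition csummable (a : I -> R[i]) : Prop :=
  summable [set: I] (fun i => (normc (a i))%:E).

(* Meaningful for [csummable] families only. *)
Definition csum (a : I -> R[i]) : R[i] :=
  rsum (fun i => complex.Re (a i)) +i* rsum (fun i => complex.Im (a i)).

End sums.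

Section complex_valued.
Context (R : realType) (disp : measure_display) (T : measurableType disp).

Definition cmeasurable (f : T -> R[i]) : Prop :=
  measurable_fun [set: T] (fun x => complex.Re (f x)) /\
  measurable_fun [set: T] (fun x => complex.Im (f x)).

Definition cintegral (mu : {measure set T -> \bar R}) (f : T -> R[i]) : R[i] :=
  (\int[mu]_x complex.Re (f x)) +i* (\int[mu]_x complex.Im (f x)).

Definition cLnorm (mu : {measure set T -> \bar R}) (p : \bar R)
    (f : T -> R[i]) : \bar R :=
  Lnorm mu p (fun x => (normc (f x))%:E).

End complex_valued.

Section torus.
Context (R : realType).

(* The circle R/Z is represented by its fundamental domain [0, 1] with Lebesgue
   measure. A function on the torus is a function on R^d of which only the
   values on [0, 1]^d, up to null sets, matter. *)
Definition circle : probability (measurableTypeR R) R := uniform_prob (@ltr01 R).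

Variable d : nat.

Notation point := (d.-tuple (measurableTypeR R)).
Notation freq := (d.-tuple int).

Definition torus : probability point R := power_prob circle d.

Definition spacetime : probability (point * measurableTypeR R)%type R :=
  (torus \x circle)%E.

Definition dotp (k : freq) (x : point) : R :=
  \sum_(i < d) (tnth k i)%:~R * (tnth x i : R).

Definition sqnorm (k : freq) : R := \sum_(i < d) (tnth k i)%:~R ^+ 2.

(* exp (2 pi i theta) *)
Definition cexp (theta : R) : R[i] :=
  cos (2 * pi * theta) +i* sin (2 * pi * theta).

Definition fourier (f : point -> R[i]) (k : freq) : R[i] :=
  cintegral torus (fun x => f x * cexp (- dotp k x)).

Definition Hs_norm (s : R) (f : point -> R[i]) : \bar R :=
  ((\esum_(k in [set: freq])
     (((1 + sqnorm k) `^ (s / 2) * normc (fourier f k)) ^+ 2)%:E) `^ (2^-1))%E.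

Definition Hs_inner (s : R) (f g : point -> R[i]) : R[i] :=
  csum (fun k : freq =>
    ((1 + sqnorm k) `^ s)%:C * (fourier f k * (fourier g k)^*)).

(* For s >= 0, H^s is a subspace of L^2. *)
Definition in_Hs (s : R) (f : point -> R[i]) : Prop :=
  [/\ cmeasurable f, (cLnorm torus 2%:E f < +oo)%E & (Hs_norm s f < +oo)%E].

Definition orthonormal_Hs (s : R) (f : nat -> point -> R[i]) : Prop :=
  (forall j, in_Hs s (f j)) /\
  (forall i j, Hs_inner s (f i) (f j) = (i == j)%:R).

Definition schrodinger_sum (f : point -> R[i]) (A : {fset freq}) (t : R)
    (x : point) : R[i] :=
  \sum_(k <- A) cexp (dotp k x + t * sqnorm k) * fourier f k.

(* [u] is a version of (x, t) |-> (e^{it Delta} f)(x): a jointly measurable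
   function such that, for almost every t, the series over k in Z^d defining
   e^{it Delta} f converges to u (., t), unconditionally in L^2. The series need
   not converge absolutely at any point, so u is determined up to null sets. *)
Definition schrodinger (f : point -> R[i])
    (u : point * measurableTypeR R -> R[i]) : Prop :=
  cmeasurable u /\
  \forall t \ae circle, forall e : R, 0 < e ->
    exists A : {fset freq}, forall B : {fset freq}, (A `<=` B)%fset ->
      (cLnorm torus 2%:E (fun x => u (x, t) - schrodinger_sum f B t x)%R
         <= e%:E)%E.

Definition mixed_norm (F : point * measurableTypeR R -> R[i]) : \bar R :=
  Lnorm torus 2%:E (fun x => cLnorm circle +oo%E (fun t => F (x, t))).

Definition density_term (lam : nat -> R[i])
    (u : nat -> point * measurableTypeR R -> R[i])
    (z : point * measurableTypeR R) (j : nat) : R[i] :=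
  lam j * (normc (u j z) ^+ 2)%:C.

End torus.

Definition ell_norm (R : realType) (p : R) (lam : nat -> R[i]) : \bar R :=
  Lnorm counting p%:E (fun j => (normc (lam j))%:E).

(* Main.v *)
Require Import Defs.
From mathcomp Require Import all_boot all_order all_algebra.
From mathcomp Require Import complex finmap.
From mathcomp Require Import all_classical all_reals all_analysis.
From mathcomp Require Import measurable_realfun ess_sup_inf.
From mathcomp Require Import ring lra zify.

Set Implicit Arguments.
Unset Strict Implicit.
Unset Printing Implicit Defensive.

Import Order.TTheory GRing.Theory Num.Theory.
Import numFieldNormedType.Exports.
Import ComplexField.Normc.

Local Open Scope classical_set_scope.
Local Open Scope complex_scope.
Local Open Scope ring_scope.

(** Since l^alpha' embeds in l^2, it suffices to treat alpha' = 2. Testing the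
    density at the maximising time against a weight g, the claim becomes a bound on the
    Hilbert-Schmidt norm of sum_b int psi_b(x) e_(x,b) (x) e_(x,b) dx, where e_(x,b) is the
    vector of exponentials at (x, t_b); this norm is at most
    (int int g(x) g(y) K(x - y)^2)^(1/2) with K = sup_t |sum_k e(k x + t |k|^2)|, and
    Schur's test reduces everything to the L^2 norm of K.

    For frequencies in a cube of side N the time t may be restricted to a grid of about
    N^2 points, because the density is recovered from its samples. Weyl differencing
    bounds the one-dimensional sums by W(t)^(1/2), uniformly in x, where W is a sum of
    Fejer kernels, and counting the solutions of h v = h' v' gives
    sum_t W(t)^2 <= N^4 up to logarithms. At the at most N^4 / mu^2 grid points with
    W > mu one uses the L^2 orthogonality of the exponentials, elsewhere K^2 <= mu^d. The
    choice mu = N^(2 - d/(d+2)) yields |K|_2^2 <= N^(d + 2d/(d+2)) up to logarithms, which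
    is summable over dyadic N against the Sobolev weights N^(-4s) precisely when
    s > d/4 + d/(2(d+2)). *)

(** * Exponential sums and Weyl's inequality *)

(** Two gaps separate the kernel bound from the claim. Orthonormality does not survive restriction
    to a frequency shell, but Bessel's inequality does, so the duality argument is run for finite
    Bessel systems, with bounds uniform in their size [J]. Moreover the truncated series converge
    only in mean square, at almost every fixed [t], whereas the mixed norm fixes [x] first: the
    maximal bound is proved for truncations to cubes, with a majorant ([square_fun]) independent of
    the time and of the truncation, and Tonelli's theorem carries it over to [u]. The equispaced
    time grid has three uses: it samples the density, it turns the second moment of W into an exact
    count of integer solutions, and it is closed under differences modulo 1, which are the times at
    which the kernel is evaluated. The strict inequality on [s] leaves a surplus [4 * s - loss], cut
    into five equal parts [eta]: one absorbs the logarithms, three pay for recombining the shells,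
    one makes the final series converge. *)

Section complex_lemmas.
Context (R : realType).
Implicit Types (z w : R[i]) (t : R).

Lemma normc_ge0 z : 0 <= normc z.
Proof. by case: z => a b; exact: sqrtr_ge0. Qed.

Lemma normc_sqrE z : normc z ^+ 2 = complex.Re z ^+ 2 + complex.Im z ^+ 2.
Proof. by case: z => a b /=; rewrite sqr_sqrtr // addr_ge0 ?sqr_ge0. Qed.

Lemma normc_sqr_conj z : (normc z ^+ 2)%:C = z * z^*.
Proof.
rewrite normc_sqrE; case: z => a b /=; apply/eqP; rewrite eq_complex /=.
by apply/andP; split; apply/eqP; ring.
Qed.

Lemma normc_sum I (r : seq I) (P : pred I) (F : I -> R[i]) :
  normc (\sum_(i <- r | P i) F i) <= \sum_(i <- r | P i) normc (F i).
Proof.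
elim/big_ind2: _ => [|x a y b xa yb|//]; first by rewrite normc0.
by apply: le_trans (le_normcD _ _) _; exact: lerD.
Qed.

Lemma normc_real t : normc t%:C = `|t|.
Proof. by rewrite /= expr0n /= addr0 sqrtr_sqr. Qed.

Lemma normc_nat n : normc (n%:R : R[i]) = n%:R.
Proof. by rewrite -(rmorph_nat (real_complex R)) normc_real ger0_norm. Qed.

Lemma normc_conj z : normc z^* = normc z.
Proof. by case: z => a b /=; rewrite sqrrN. Qed.

Lemma normcB z w : normc (z - w) = normc (w - z).
Proof. by rewrite -normcN opprB. Qed.

Lemma normc_triB z w : normc (z - w) <= normc z + normc w.
Proof. by rewrite -(normcN w); exact: le_normcD. Qed.

Lemma Re_sum I (r : seq I) (P : pred I) (F : I -> R[i]) :
  complex.Re (\sum_(i <- r | P i) F i) = \sum_(i <- r | P i) complex.Re (F i).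
Proof. by elim/big_rec2: _ => [//|i y1 y2 _ <-]; case: (F i) y2 => ? ? []. Qed.

Lemma Im_sum I (r : seq I) (P : pred I) (F : I -> R[i]) :
  complex.Im (\sum_(i <- r | P i) F i) = \sum_(i <- r | P i) complex.Im (F i).
Proof. by elim/big_rec2: _ => [//|i y1 y2 _ <-]; case: (F i) y2 => ? ? []. Qed.

Lemma normRe_le z : `|complex.Re z| <= normc z.
Proof.
rewrite -ler_sqr ?nnegrE ?normc_ge0 // normc_sqrE real_normK ?num_real //.
by rewrite lerDl sqr_ge0.
Qed.

Lemma normIm_le z : `|complex.Im z| <= normc z.
Proof.
rewrite -ler_sqr ?nnegrE ?normc_ge0 // normc_sqrE real_normK ?num_real //.
by rewrite lerDr sqr_ge0.
Qed.

Lemma normc_le_ReIm z : normc z <= `|complex.Re z| + `|complex.Im z|.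
Proof.
rewrite -ler_sqr ?nnegrE ?normc_ge0 ?addr_ge0 // normc_sqrE sqrrD.
rewrite !real_normK ?num_real //.
by rewrite lerD2r lerDl mulrn_wge0 // mulr_ge0.
Qed.

End complex_lemmas.

Section exponential_sums.
Context (R : realType).
Implicit Types (x y th : R) (n L m : nat).

Lemma cexpD x y : cexp (x + y) = cexp x * cexp y.
Proof.
apply/eqP; rewrite eq_complex /= mulrDr cosD sinD.
by apply/andP; split; apply/eqP; ring.
Qed.

Lemma cexp0 : cexp (0 : R) = 1.
Proof. by rewrite /cexp mulr0 cos0 sin0. Qed.

Lemma cexpN x : cexp (- x) = (cexp x)^*.
Proof. by rewrite /cexp mulrN cosN sinN. Qed.

Lemma normc_cexp x : normc (cexp x) = 1.
Proof. by rewrite /= cos2Dsin2 sqrtr1. Qed.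

Lemma cexp1 : cexp (1 : R) = 1.
Proof. by rewrite /cexp mulr1 mulr_natl cos2pi sin2pi. Qed.

Lemma cexpMn n x : cexp (n%:R * x) = cexp x ^+ n.
Proof.
elim: n => [|n IH]; first by rewrite mul0r cexp0 expr0.
by rewrite -natr1 mulrDl mul1r cexpD IH exprSr.
Qed.

Lemma cexp_int (k : int) : cexp (k%:~R : R) = 1.
Proof.
case: k => n.
  by rewrite -pmulrn -[n%:R]mulr1 cexpMn cexp1 expr1n.
by rewrite NegzE rmorphN /= cexpN -pmulrn -[n.+1%:R]mulr1 cexpMn cexp1 expr1n rmorph1.
Qed.

Lemma cexpDint x (k : int) : cexp (x + k%:~R) = cexp x.
Proof. by rewrite cexpD cexp_int mulr1. Qed.

Lemma cexp_sum I (r : seq I) (P : pred I) (F : I -> R) :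
  cexp (\sum_(i <- r | P i) F i) = \prod_(i <- r | P i) cexp (F i).
Proof.
by apply: (big_morph (@cexp R)); [exact: cexpD|exact: cexp0].
Qed.

Lemma cexp_neq1 x : 0 < x < 1 -> cexp x != 1.
Proof.
move=> /andP[x0 x1]; apply/negP => /eqP /(congr1 (@complex.Re R)) /= h.
have : sin (pi * x) ^+ 2 = 0.
  have := cos2Dsin2 (pi * x).
  have : cos (2 * pi * x) = cos (pi * x) ^+ 2 - sin (pi * x) ^+ 2.
    by rewrite -mulrA mulr_natl mulr2n cosD -!expr2.
  by rewrite h; lra.
move=> /eqP; rewrite sqrf_eq0 => /eqP s0.
have := @sin_gt0_pi R (pi * x).
rewrite s0 ltxx => H; have : false by apply: H; rewrite mulr_gt0 ?pi_gt0 //= gtr_pMr ?pi_gt0.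
by [].
Qed.

Definition geom_sum n th : R[i] := \sum_(i < n) cexp (i%:R * th).

Lemma normc_geom_sum_le n th : normc (geom_sum n th) <= n%:R.
Proof.
apply: le_trans (normc_sum _ _ _) _.
under eq_bigr do rewrite normc_cexp.
by rewrite sumr_const card_ord.
Qed.

Lemma geom_sumE n th : (1 - cexp th) * geom_sum n th = 1 - cexp (n%:R * th).
Proof.
rewrite cexpMn /geom_sum; under eq_bigr do rewrite cexpMn.
by rewrite -opprB -[RHS]opprB subrX1 mulNr.
Qed.

Lemma normc_geom_sum_mul n th :
  normc (1 - cexp th) * normc (geom_sum n th) <= 2.
Proof.
rewrite -normcM geom_sumE; apply: le_trans (normc_triB _ _) _.
by rewrite normc_cexp normc1; lra.
Qed.

Lemma normc_1BX n th : normc (1 - cexp (n%:R * th)) <= n%:R * normc (1 - cexp th).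
Proof.
rewrite -geom_sumE normcM mulrC ler_wpM2r ?normc_ge0 //.
exact: normc_geom_sum_le.
Qed.

(** The [i]-th term is within [i * de] of 1, where [de = normc (1 - cexp th)], so the sum misses [n]
    by at most [n * (n - 1) / 2 * de <= n / 2]. *)
Lemma normc_geom_sum_ge n th : n%:R * normc (1 - cexp th) <= 1 ->
  n%:R / 2 <= normc (geom_sum n th).
Proof.
set de := normc _ => nde.
have de0 : 0 <= de by exact: normc_ge0.
have h : normc (n%:R - geom_sum n th) <= n%:R / 2.
  have -> : n%:R - geom_sum n th = \sum_(i < n) (1 - cexp (i%:R * th)).
    by rewrite sumrB sumr_const card_ord.
  apply: le_trans (normc_sum _ _ _) _.
  have s1 : \sum_(i < n) normc (1 - cexp (i%:R * th)) <= \sum_(i < n) i%:R * de.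
    by apply: ler_sum => i _; exact: normc_1BX.
  apply: le_trans s1 _.
  rewrite -mulr_suml.
  have -> : \sum_(i < n) i%:R = n%:R * (n%:R - 1) / 2 :> R.
    elim: n {nde} => [|n IH]; first by rewrite big_ord0 !mul0r.
    by rewrite big_ord_recr /= IH -natr1; field.
  case: n nde => [|n] nde; first by rewrite !mul0r.
  have : n.+1%:R * (n.+1%:R * de) <= n.+1%:R * 1 :> R by apply: ler_wpM2l.
  have : 0 <= n.+1%:R * de by apply: mulr_ge0.
  nra.
have := normc_triB (geom_sum n th) (geom_sum n th - n%:R).
rewrite opprB addrC subrK normc_nat [normc (_ - n%:R)]normcB => h2.
have := le_trans h2 (lerD (lexx _) h); lra.
Qed.

(* Unlike [normc (geom_sum m th)], which it dominates up to a constant for all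
   [m <= n], this sum of Fejer kernels has nonnegative Fourier coefficients, so that the
   moments of its dilates count solutions of linear equations. *)
Definition fejer_sum n th : R :=
  \sum_(L < n) normc (geom_sum L.+1 th) ^+ 2 / L.+1%:R ^+ 2.

Lemma fejer_term_ge L th : L.+1%:R * normc (1 - cexp th) <= 1 ->
  4^-1 <= normc (geom_sum L.+1 th) ^+ 2 / L.+1%:R ^+ 2.
Proof.
move=> h; rewrite ler_pdivlMr ?exprn_gt0 //.
have := normc_geom_sum_ge h; have := ler0n R L.+1.
have := normc_ge0 (geom_sum L.+1 th); nra.
Qed.

Lemma fejer_sum_term_ge0 L th : 0 <= normc (geom_sum L.+1 th) ^+ 2 / L.+1%:R ^+ 2.
Proof. by rewrite mulr_ge0 ?sqr_ge0 // invr_ge0 sqr_ge0. Qed.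

Lemma fejer_sum_ge0 n th : 0 <= fejer_sum n th.
Proof. by apply: sumr_ge0 => i _; exact: fejer_sum_term_ge0. Qed.

(** The first [m] summands have lengths too short for cancellation at this angle and contribute at
    least 1/4 each. *)
Lemma fejer_sum_ge n m th : (m <= n)%N -> m%:R * normc (1 - cexp th) <= 1 ->
  m%:R / 4 <= fejer_sum n th.
Proof.
move=> mn mde; rewrite /fejer_sum.
rewrite (big_ord_widen_cond n predT (fun L => normc (geom_sum L.+1 th) ^+ 2 / L.+1%:R ^+ 2)) //.
rewrite (bigID (fun i : 'I_n => (i < m)%N)) /=.
rewrite -[leLHS]addr0 lerD //; last first.
  by apply: sumr_ge0 => i _; exact: fejer_sum_term_ge0.
rewrite (eq_bigl (fun i : 'I_n => (i < m)%N)); last by move=> i; rewrite ltn_ord.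
rewrite -(big_ord_widen_cond n predT (fun L => normc (geom_sum L.+1 th) ^+ 2 / L.+1%:R ^+ 2)) //=.
have -> : m%:R / 4 = \sum_(i < m) (4^-1 : R).
  by rewrite sumr_const card_ord -[RHS]mulr_natl.
apply: ler_sum => i _; apply: fejer_term_ge.
apply: le_trans mde; rewrite ler_wpM2r ?normc_ge0 // ler_nat.
exact: ltn_ord.
Qed.

(** A geometric sum is at most its length and at most [2 / de], while the Fejer sum counts, up to a
    factor 4, the lengths below [1 / de]. With [k] the integer part of [1 / de], the constant comes
    from [2 / de < 2 * (k + 1) <= 4 * k = 16 * (k / 4)]. *)
Lemma geom_sum_le_fejer n m th : (m <= n)%N ->
  normc (geom_sum m th) <= 16 * fejer_sum n th.
Proof.
move=> mn; set de := normc (1 - cexp th).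
have de0 : 0 <= de by exact: normc_ge0.
have [h|h] := leP (m%:R * de) 1.
  have := fejer_sum_ge mn h; have := normc_geom_sum_le m th.
  have := ler0n R m; lra.
have m0 : (0 < m)%N by case: m h {mn} => // /[!mul0r]; rewrite ltNge ler01.
have de1 : 0 < de.
  by rewrite lt0r de0 andbT; apply: contraTneq h => ->; rewrite mulr0 -leNgt.
have D2 : normc (geom_sum m th) <= 2 / de.
  by rewrite ler_pdivlMr // mulrC; exact: normc_geom_sum_mul.
apply: le_trans D2 _.
have tr : (Num.truncn de^-1)%:R <= de^-1 < (Num.truncn de^-1).+1%:R.
  by apply: truncn_itv; rewrite invr_ge0.
(* If [de > 1] no length is short enough, and the summand of length 1, whose value is 1, has to
   suffice. *)
case: (posnP (Num.truncn de^-1)) tr => [->|t0] /andP[t1 t2].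
  have : 1 / 4 <= fejer_sum n th.
    rewrite /fejer_sum; case: n mn => [|n] mn; first by case: m m0 mn h.
    rewrite big_ord_recl /= -[1/4]addr0 lerD //; last first.
      by apply: sumr_ge0 => i _; exact: fejer_sum_term_ge0.
    by rewrite /geom_sum big_ord1 normc_cexp; lra.
  have : de^-1 < 1 by [].
  lra.
have tm : (Num.truncn de^-1 <= m)%N.
  rewrite -(ler_nat R); apply: le_trans t1 _.
  by rewrite -[leLHS]mul1r ler_pdivrMr // ltW.
have tde : (Num.truncn de^-1)%:R * de <= 1 by rewrite -ler_pdivlMr // mul1r.
have := fejer_sum_ge (leq_trans tm mn) tde.
move: t2; rewrite -natr1.
have : 1 <= (Num.truncn de^-1)%:R :> R by rewrite ler1n.
lra.
Qed.

End exponential_sums.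

(** * Weyl differencing and the count of collisions *)

Section weyl_sums.
Context (R : realType).
Implicit Types (x t : R) (n : nat).

Lemma sum_nat_bool_card n (p : pred 'I_n) : (\sum_(i < n) p i)%N = #|[set i | p i]%SET|.
Proof. by rewrite -sum1dep_card [RHS]big_mkcond /=; apply: eq_bigr => i _; case: (p i). Qed.

(* Weyl differencing: [T] collects the products of terms at distance [h >= 0]. *)
Lemma sum_mul_conj n (a : nat -> R[i]) :
  let S := \sum_(i < n) a i in
  let T := \sum_(h < n) \sum_(j < n - h) a (j + h)%N * (a j)^* in
  S * S^* = T + T^* - \sum_(i < n) a i * (a i)^*.
Proof.
elim: n => [|n IH] /=; first by rewrite !big_ord0 rmorph0 mul0r subr0 addr0.
move: IH => /=; set S := \sum_(i < n) a i; set T := \sum_(h < n) _ => IH.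
(* Going from [n] to [n + 1] lengthens each row [h] by the single product [a n * (a (n - h))^*];
   together these form [a n] times the conjugate of the new full sum. *)
have -> : \sum_(h < n.+1) \sum_(j < n.+1 - h) a (j + h)%N * (a j)^* =
    T + a n * (S + a n)^*.
  have -> : a n * (S + a n)^* = \sum_(h < n.+1) a n * (a (n - h)%N)^*.
    rewrite -mulr_sumr -rmorph_sum /= (reindex_inj rev_ord_inj) /=.
    rewrite big_ord_recr /= subSS subnn; congr (_ * (_ + _)^*).
      by apply: eq_bigr => i _; congr a; rewrite subSS subKn // ltnW.
    by rewrite subn0.
  have -> : T = \sum_(h < n.+1) \sum_(j < n - h) a (j + h)%N * (a j)^*.
    by rewrite big_ord_recr /= subnn big_ord0 addr0.
  rewrite -big_split /=; apply: eq_bigr => h _.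
  rewrite subSn; last by rewrite -ltnS.
  by rewrite big_ord_recr /= subnK // -ltnS.
rewrite !big_ord_recr /= -/S !(rmorphD, rmorphM) /= !conjCK.
rewrite mulrDl mulrDr IH; ring.
Qed.

Lemma normc_sum_sqr_le n (a : nat -> R[i]) :
  normc (\sum_(i < n) a i) ^+ 2 <=
  2 * \sum_(h < n) normc (\sum_(j < n - h) a (j + h)%N * (a j)^*).
Proof.
have := congr1 (@complex.Re R) (sum_mul_conj n a); cbv zeta.
rewrite -normc_sqr_conj [complex.Re _%:C]/= => ->.
set T := \sum_(h < n) _.
have -> : complex.Re (T + T^* - \sum_(i < n) a i * (a i)^*) =
   2 * complex.Re T - \sum_(i < n) normc (a i) ^+ 2.
  under eq_bigr do rewrite -normc_sqr_conj.
  rewrite -rmorph_sum /=; case: T => u v /=; ring.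
have : 0 <= \sum_(i < n) normc (a i) ^+ 2 by apply: sumr_ge0 => i _; exact: sqr_ge0.
have : normc T <= \sum_(h < n) normc (\sum_(j < n - h) a (j + h)%N * (a j)^*).
  exact: normc_sum.
have := normRe_le T; have := ler_norm (complex.Re T); lra.
Qed.

(** Since [(j + h)^2 - j^2 = h^2 + 2 j h] is linear in [j], differencing leaves geometric sums at
    the angle [h * (2 * t)], and [x] survives only in a unimodular factor. The constant is 2 from
    differencing times 16 from [geom_sum_le_fejer]. *)
Definition weyl_majorant n t : R := 32 * \sum_(h < n) fejer_sum n (h%:R * (2 * t)).

Lemma weyl_majorant_ge0 n t : 0 <= weyl_majorant n t.
Proof. by rewrite mulr_ge0 // sumr_ge0 // => i _; exact: fejer_sum_ge0. Qed.

Lemma weyl_sum_le n x t :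
  normc (\sum_(i < n) cexp (i%:R * x + i%:R ^+ 2 * t)) ^+ 2 <= weyl_majorant n t.
Proof.
apply: le_trans (normc_sum_sqr_le n (fun i => cexp (i%:R * x + i%:R ^+ 2 * t))) _.
rewrite /weyl_majorant (_ : 32 = 2 * 16) -?mulrA ?ler_pM2l //; last by rewrite -natrM.
rewrite mulr_sumr; apply: ler_sum => h _.
have -> : \sum_(j < n - h) cexp ((j + h)%:R * x + (j + h)%:R ^+ 2 * t) *
    (cexp (j%:R * x + j%:R ^+ 2 * t))^* =
    cexp (h%:R * x + h%:R ^+ 2 * t) * geom_sum (n - h) (h%:R * (2 * t)).
  rewrite /geom_sum mulr_sumr; apply: eq_bigr => j _.
  by rewrite -cexpN -!cexpD; congr cexp; rewrite natrD; ring.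
rewrite normcM normc_cexp mul1r; apply: geom_sum_le_fejer; exact: leq_subr.
Qed.

(** For [|m| < P], divisibility by [P] means [m = 0], so [P] nodes detect equality of integers and
    not merely congruence. *)
Lemma cexp_orthogonality (P : nat) (m : int) : (`|m| < P)%N ->
  \sum_(b < P) cexp (m%:~R * (b%:R / P%:R) : R) = P%:R * (m == 0)%:R.
Proof.
move=> mP; have P0 : (0 < P)%N by exact: leq_ltn_trans mP.
have PR : P%:R != 0 :> R by rewrite pnatr_eq0 -lt0n.
have [->|m0] := eqVneq m 0.
  under eq_bigr do rewrite mul0r cexp0.
  by rewrite sumr_const card_ord mulr1.
have -> : \sum_(b < P) cexp (m%:~R * (b%:R / P%:R) : R) = geom_sum P (m%:~R / P%:R).
  by apply: eq_bigr => b _; congr cexp; rewrite mulrCA.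
rewrite mulr0; have := geom_sumE P (m%:~R / P%:R : R).
rewrite mulrCA divff // mulr1 cexp_int subrr => /eqP; rewrite mulf_eq0 subr_eq0.
case/orP => [|/eqP //]; rewrite eq_sym => /eqP h; exfalso; move: h; apply/eqP.
have key k : (0 < k < P)%N -> cexp (k%:R / P%:R : R) != 1.
  move=> /andP[k0 kP]; apply: cexp_neq1.
  by rewrite divr_gt0 ?ltr0n //= ltr_pdivrMr ?ltr0n // mul1r ltr_nat.
case: m mP m0 => k kP k0.
  by rewrite -pmulrn; apply: key; rewrite lt0n kP andbT.
rewrite NegzE rmorphN mulNr cexpN -(rmorph1 (@Num.conj R[i])) (inj_eq (can_inj (@conjCK _))).
by apply: (key k.+1); rewrite kP.
Qed.

Lemma normc_geom_sqr n x : (normc (geom_sum n x) ^+ 2)%:C =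
  \sum_(v < n) \sum_(w < n) cexp ((v%:R - w%:R) * x).
Proof.
rewrite normc_sqr_conj /geom_sum rmorph_sum /= big_distrlr /=.
apply: eq_bigr => v _; apply: eq_bigr => w _.
by rewrite -cexpN -cexpD mulrBl.
Qed.

(** The equation is [h (v - w) + h' (v' - w') = 0], with the negative terms moved across to stay in
    [nat]. *)
Definition collisions L L' h h' : nat :=
  \sum_(v < L) \sum_(w < L) \sum_(v' < L') \sum_(w' < L')
    (h * v + h' * v' == h * w + h' * w')%N.

(** Expanding the squares gives the frequencies [2 (h v + h' v' - h w - h' w')]. Each product is
    below [n ^ 2], so these stay below [4 * n ^ 2 <= P] in absolute value and no aliasing occurs. *)
Lemma sum_fejer_product n P L L' h h' : (4 * n ^ 2 <= P)%N -> (0 < n)%N ->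
  (L <= n)%N -> (L' <= n)%N -> (h < n)%N -> (h' < n)%N ->
  \sum_(b < P) normc (geom_sum L (h%:R * (2 * (b%:R / P%:R)) : R)) ^+ 2 *
      normc (geom_sum L' (h'%:R * (2 * (b%:R / P%:R)) : R)) ^+ 2 =
  P%:R * (collisions L L' h h')%:R.
Proof.
move=> nP n0 Ln L'n hn h'n; apply: (@complexI R).
rewrite rmorph_sum rmorphM /= !rmorph_nat.
under eq_bigr do rewrite rmorphM /= !normc_geom_sqr big_distrl /=.
rewrite exchange_big /= /collisions natr_sum mulr_sumr; apply: eq_bigr => v _.
under eq_bigr do rewrite big_distrl /=.
rewrite exchange_big /= natr_sum mulr_sumr; apply: eq_bigr => w _.
under eq_bigr do rewrite big_distrr /=.
rewrite exchange_big /= natr_sum mulr_sumr; apply: eq_bigr => v' _.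
under eq_bigr do rewrite big_distrr /=.
rewrite exchange_big /= natr_sum mulr_sumr; apply: eq_bigr => w' _.
pose m : int := 2 * ((h * v + h' * v')%N%:Z - (h * w + h' * w')%N%:Z).
have -> : (h * v + h' * v' == h * w + h' * w')%N = (m == 0).
  by rewrite mulf_eq0 /= subr_eq0 eqz_nat.
rewrite -cexp_orthogonality; last first.
  have := ltn_ord v; have := ltn_ord w; have := ltn_ord v'; have := ltn_ord w'.
  have b1 (a b c : nat) : (a < n)%N -> (b < c)%N -> (c <= n)%N -> (a * b < n ^ 2)%N.
    move=> an bc cn; rewrite expnS expn1; apply: ltn_mul => //; exact: leq_trans bc cn.
  move=> /(b1 _ _ _ h'n)/(_ L'n) q1 /(b1 _ _ _ h'n)/(_ L'n) q2.
  move=> /(b1 _ _ _ hn)/(_ Ln) q3 /(b1 _ _ _ hn)/(_ Ln) q4.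
  rewrite /m; move: q1 q2 q3 q4 nP; clear; lia.
apply: eq_bigr => b _; rewrite -cexpD; congr cexp.
rewrite /m !rmorphM /= !rmorphB /= -!pmulrn !natrD !natrM; ring.
Qed.

Lemma count_congruent n q m v : (0 < q)%N -> (n <= q * m)%N ->
  (\sum_(w < n) (w == v %[mod q]) <= m)%N.
Proof.
move=> q0 nm.
have lt (w : 'I_n) : (w %/ q < m)%N.
  by rewrite ltn_divLR // mulnC; exact: leq_trans (ltn_ord w) nm.
rewrite (sum_nat_bool_card (fun w => w == v %[mod q])).
rewrite -[leqRHS]card_ord -(card_in_imset (f := fun w => Ordinal (lt w))).
  exact: max_card.
move=> a b; rewrite !inE => /eqP am /eqP bm [ab]; apply: val_inj => /=.
by rewrite (divn_eq a q) (divn_eq b q) ab am bm.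
Qed.

(** As [h' > 0], each [w] admits at most one [w']. After division by the gcd, [h / g] is invertible
    modulo [q = h' / g], which forces [w] to be congruent to [v] modulo [q]. *)
Lemma count_collisions n h h' v v' : (0 < h')%N ->
  (\sum_(w < n) \sum_(w' < n) (h * v + h' * v' == h * w + h' * w')
     <= n %/ (h' %/ gcdn h h') + 1)%N.
Proof.
move=> h0; set g := gcdn h h'; set q := (h' %/ g)%N.
have g0 : (0 < g)%N by rewrite gcdn_gt0 h0 orbT.
have hg : h = (h %/ g * g)%N by rewrite divnK // dvdn_gcdl.
have h'g : h' = (q * g)%N by rewrite divnK // dvdn_gcdr.
have q0 : (0 < q)%N by move: h0; rewrite h'g muln_gt0 => /andP[].
have cop : coprime q (h %/ g).
  by rewrite /coprime -(eqn_pmul2r g0) mul1n muln_gcdl -h'g -hg gcdnC.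
apply: leq_trans (_ : \sum_(w < n) (w == v %[mod q]) <= _)%N; last first.
  by apply: count_congruent => //; rewrite addn1 mulnC ltnW // ltn_ceil.
apply: leq_sum => w _.
have sub1 : (\sum_(w' < n) (h * v + h' * v' == h * w + h' * w') <= 1)%N.
  rewrite (sum_nat_bool_card (fun w' : 'I_n => h * v + h' * v' == h * w + h' * w')%N).
  apply/card_le1_eqP => a b; rewrite !inE => /eqP ea /eqP eb; apply: val_inj => /=.
  apply/eqP; move: ea; rewrite eb => /eqP; rewrite eqn_add2l eqn_pmul2l // => /eqP ->.
have [//|ne] := boolP (w == v %[mod q]); rewrite leqn0 sum_nat_eq0.
apply/forallP => w'; apply/implyP => _; rewrite eqb0; apply: contra ne => /eqP e.
have e1 : (h %/ g * v + q * v' = h %/ g * w + q * w')%N.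
  apply/eqP; rewrite -(eqn_pmul2r g0) !mulnDl.
  by rewrite ![(_ * _ * g)%N]mulnAC -hg -h'g e.
have em : (h %/ g * w == h %/ g * v %[mod q])%N.
  rewrite -(modnMDl w' (h %/ g * w)%N) -(modnMDl v' (h %/ g * v)%N).
  by rewrite addnC (addnC (v' * q)%N) (mulnC w') (mulnC v') -e1.
case: (leqP v w) em => vw; last rewrite eq_sym [in X in _ -> X]eq_sym.
  by rewrite !eqn_mod_dvd ?leq_mul // -mulnBr Gauss_dvdr.
by rewrite !eqn_mod_dvd ?leq_mul ?(ltnW vw) // -mulnBr Gauss_dvdr.
Qed.

End weyl_sums.

(** * The second moment of the Weyl majorant *)

Section weyl_second_moment.
Context (R : realType).
Implicit Types (n h : nat).

Lemma leq_sum_widen m n (F : nat -> nat) : (m <= n)%N ->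
  (\sum_(i < m) F i <= \sum_(i < n) F i)%N.
Proof.
move=> mn; rewrite (big_ord_widen n F mn) big_mkcond /=.
by apply: leq_sum => i _; case: ifP.
Qed.

Lemma collisions_le n L L' h h' (B : nat) : (L <= n)%N -> (L' <= n)%N ->
  (forall v v', \sum_(w < n) \sum_(w' < n)
     (h * v + h' * v' == h * w + h' * w') <= B)%N ->
  (collisions L L' h h' <= L * L' * B)%N.
Proof.
move=> Ln L'n HB; rewrite /collisions.
have -> : (L * L' * B = \sum_(v < L) \sum_(v' < L') B)%N.
  by rewrite !sum_nat_const !card_ord mulnA.
apply: leq_sum => v _; rewrite exchange_big /=; apply: leq_sum => v' _.
apply: leq_trans (HB v v').
apply: leq_trans (_ : \sum_(w < L) \sum_(w' < n)
     (h * v + h' * v' == h * w + h' * w')%N <= _)%N.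
  by apply: leq_sum => w _; exact: (leq_sum_widen (fun w' => (h * v + h' * v' == h * w + h'
      * w')%N)).
exact: (leq_sum_widen (fun w => \sum_(w' < n) (h * v + h' * v' == h * w + h' * w'))%N).
Qed.

Definition harmonic_sum n : R := \sum_(L < n) L.+1%:R^-1.

Lemma harmonic_sum_ge1 n : (0 < n)%N -> 1 <= harmonic_sum n.
Proof.
case: n => // n _; rewrite /harmonic_sum big_ord_recl invr1 lerDl.
by apply: sumr_ge0 => i _; rewrite invr_ge0.
Qed.

(** This is the divisor function for [0 < h <= n]; the cutoff gives the finite value [n] at
    [h = 0]. *)
Definition divisor_count n h : nat := \sum_(q < n) (q.+1 %| h).

Lemma count_multiples n q m : (0 < q)%N -> (n <= q * m)%N ->
  (\sum_(h < n) (q %| h) <= m)%N.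
Proof.
move=> q0 nm; apply: leq_trans (count_congruent 0 q0 nm).
by apply: leq_sum => h _; rewrite mod0n.
Qed.

(** The gcd is one of the common divisors [q], hence at most their sum. Each [q] dividing [h] has
    [h / q] multiples below [h], so it contributes exactly [h] after exchanging the sums. *)
Lemma sum_gcdn_le n h : (0 < h <= n)%N ->
  (\sum_(k < h) gcdn k h <= h * divisor_count n h)%N.
Proof.
move=> /andP[h0 hn].
apply: (@leq_trans (\sum_(k < h) \sum_(q < n) q.+1 * ((q.+1 %| k) && (q.+1 %| h)))%N).
  apply: leq_sum => k _; have g0 : (0 < gcdn k h)%N by rewrite gcdn_gt0 h0 orbT.
  have gn : ((gcdn k h).-1 < n)%N.
    by rewrite prednK //; apply: leq_trans hn; apply: dvdn_leq; rewrite ?dvdn_gcdr.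
  rewrite (bigD1 (Ordinal gn)) //= prednK // dvdn_gcdl dvdn_gcdr muln1.
  exact: leq_addr.
rewrite exchange_big /= /divisor_count big_distrr /=; apply: leq_sum => q _.
have [/dvdnP[m hm]|_] := boolP (q.+1 %| h)%N; last first.
  by rewrite big1 // => k _; rewrite andbF muln0.
under eq_bigr do rewrite andbT.
rewrite -big_distrr /= muln1; apply: leq_trans (_ : q.+1 * m <= h)%N.
  by rewrite leq_mul2l /=; apply: count_multiples => //; rewrite hm mulnC.
by rewrite hm mulnC.
Qed.

(* For fixed [v] and [v'], the solutions of [h v + h' v' = h w + h' w'] lie on a
   progression of step [maxn h h' / gcdn h h']; no such gain is available for
   [h = h' = 0]. *)
Definition collision_bound n h h' : R :=
  if (h == 0%N) && (h' == 0%N) then n%:R ^+ 2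
  else n%:R * (gcdn h h')%:R / (maxn h h')%:R + 1.

Lemma collision_boundC n h h' : collision_bound n h h' = collision_bound n h' h.
Proof. by rewrite /collision_bound andbC gcdnC maxnC. Qed.

Lemma count_collisions_le_bound n h h' v v' :
  (\sum_(w < n) \sum_(w' < n) (h * v + h' * v' == h * w + h' * w')%N)%N%:R
    <= collision_bound n h h'.
Proof.
wlog hh : h h' v v' / (h <= h')%N.
  move=> H; case/orP: (leq_total h h') => [/H//|/H H'].
  rewrite collision_boundC; apply: le_trans (H' v' v).
  rewrite ler_nat exchange_big /=; apply: leq_sum => w _; apply: leq_sum => w' _.
  by rewrite addnC [X in _ == X]addnC.
rewrite /collision_bound; have [h'0|h'0] := posnP h'.
  move: hh; rewrite h'0 leqn0 => -> /=.
  rewrite -natrX ler_nat.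
  apply: leq_trans (_ : \sum_(w < n) \sum_(w' < n) 1 <= _)%N.
    by apply: leq_sum => w _; apply: leq_sum => w' _; exact: leq_b1.
  by rewrite !sum_nat_const !card_ord muln1.
rewrite andbF (maxn_idPr hh).
apply: le_trans (_ : (n %/ (h' %/ gcdn h h') + 1)%N%:R <= _).
  by rewrite ler_nat count_collisions.
rewrite natrD lerD2r.
have g0 : (0 < gcdn h h')%N by rewrite gcdn_gt0 h'0 orbT.
have h'g : h' = (h' %/ gcdn h h' * gcdn h h')%N by rewrite divnK // dvdn_gcdr.
set q := (h' %/ _)%N in h'g *.
have q0 : (0 < q)%N by move: h'0; rewrite {1}h'g muln_gt0 => /andP[].
have -> : n%:R * (gcdn h h')%:R / h'%:R = n%:R / q%:R :> R.
  have -> : h'%:R = q%:R * (gcdn h h')%:R :> R by rewrite -natrM -h'g.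
  by field; rewrite !pnatr_eq0 -!lt0n g0 q0.
by rewrite ler_pdivlMr ?ltr0n // -natrM ler_nat leq_divM.
Qed.

Lemma sum_symmetric n (F : nat -> nat -> R) : (forall h h', F h h' = F h' h) ->
  \sum_(h < n) \sum_(h' < n) F h h' =
  \sum_(h < n) (2 * \sum_(k < h) F k h + F h h).
Proof.
move=> FC; elim: n => [|n IH]; first by rewrite !big_ord0.
rewrite big_ord_recr [RHS]big_ord_recr /= -IH.
under eq_bigr do rewrite big_ord_recr /=.
rewrite big_split big_ord_recr /=.
under [X in _ + (X + _)]eq_bigr do rewrite FC.
ring.
Qed.

Lemma sum_collision_bound n : (0 < n)%N ->
  \sum_(h < n) \sum_(h' < n) collision_bound n h h' <=
  8 * n%:R ^+ 2 * harmonic_sum n.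
Proof.
move=> n0; rewrite (sum_symmetric _ (@collision_boundC n)).
have n1 : 1 <= n%:R :> R by rewrite ler1n.
have H1 := harmonic_sum_ge1 n0.
(* For [h > 0] the gcd terms on both sides of the diagonal give at most [2 n] times the divisor
   count; the units and the diagonal add [2 h + n + 1 <= 3 n]. *)
have step (h : 'I_n) : 2 * (\sum_(k < h) collision_bound n k h) + collision_bound n h h <=
   (if h == 0%N :> nat then n%:R ^+ 2 else 0) + (2 * n%:R * (divisor_count n h)%:R + 3 * n%:R).
  have [h0|h0] := eqVneq (h : nat) 0%N.
    rewrite h0 big_ord0 mulr0 add0r /collision_bound /= lerDl.
    by rewrite addr_ge0 ?mulr_ge0.
  have hpos : (0 < h)%N by rewrite lt0n.
  have hR : h%:R != 0 :> R by rewrite pnatr_eq0.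
  have -> : \sum_(k < h) collision_bound n k h =
     n%:R / h%:R * (\sum_(k < h) gcdn k h)%N%:R + h%:R.
    rewrite natr_sum mulr_sumr -[X in _ + X%:R]card_ord -sumr_const -big_split /=.
    apply: eq_bigr => k _; rewrite /collision_bound (negbTE h0) andbF.
    by rewrite (maxn_idPr (ltnW (ltn_ord k))); congr (_ + 1); rewrite mulrAC.
  rewrite /collision_bound (negbTE h0) /= gcdnn maxnn mulfK // add0r.
  have g1 : n%:R / h%:R * (\sum_(k < h) gcdn k h)%N%:R <= n%:R * (divisor_count n h)%:R :> R.
    rewrite -mulrA ler_pM2l ?ltr0n // mulrC ler_pdivrMr ?ltr0n // -natrM ler_nat mulnC.
    by apply: sum_gcdn_le; rewrite hpos ltnW.
  have : h%:R + 1 <= n%:R :> R by rewrite natr1 ler_nat.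
  move: g1; lra.
apply: le_trans (ler_sum _ (fun i _ => step i)) _.
rewrite big_split /= -big_mkcond /= [X in _ + X]big_split /=.
rewrite [X in _ + (_ + X)]sumr_const card_ord -mulr_sumr.
rewrite (big_pred1 (Ordinal n0)) //=.
(* Average order of the divisor function: [q] has at most [n / q + 1] multiples below [n]. The final
   constant is then 8 = 1 + 4 + 3. *)
have dc : \sum_(h < n) (divisor_count n h)%:R <= 2 * n%:R * harmonic_sum n.
  rewrite -natr_sum /divisor_count exchange_big /= natr_sum.
  have -> : 2 * n%:R * harmonic_sum n = n%:R * harmonic_sum n + n%:R * harmonic_sum n by ring.
  apply: (@le_trans _ _ (\sum_(q < n) (n%:R / q.+1%:R + 1))).
    apply: ler_sum => q _.
    apply: (@le_trans _ _ (n %/ q.+1 + 1)%N%:R).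
      by rewrite ler_nat; apply: count_multiples => //; rewrite addn1 mulnC ltnW // ltn_ceil.
    by rewrite natrD lerD2r ler_pdivlMr ?ltr0n // -natrM ler_nat leq_divM.
  rewrite big_split /= -mulr_sumr sumr_const card_ord lerD2l.
  by rewrite -[leLHS]mulr1 ler_pM2l ?ltr0n.
rewrite -mulr_sumr -[(3 * n%:R) *+ n]mulr_natr.
have : 2 * n%:R * \sum_(h < n) (divisor_count n h)%:R <= 2 * n%:R * (2 * n%:R * harmonic_sum n).
  by rewrite ler_pM2l // mulr_gt0 // ltr0n.
have : n%:R ^+ 2 <= n%:R ^+ 2 * harmonic_sum n by rewrite ler_peMr // sqr_ge0.
nra.
Qed.

Lemma sum_sqr_exchange (I : finType) P (F : I -> 'I_P -> R) :
  \sum_(b < P) (\sum_i F i b) ^+ 2 = \sum_i \sum_j \sum_(b < P) F i b * F j b.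
Proof.
under eq_bigr do rewrite expr2 big_distrlr /=.
by rewrite exchange_big /=; apply: eq_bigr => i _; rewrite exchange_big.
Qed.

(** Two of the harmonic factors come from the Fejer lengths: at most [L * L'] pairs [(v, v')]
    against the weight [1 / (L * L')^2]. The third comes from the divisors in [sum_collision_bound].
    The constant is [32^2 * 8]. *)
Lemma weyl_majorant_moment n P : (0 < n)%N -> (4 * n ^ 2 <= P)%N ->
  \sum_(b < P) weyl_majorant n (b%:R / P%:R : R) ^+ 2 <=
  2 ^+ 13 * P%:R * n%:R ^+ 2 * harmonic_sum n ^+ 3.
Proof.
move=> n0 nP.
under eq_bigr do rewrite /weyl_majorant exprMn.
rewrite -mulr_sumr sum_sqr_exchange.
have -> : 2 ^+ 13 * P%:R * n%:R ^+ 2 * harmonic_sum n ^+ 3 =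
   32 ^+ 2 * (P%:R * harmonic_sum n ^+ 2 * (8 * n%:R ^+ 2 * harmonic_sum n)) by ring.
rewrite ler_pM2l ?exprn_gt0 //.
apply: le_trans (ler_wpM2l _ (sum_collision_bound n0)); last first.
  by rewrite mulr_ge0 ?sqr_ge0.
rewrite mulr_sumr; apply: ler_sum => h _.
rewrite mulr_sumr; apply: ler_sum => h' _.
rewrite /fejer_sum; under eq_bigr do rewrite big_distrlr /=.
rewrite exchange_big /=.
have -> : P%:R * harmonic_sum n ^+ 2 * collision_bound n h h' = \sum_(L < n) \sum_(L' < n)
    P%:R * (collision_bound n h h' / L.+1%:R / L'.+1%:R).
  rewrite expr2 big_distrlr /= mulr_sumr mulr_suml; apply: eq_bigr => L _.
  by rewrite mulr_sumr mulr_suml; apply: eq_bigr => L' _; ring.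
apply: ler_sum => L _; rewrite exchange_big /=; apply: ler_sum => L' _.
have -> : \sum_(b < P)
   normc (geom_sum L.+1 (h%:R * (2 * (b%:R / P%:R)))) ^+ 2 / L.+1%:R ^+ 2 *
   (normc (geom_sum L'.+1 (h'%:R * (2 * (b%:R / P%:R)))) ^+ 2 / L'.+1%:R ^+ 2) =
   P%:R * ((collisions L.+1 L'.+1 h h')%:R / L.+1%:R ^+ 2 / L'.+1%:R ^+ 2) :> R.
  rewrite !mulrA -(@sum_fejer_product R n) // !mulr_suml; apply: eq_bigr => b _; ring.
rewrite ler_pM2l; last by rewrite ltr0n; apply: leq_trans nP; rewrite muln_gt0 /= expn_gt0 n0.
rewrite !ler_pdivrMr ?exprn_gt0 ?ltr0n //.
have cancel (c x y : R) : x != 0 -> y != 0 -> c / x / y * y ^+ 2 * x ^+ 2 = x * y * c.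
  by move=> x0 y0; field; rewrite x0 y0.
rewrite cancel ?pnatr_eq0 //.
(* [collisions_le] takes a natural bound; the counts being integers, rounding the real bound down
   loses nothing. *)
have [B [HB1 HB2]] : exists B : nat, (forall v v', \sum_(w < n) \sum_(w' < n)
     (h * v + h' * v' == h * w + h' * w') <= B)%N /\ B%:R <= collision_bound n h h'.
  exists (Num.truncn (collision_bound n h h')); split.
    move=> v v'; rewrite truncn_ge_nat; last first.
      by apply: le_trans (count_collisions_le_bound n h h' v v').
    exact: count_collisions_le_bound.
  by rewrite truncn_le // (le_trans _ (count_collisions_le_bound n h h' 0 0)).
apply: le_trans (_ : (L.+1 * L'.+1 * B)%N%:R <= _).
  by rewrite ler_nat; apply: (@collisions_le n).
by rewrite !natrM ler_wpM2l // mulr_ge0.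
Qed.

End weyl_second_moment.

(** * Hilbert-Schmidt duality *)

Section bounded_measurable.
Context d (T : measurableType d) (R : realType).
Implicit Types f g : T -> R.

(** On a probability space such functions form an algebra of integrable functions. All objects at a
    fixed scale belong to it, so linearity and Fubini need no separate integrability arguments. *)
Definition bmeas f := measurable_fun setT f /\ exists M : R, forall x, `|f x| <= M.

Lemma bmeas_measurable f : bmeas f -> measurable_fun setT f.
Proof. by case. Qed.

Lemma bmeas_cst r : bmeas (fun=> r).
Proof. by split; [exact: measurable_cst|exists `|r|]. Qed.

Lemma bmeasD f g : bmeas f -> bmeas g -> bmeas (fun x => f x + g x).
Proof.
move=> [mf [M fM]] [mg [N gN]]; split; first exact: measurable_funD.
by exists (M + N) => x; rewrite (le_trans (ler_normD _ _)) // lerD.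
Qed.

Lemma bmeasM f g : bmeas f -> bmeas g -> bmeas (fun x => f x * g x).
Proof.
move=> [mf [M fM]] [mg [N gN]]; split; first exact: measurable_funM.
by exists (M * N) => x; rewrite normrM ler_pM.
Qed.

Lemma bmeasZ r f : bmeas f -> bmeas (fun x => r * f x).
Proof. by apply: bmeasM; exact: bmeas_cst. Qed.

Lemma bmeasX f n : bmeas f -> bmeas (fun x => f x ^+ n).
Proof.
move=> bf; elim: n => [|n IH]; first exact: bmeas_cst.
by under eq_fun do rewrite exprS; exact: bmeasM.
Qed.

Lemma bmeas_sum I (r : seq I) (F : I -> T -> R) : (forall i, bmeas (F i)) ->
  bmeas (fun x => \sum_(i <- r) F i x).
Proof.
move=> bF; elim: r => [|i r IH].
  by under eq_fun do rewrite big_nil; exact: bmeas_cst.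
by under eq_fun do rewrite big_cons; exact: bmeasD.
Qed.

Lemma bmeas_prod I (r : seq I) (P : pred I) (F : I -> T -> R) : (forall i, bmeas (F i)) ->
  bmeas (fun x => \prod_(i <- r | P i) F i x).
Proof.
move=> bF; elim: r => [|i r IH].
  by under eq_fun do rewrite big_nil; exact: bmeas_cst.
under eq_fun do rewrite big_cons; case: (P i) => //; exact: bmeasM.
Qed.

Lemma bmeas_bigmax I (r : seq I) (F : I -> T -> R) : (forall i, bmeas (F i)) ->
  bmeas (fun x => \big[Num.max/0]_(i <- r) F i x).
Proof.
move=> bF; elim: r => [|i r [mr [M rM]]].
  by under eq_fun do rewrite big_nil; exact: bmeas_cst.
under eq_fun do rewrite big_cons.
have [mF [N FN]] := bF i; split; first exact: measurable_maxr.
exists (M + N) => x; have M0 : 0 <= M by apply: le_trans (rM x).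
have N0 : 0 <= N by apply: le_trans (FN x).
by case: (leP (F i x)) => _; [apply: (le_trans (rM x))|apply: (le_trans (FN x))];
  rewrite ?lerDl ?lerDr.
Qed.

Lemma bmeas_eq_indicator f g : bmeas f -> bmeas g -> bmeas (fun x => (f x == g x)%:R).
Proof.
move=> [mf _] [mg _]; split.
  have mb : measurable_fun setT (fun x => f x == g x) by exact: measurable_fun_eqr.
  have -> : (fun x => (f x == g x)%:R : R) = (fun x => if f x == g x then 1 else 0).
    by apply/funext => x; case: (f x == g x).
  by apply: measurable_fun_ifT => //; exact: measurable_cst.
by exists 1 => x; case: (f x == g x); rewrite ?normr1 ?normr0.
Qed.

Variable mu : probability T R.

Lemma bmeas_integrable f : bmeas f -> mu.-integrable setT (EFin \o f).
Proof.
move=> [mf [M fM]].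
apply: (@le_integrable _ _ _ mu setT _ (EFin \o f) (EFin \o cst M)) => //.
- exact/measurable_EFinP.
- by move=> x _ /=; rewrite lee_fin (le_trans (fM x)) ?ler_norm.
- exact: finite_measure_integrable_cst.
Qed.

Lemma EFin_Rint f : bmeas f -> ((\int[mu]_x f x)%:E = \int[mu]_x (f x)%:E)%E.
Proof.
move=> bf; rewrite /Rintegral fineK //.
exact: integrable_fin_num (bmeas_integrable bf).
Qed.

Lemma RintD f g : bmeas f -> bmeas g ->
  \int[mu]_x (f x + g x) = \int[mu]_x f x + \int[mu]_x g x.
Proof. by move=> bf bg; apply: RintegralD => //; exact: bmeas_integrable. Qed.

Lemma RintZ r f : bmeas f -> \int[mu]_x (r * f x) = r * \int[mu]_x f x.
Proof. by move=> bf; apply: RintegralZl => //; exact: bmeas_integrable. Qed.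

Lemma Rint_cst r : \int[mu]_x (cst r x) = r.
Proof.
rewrite Rintegral_cst // [X in fine X](_ : _ = 1%E) ?mulr1 //.
exact: probability_setT.
Qed.

Lemma Rint_sum I (r : seq I) (F : I -> T -> R) : (forall i, bmeas (F i)) ->
  \int[mu]_x (\sum_(i <- r) F i x) = \sum_(i <- r) \int[mu]_x F i x.
Proof.
move=> bF; elim: r => [|i r IH].
  under eq_Rintegral do rewrite big_nil.
  by rewrite big_nil (Rint_cst 0).
under eq_Rintegral do rewrite big_cons.
by rewrite big_cons RintD // ?IH //; exact: bmeas_sum.
Qed.

Lemma Rint_le f g : bmeas f -> bmeas g -> (forall x, f x <= g x) ->
  \int[mu]_x f x <= \int[mu]_x g x.
Proof. by move=> bf bg fg; apply: le_Rintegral => //; exact: bmeas_integrable. Qed.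

Lemma Rint_ge0 f : (forall x, 0 <= f x) -> 0 <= \int[mu]_x f x.
Proof. by move=> f0; apply: Rintegral_ge0. Qed.

End bounded_measurable.

Section bounded_measurable_product.
Context d (T : measurableType d) d' (T' : measurableType d') (R : realType).
Variables (mu : probability T R) (nu : probability T' R).

Lemma bmeas_comp (g : T -> T') (f : T' -> R) :
  measurable_fun setT g -> bmeas f -> bmeas (fun x => f (g x)).
Proof.
move=> mg [mf [M fM]]; split; first exact: (measurableT_comp mf mg).
by exists M => x.
Qed.

Variable h : T * T' -> R.
Hypothesis bh : bmeas h.

Lemma bmeas_section1 x : bmeas (fun y => h (x, y)).
Proof.
case: bh => mh [M hM]; split; last by exists M => y.
exact: (measurableT_comp mh (pair1_measurable x)).
Qed.

Lemma bmeas_section2 y : bmeas (fun x => h (x, y)).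
Proof.
case: bh => mh [M hM]; split; last by exists M => x.
exact: (measurableT_comp mh (pair2_measurable y)).
Qed.

Lemma Rint_norm_le (f : T' -> R) M : bmeas f -> (forall y, `|f y| <= M) ->
  `|\int[nu]_y f y| <= M.
Proof.
move=> bf fM; rewrite ler_norml; apply/andP; split.
  rewrite -(Rint_cst nu (- M)); apply: Rint_le => // [|y]; first exact: bmeas_cst.
  by have := fM y; rewrite ler_norml => /andP[].
rewrite -(Rint_cst nu M); apply: Rint_le => // [|y]; first exact: bmeas_cst.
by have := fM y; rewrite ler_norml => /andP[].
Qed.

Lemma bmeas_Rint : bmeas (fun x => \int[nu]_y h (x, y)).
Proof.
case: (bh) => mh [M hM]; split; last first.
  by exists M => x; apply: Rint_norm_le => //; exact: bmeas_section1.
apply: (measurableT_comp (fine_measurable measurableT)) => //.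
apply: (@measurable_fubini_F _ _ _ _ R mu nu (fun z => (h z)%:E)).
exact: (bmeas_integrable (mu \x nu)%E bh).
Qed.

End bounded_measurable_product.

Section bounded_measurable_swap.
Context d (T : measurableType d) d' (T' : measurableType d') (R : realType).
Variables (mu : probability T R) (nu : probability T' R).
Variable h : T * T' -> R.
Hypothesis bh : bmeas h.

Lemma bmeas_Rint_swap :
  \int[mu]_x \int[nu]_y h (x, y) = \int[nu]_y \int[mu]_x h (x, y).
Proof.
rewrite /Rintegral; congr fine.
transitivity (\int[mu]_x \int[nu]_y (h (x, y))%:E)%E.
  by apply: eq_integral => x _; rewrite -(EFin_Rint nu (bmeas_section1 bh x)).
rewrite (Fubini (bmeas_integrable (mu \x nu)%E bh)).
by apply: eq_integral => y _; rewrite -(EFin_Rint mu (bmeas_section2 bh y)).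
Qed.

End bounded_measurable_swap.

Section hilbert_schmidt.
Context d (X : measurableType d) (R : realType) (mu : probability X R).
Context (I K : finType) (J : nat).
Variables (e : I -> K -> X -> R) (G : 'I_J -> K -> R) (lam : 'I_J -> R).
Variables (kappa : X * X -> R) (B : R).
Hypothesis be : forall i k, bmeas (e i k).
Hypothesis bessel : forall phi : K -> R,
  \sum_j (\sum_k phi k * G j k) ^+ 2 <= \sum_k phi k ^+ 2.
Hypothesis bkappa : bmeas kappa.
Hypothesis kappaC : forall x y, kappa (x, y) = kappa (y, x).
Hypothesis kappa_ge : forall i l x y,
  (\sum_k e i k x * e l k y) ^+ 2 <= kappa (x, y).
Hypothesis kappa_int : forall x, \int[mu]_y kappa (x, y) <= B.
Hypothesis kappa0 : forall z, 0 <= kappa z.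

(** This is the quadratic form of the finite-rank operator [\sum_j lam j G_j (x) G_j] at the vector
    [e i _ x]. *)
Definition density (i : I) (x : X) : R := \sum_j lam j * (\sum_k G j k * e i k x) ^+ 2.

Lemma bmeas_density i : bmeas (density i).
Proof.
apply: bmeas_sum => j; apply: bmeasZ; apply: bmeasX; apply: bmeas_sum => k.
exact: bmeasZ.
Qed.

Lemma cauchy_schwarz (S : finType) (a b : S -> R) :
  (\sum_i a i * b i) ^+ 2 <= (\sum_i a i ^+ 2) * (\sum_i b i ^+ 2).
Proof.
set A := \sum_i a i ^+ 2; set C := \sum_i b i ^+ 2; set D := \sum_i a i * b i.
have quad t : 0 <= A * t ^+ 2 - 2 * D * t + C.
  have -> : A * t ^+ 2 - 2 * D * t + C = \sum_i (a i * t - b i) ^+ 2.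
    rewrite /A /C /D mulr_sumr !mulr_suml -sumrB -big_split /=.
    by apply: eq_bigr => i _; ring.
  by apply: sumr_ge0 => i _; exact: sqr_ge0.
have A0 : 0 <= A by apply: sumr_ge0 => i _; exact: sqr_ge0.
have [A0'|An0] := eqVneq A 0.
  have D0 : D = 0.
    rewrite /D big1 // => i _; have : a i ^+ 2 = 0.
      move: A0' => /eqP; rewrite /A psumr_eq0 => [/allP/(_ i)|k _]; last exact: sqr_ge0.
      by rewrite mem_index_enum => /(_ isT) /eqP.
    by move=> /eqP; rewrite sqrf_eq0 => /eqP ->; rewrite mul0r.
  by rewrite D0 A0' mul0r expr0n.
have Ap : 0 < A by rewrite lt0r An0.
have := quad (D / A).
have -> : A * (D / A) ^+ 2 - 2 * D * (D / A) + C = (A * C - D ^+ 2) / A.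
  by field.
by rewrite pmulr_lge0 ?invr_gt0 // subr_ge0.
Qed.

Variable psi : I -> X -> R.
Hypothesis bpsi : forall i, bmeas (psi i).
Hypothesis psi0 : forall i x, 0 <= psi i x.
Let g x := \sum_i psi i x.
Let M k l := \sum_i \int[mu]_x (psi i x * (e i k x * e i l x)).

Let bg : bmeas g. Proof. by apply: bmeas_sum. Qed.
Let g0 x : 0 <= g x. Proof. by apply: sumr_ge0. Qed.

(** By [2 g(x) g(y) <= g(x)^2 + g(y)^2], each half leaves the kernel to be integrated in the other
    variable, where its mass is at most [B]; the second half uses the symmetry of [kappa]. *)
Lemma Rint_schur : \int[mu]_x (g x * \int[mu]_y (g y * kappa (x, y))) <=
  B * \int[mu]_x g x ^+ 2.
Proof.
have bk2 : bmeas (fun z : X * X => g z.2 * kappa z).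
  by apply: bmeasM => //; apply: (bmeas_comp _ bg); exact: measurable_snd.
have bk3 : bmeas (fun z : X * X => g z.2 ^+ 2 * kappa z).
  by apply: bmeasM => //; apply: (bmeas_comp _ (bmeasX 2 bg)); exact: measurable_snd.
have bI := bmeas_Rint mu mu bk2; have bI2 := bmeas_Rint mu mu bk3.
have kx x : bmeas (fun y => kappa (x, y)) by exact: bmeas_section1.
have ky y : bmeas (fun x => kappa (x, y)) by exact: bmeas_section2.
have bg2 : bmeas (fun x => g x ^+ 2) by exact: bmeasX.
have pw x : g x * \int[mu]_y (g y * kappa (x, y)) <=
    2^-1 * B * g x ^+ 2 + 2^-1 * \int[mu]_y (g y ^+ 2 * kappa (x, y)).
  rewrite -RintZ; last exact: bmeasM.
  apply: (@le_trans _ _ (\int[mu]_y (2^-1 * g x ^+ 2 * kappa (x, y) +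
      2^-1 * (g y ^+ 2 * kappa (x, y))))).
    apply: Rint_le => [||y]; first by apply: bmeasZ; exact: bmeasM.
      by apply: bmeasD; [exact: bmeasZ|apply: bmeasZ; exact: bmeasM].
    rewrite -subr_ge0 (_ : _ - _ = 2^-1 * (g x - g y) ^+ 2 * kappa (x, y)); last by field.
    by apply: mulr_ge0 => //; apply: mulr_ge0; rewrite ?invr_ge0 ?sqr_ge0.
  rewrite RintD; [|exact: bmeasZ|by apply: bmeasZ; exact: bmeasM].
  rewrite !RintZ //; last exact: bmeasM.
  by rewrite lerD2r mulrAC ler_wpM2r ?sqr_ge0 // ler_wpM2l // invr_ge0.
apply: le_trans (Rint_le mu _ _ pw) _.
- exact: bmeasM.
- by apply: bmeasD; exact: bmeasZ.
rewrite RintD; [|exact: bmeasZ|exact: bmeasZ].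
rewrite !RintZ // (bmeas_Rint_swap mu mu bk3) /=.
have : \int[mu]_y \int[mu]_x (g y ^+ 2 * kappa (x, y)) <= B * \int[mu]_x g x ^+ 2.
  rewrite -RintZ //; apply: Rint_le => [||y].
  - apply: (@bmeas_Rint _ _ _ _ R mu mu (fun z => g z.1 ^+ 2 * kappa (z.2, z.1))).
    apply: bmeasM; first by apply: (bmeas_comp _ bg2); exact: measurable_fst.
    by apply: bmeas_comp bkappa; exact: measurable_swap.
  - exact: bmeasZ.
  rewrite RintZ // mulrC ler_wpM2r ?sqr_ge0 //.
  by under eq_Rintegral do rewrite kappaC.
lra.
Qed.

Let bpsie i k l : bmeas (fun x => psi i x * (e i k x * e i l x)).
Proof. by apply: bmeasM => //; exact: bmeasM. Qed.

(** Expanding one factor [M k l] inside the integral turns the Hilbert-Schmidt norm into a double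
    integral of [psi i x * psi i' y] against the squared inner products. The bound [kappa] does not
    depend on [i] and [i'], so the weights add up to [g] in each variable. *)
Lemma hs_norm_le : \sum_k \sum_l M k l ^+ 2 <= B * \int[mu]_x g x ^+ 2.
Proof.
have bk2 : bmeas (fun z : X * X => g z.2 * kappa z).
  by apply: bmeasM => //; apply: (bmeas_comp _ bg); exact: measurable_snd.
have bI := bmeas_Rint mu mu bk2.
have bq i : bmeas (fun x => \sum_k \sum_l M k l * (e i k x * e i l x)).
  by apply: bmeas_sum => k; apply: bmeas_sum => l; apply: bmeasZ; exact: bmeasM.
have q_le i x : \sum_k \sum_l M k l * (e i k x * e i l x) <= \int[mu]_y (g y * kappa (x, y)).
  have -> : \sum_k \sum_l M k l * (e i k x * e i l x) =
     \int[mu]_y (\sum_i' psi i' y * (\sum_k e i k x * e i' k y) ^+ 2).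
    rewrite Rint_sum; last first.
      move=> i'; apply: bmeasM => //; apply: bmeasX; apply: bmeas_sum => k; exact: bmeasZ.
    transitivity (\sum_i' \sum_k \sum_l
        (e i k x * e i l x) * \int[mu]_y (psi i' y * (e i' k y * e i' l y))).
      rewrite [RHS]exchange_big /=; apply: eq_bigr => k _.
      rewrite [RHS]exchange_big /=; apply: eq_bigr => l _.
      by rewrite /M mulr_suml; apply: eq_bigr => i' _; rewrite mulrC.
    apply: eq_bigr => i' _; rewrite (@eq_Rintegral _ _ _ mu setT (fun y => \sum_k \sum_l
        (e i k x * e i l x) * (psi i' y * (e i' k y * e i' l y)))); last first.
      move=> y _; rewrite expr2 big_distrlr mulr_sumr /=; apply: eq_bigr => k _.
      by rewrite mulr_sumr; apply: eq_bigr => l _; ring.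
    rewrite Rint_sum; last by move=> k; apply: bmeas_sum => l; exact: bmeasZ.
    apply: eq_bigr => k _; rewrite Rint_sum; last by move=> l; exact: bmeasZ.
    by apply: eq_bigr => l _; rewrite RintZ.
  apply: Rint_le => [||y].
  - apply: bmeas_sum => i'; apply: bmeasM => //; apply: bmeasX; apply: bmeas_sum => k;
      exact: bmeasZ.
  - exact: (bmeas_section1 bk2).
  - by rewrite /g mulr_suml; apply: ler_sum => i' _; rewrite ler_wpM2l.
apply: le_trans Rint_schur.
have -> : \sum_k \sum_l M k l ^+ 2 =
   \int[mu]_x (\sum_i psi i x * \sum_k \sum_l M k l * (e i k x * e i l x)).
  rewrite Rint_sum; last by move=> i; exact: bmeasM.
  transitivity (\sum_i \sum_k \sum_l M k l * \int[mu]_x (psi i x * (e i k x * e i l x))).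
    rewrite [RHS]exchange_big /=; apply: eq_bigr => k _.
    rewrite [RHS]exchange_big /=; apply: eq_bigr => l _.
    by rewrite expr2 {2}/M mulr_sumr.
  apply: eq_bigr => i _; rewrite (@eq_Rintegral _ _ _ mu setT (fun x => \sum_k \sum_l
      M k l * (psi i x * (e i k x * e i l x)))); last first.
    move=> x _; rewrite mulr_sumr; apply: eq_bigr => k _.
    by rewrite mulr_sumr; apply: eq_bigr => l _; ring.
  rewrite Rint_sum; last by move=> k; apply: bmeas_sum => l; exact: bmeasZ.
  apply: eq_bigr => k _; rewrite Rint_sum; last by move=> l; exact: bmeasZ.
  by apply: eq_bigr => l _; rewrite RintZ.
apply: Rint_le => [||x]; [by apply: bmeas_sum => i; exact: bmeasM|exact: bmeasM|].
by rewrite /g mulr_suml; apply: ler_sum => i _; rewrite ler_wpM2l.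
Qed.

(** The tested density is [\sum_j lam j <G_j, M G_j>]. After Cauchy-Schwarz in [j], [|G_j| <= 1]
    reduces each term to [|M G_j|^2], and Bessel's inequality applied to every row of [M] sums these
    to at most the Hilbert-Schmidt norm squared. *)
Lemma hs_duality : (\sum_i \int[mu]_x (psi i x * density i x)) ^+ 2 <=
  (\sum_j lam j ^+ 2) * (B * \int[mu]_x g x ^+ 2).
Proof.
pose a j := \sum_k G j k * \sum_l M k l * G j l.
have -> : \sum_i \int[mu]_x (psi i x * density i x) = \sum_j lam j * a j.
  transitivity (\sum_i \sum_j \sum_k \sum_l lam j * (G j k * G j l) *
      \int[mu]_x (psi i x * (e i k x * e i l x))).
    apply: eq_bigr => i _; rewrite (@eq_Rintegral _ _ _ mu setT (fun x => \sum_j \sum_k \sum_l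
        lam j * (G j k * G j l) * (psi i x * (e i k x * e i l x)))); last first.
      move=> x _; rewrite /density mulr_sumr; apply: eq_bigr => j _.
      rewrite expr2 big_distrlr !mulr_sumr /=; apply: eq_bigr => k _.
      by rewrite !mulr_sumr; apply: eq_bigr => l _; ring.
    rewrite Rint_sum; last first.
      by move=> j; apply: bmeas_sum => k; apply: bmeas_sum => l; exact: bmeasZ.
    apply: eq_bigr => j _; rewrite Rint_sum; last first.
      by move=> k; apply: bmeas_sum => l; exact: bmeasZ.
    apply: eq_bigr => k _; rewrite Rint_sum; last by move=> l; exact: bmeasZ.
    by apply: eq_bigr => l _; rewrite RintZ.
  rewrite exchange_big /=; apply: eq_bigr => j _.
  rewrite exchange_big /= /a mulr_sumr; apply: eq_bigr => k _.
  rewrite exchange_big /= !mulr_sumr; apply: eq_bigr => l _.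
  by rewrite /M -mulr_sumr; ring.
apply: le_trans (cauchy_schwarz _ _) _.
rewrite ler_wpM2l //; first by apply: sumr_ge0 => j _; exact: sqr_ge0.
apply: le_trans hs_norm_le.
(* Bessel's inequality tested on [G j] itself yields [s ^ 2 <= s]. *)
have G1 j : \sum_k G j k ^+ 2 <= 1.
  have := bessel (G j); set s := \sum_k G j k ^+ 2 => h.
  have s0 : 0 <= s by apply: sumr_ge0 => k _; exact: sqr_ge0.
  have : s ^+ 2 <= s.
    apply: le_trans h; rewrite (bigD1 j) //= -[leLHS]addr0 lerD //.
    by apply: sumr_ge0 => i _; exact: sqr_ge0.
  nra.
apply: (@le_trans _ _ (\sum_j \sum_k (\sum_l M k l * G j l) ^+ 2)).
  apply: ler_sum => j _; apply: le_trans (cauchy_schwarz _ _) _.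
  rewrite -[leRHS]mul1r ler_wpM2r //.
  by apply: sumr_ge0 => k _; exact: sqr_ge0.
rewrite exchange_big /=; apply: ler_sum => k _; exact: bessel.
Qed.

End hilbert_schmidt.

Section hilbert_schmidt_max.
Context d (X : measurableType d) (R : realType) (mu : probability X R).
Context (P : nat) (K : finType) (J : nat).
Variables (e : 'I_P -> K -> X -> R) (G : 'I_J -> K -> R) (lam : 'I_J -> R).
Variables (kappa : X * X -> R) (B : R).

(* The maximum is linearised by the disjoint sets on which the [i]-th density is
   the first one attaining it. *)
Lemma hs_maximal :
  (forall i k, bmeas (e i k)) ->
  (forall phi : K -> R, \sum_j (\sum_k phi k * G j k) ^+ 2 <= \sum_k phi k ^+ 2) ->
  bmeas kappa -> (forall x y, kappa (x, y) = kappa (y, x)) ->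
  (forall i l x y, (\sum_k e i k x * e l k y) ^+ 2 <= kappa (x, y)) ->
  (forall x, \int[mu]_y kappa (x, y) <= B) ->
  (forall z, 0 <= kappa z) -> (forall j, 0 <= lam j) ->
  \int[mu]_x (\big[Num.max/0]_i density e G lam i x) ^+ 2 <= B * \sum_j lam j ^+ 2.
Proof.
move=> be bessel bk kC kge kint k0 lam0.
have B0 : 0 <= B.
  by apply: le_trans (kint point); apply: Rint_ge0.
have rho0 i x : 0 <= density e G lam i x.
  by apply: sumr_ge0 => j _; rewrite mulr_ge0 ?sqr_ge0.
have brho i := bmeas_density G lam be i.
set g := fun x => \big[Num.max/0]_i density e G lam i x.
have bg : bmeas g by exact: bmeas_bigmax.
pose a i x : R := (density e G lam i x == g x)%:R.
have ba i : bmeas (a i) by exact: bmeas_eq_indicator.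
pose psi (i : 'I_P) x := g x * (a i x * \prod_(j < P | (j < i)%N) (1 - a j x)).
have g0 x : 0 <= g x.
  by rewrite /g; elim/big_ind: _ => // u v u0 v0; rewrite le_max u0.
have a01 i x : 0 <= 1 - a i x by rewrite /a; case: (_ == _); rewrite ?subrr ?subr0.
have bpsi i : bmeas (psi i).
  apply: bmeasM => //; apply: bmeasM => //; apply: bmeas_prod => j.
  apply: bmeasD; first exact: bmeas_cst.
  by under eq_fun do rewrite -mulN1r; exact: bmeasZ.
have psi0 i x : 0 <= psi i x.
  by rewrite !mulr_ge0 // prodr_ge0.
have sum_psi x : \sum_i psi i x = g x.
  rewrite /psi -mulr_sumr.
  (* The selectors telescope: the product on the right vanishes as soon as one density attains the
     maximum. *)
  have -> : \sum_(i < P) a i x * \prod_(j < P | (j < i)%N) (1 - a j x) =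
      1 - \prod_(i < P) (1 - a i x).
    pose b n := if insub n is Some i then a i x else 0.
    have bE (i : 'I_P) : a i x = b i by rewrite /b valK.
    have prodE n : (n <= P)%N -> \prod_(j < P | (j < n)%N) (1 - a j x) = \prod_(j < n) (1 - b j).
      move=> nP; rewrite (big_ord_widen P (fun j => 1 - b j) nP).
      by apply: eq_bigr => j _; rewrite bE.
    transitivity (\sum_(i < P) b i * \prod_(j < i) (1 - b j)).
      by apply: eq_bigr => i _; rewrite bE prodE // ltnW.
    under [in RHS]eq_bigr do rewrite bE.
    elim: (P) => [|n IH]; first by rewrite !big_ord0 subrr.
    by rewrite !big_ord_recr /= IH; ring.
  (* The maximum starts from 0, so it is attained or equal to 0; in the latter case both sides
     vanish. *)
  have [[i gi]|g00] : (exists i, density e G lam i x = g x) \/ g x = 0.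
    rewrite /g; elim/big_ind: _ => [|u v|i _]; [by right| |by left; exists i].
    by move=> hu hv; case: (leP u v).
  - have ai : a i x = 1 by rewrite /a gi eqxx.
    by rewrite (bigD1 i) //= ai subrr mul0r subr0 mulr1.
  - by rewrite g00 mul0r.
have key := hs_duality (mu := mu) lam be bessel bk kC kge kint k0 bpsi psi0.
have E : \sum_i \int[mu]_x (psi i x * density e G lam i x) = \int[mu]_x g x ^+ 2.
  rewrite -Rint_sum; last by move=> i; exact: bmeasM.
  apply: eq_Rintegral => x _; rewrite expr2 -{1}sum_psi mulr_suml; apply: eq_bigr => i _.
  rewrite /psi /a; case: eqP => [->//|_]; by rewrite mul0r mulr0 !mul0r.
move: key; rewrite E; under [X in _ <= _ * (_ * X) -> _]eq_Rintegral do rewrite sum_psi.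
set W := \int[mu]_x _; set S := \sum_j _ => key.
have W0 : 0 <= W by apply: Rint_ge0 => x; exact: sqr_ge0.
have S0 : 0 <= S by apply: sumr_ge0 => j _; exact: sqr_ge0.
(* With this choice of weights the duality reads [W ^ 2 <= S * (B * W)], and one factor [W]
   cancels. *)
have [->|Wn0] := eqVneq W 0; first by rewrite mulr_ge0.
have Wp : 0 < W by rewrite lt0r Wn0.
by rewrite -(ler_pM2r Wp) -expr2; apply: le_trans key _; rewrite mulrCA mulrA.
Qed.

End hilbert_schmidt_max.

(** * Sampling in time *)

Section sampling.
Context (R : realType).
Implicit Types (t th : R).

Lemma cauchy_schwarz_weight (S : finType) (q x : S -> R) : (forall i, 0 <= q i) ->
  (\sum_i q i * x i) ^+ 2 <= (\sum_i q i) * (\sum_i q i * x i ^+ 2).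
Proof.
move=> q0; have := cauchy_schwarz (fun i => Num.sqrt (q i)) (fun i => Num.sqrt (q i) * x i).
have sq i : Num.sqrt (q i) * Num.sqrt (q i) = q i by rewrite -expr2 sqr_sqrtr.
under eq_bigr do rewrite mulrA sq.
under [X in _ <= X * _]eq_bigr do rewrite expr2 sq.
by under [X in _ <= _ * X]eq_bigr do rewrite exprMn expr2 sq.
Qed.

Lemma geom_sumN n th : geom_sum n (- th) = (geom_sum n th)^*.
Proof.
by rewrite /geom_sum rmorph_sum /=; apply: eq_bigr => i _; rewrite mulrN cexpN.
Qed.

Lemma sum_geom_sum_sqr n P t : (n <= P)%N ->
  \sum_(b < P) normc (geom_sum n (t - b%:R / P%:R)) ^+ 2 = P%:R * n%:R.
Proof.
move=> nP; apply: (@complexI R); rewrite rmorph_sum rmorphM /= !rmorph_nat.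
under eq_bigr do rewrite normc_geom_sqr.
rewrite exchange_big /= -[in RHS](card_ord n) -sumr_const mulr_sumr.
apply: eq_bigr => v _; rewrite exchange_big /=.
transitivity (\sum_(w < n) cexp ((v%:R - w%:R) * t) *
   \sum_(b < P) cexp ((w%:Z - v%:Z)%:~R * (b%:R / P%:R) : R)).
  apply: eq_bigr => w _; rewrite mulr_sumr; apply: eq_bigr => b _.
  by rewrite -cexpD; congr cexp; rewrite rmorphB /= -!pmulrn; ring.
rewrite (bigD1 v) //= [X in _ + X]big1 ?addr0 => [|w wv].
  rewrite cexp_orthogonality; last by rewrite subrr (leq_ltn_trans (leq0n v)) // (leq_trans
      (ltn_ord v)).
  by rewrite !subrr eqxx mul0r cexp0 mul1r mulr1.
rewrite cexp_orthogonality; last by have := ltn_ord v; have := ltn_ord w; lia.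
by rewrite subr_eq0 eqz_nat (inj_eq (@ord_inj n)) (negbTE wv) !mulr0.
Qed.

Section kernel.
Variables (D P : nat) (t : R).
Hypothesis DP : (D.*2.+1 <= P)%N.

(* The Fourier coefficient of [V] at every frequency in [0, D] is 1. *)
Let V th : R[i] := geom_sum D.+1 (- th) * geom_sum D.*2.+1 th / D.+1%:R.
Let q (b : 'I_P) := normc (V (t - b%:R / P%:R)).

(** After expanding [V], the sum over the nodes retains only [c = m + a]. For each of the [D + 1]
    values of [a] there is exactly one such [c], because [m + a <= 2 D]; hence the normalisation of
    [V]. *)
Lemma sampling_reproduces m : (m <= D)%N ->
  cexp (m%:R * t) = P%:R^-1 * \sum_(b < P) cexp (m%:R * (b%:R / P%:R)) * V (t - b%:R / P%:R).
Proof.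
move=> mD; have P0 : P%:R != 0 :> R[i] by rewrite pnatr_eq0 -lt0n; exact: leq_trans DP.
have L0 : D.+1%:R != 0 :> R[i] by rewrite pnatr_eq0.
apply: (mulfI P0); rewrite mulrA divff // mul1r.
apply: (mulIf L0); rewrite mulr_suml.
transitivity (\sum_(a < D.+1) \sum_(c < D.*2.+1) cexp ((c%:R - a%:R) * t) *
   \sum_(b < P) cexp (((m + a)%N%:Z - c%:Z)%:~R * (b%:R / P%:R) : R)).
  transitivity (\sum_(a < D.+1) P%:R * cexp (m%:R * t)).
    by rewrite sumr_const card_ord mulr_natr.
  apply: eq_bigr => a _.
  have maD : (m + a < D.*2.+1)%N.
    by rewrite ltnS -addnn leq_add // -ltnS ltn_ord.
  rewrite (bigD1 (Ordinal maD)) //= [X in _ + X]big1 ?addr0 => [|c ca].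
    rewrite subrr cexp_orthogonality ?mulr1; last exact: leq_trans DP.
    by rewrite mulrC natrD addrK.
  rewrite cexp_orthogonality; last by have := ltn_ord c; have := maD; have := DP; lia.
  rewrite subr_eq0 eqz_nat (_ : (m + a == c)%N = false) ?mulr0 //.
  by apply/negbTE; apply: contra ca => /eqP h; apply/eqP/val_inj.
symmetry; under eq_bigr do rewrite /V mulrA divfK // /geom_sum big_distrlr mulr_sumr /=.
rewrite exchange_big /=; apply: eq_bigr => a _.
under eq_bigr do rewrite mulr_sumr.
rewrite exchange_big /=; apply: eq_bigr => c _.
rewrite mulr_sumr; apply: eq_bigr => b _; rewrite -!cexpD; congr cexp.
by rewrite rmorphB /= -!pmulrn natrD; ring.
Qed.

(** This is a kernel of de la Vallee-Poussin type, whose mean modulus stays bounded. By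
    [2 x y <= x^2 + y^2] and discrete Parseval the mean is at most [((D + 1) + (2 D + 1)) / (2 (D +
    1)) <= 3 / 2]. *)
Lemma sampling_weight_le : P%:R^-1 * \sum_b q b <= 3 / 2.
Proof.
have P0 : 0 < P%:R :> R by rewrite ltr0n; exact: leq_trans DP.
rewrite mulrC ler_pdivrMr //.
have qle b : q b <= (2 * D.+1%:R)^-1 * (normc (geom_sum D.+1 (t - b%:R / P%:R)) ^+ 2 +
    normc (geom_sum D.*2.+1 (t - b%:R / P%:R)) ^+ 2).
  rewrite /q /V !normcM normcV normc_nat geom_sumN normc_conj.
  set x := normc _; set y := normc _.
  rewrite [leRHS]mulrC invfM mulrA ler_pM2r ?invr_gt0 ?ltr0n //.
  have := sqr_ge0 (x - y); lra.
apply: le_trans (ler_sum _ (fun b _ => qle b)) _.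
rewrite -mulr_sumr big_split /= !sum_geom_sum_sqr //; last first.
  by apply: leq_trans DP; rewrite ltnS -addnn leq_addr.
rewrite ler_pdivrMl ?mulr_gt0 ?ltr0n //.
have : (D.*2.+1)%:R = 2 * D.+1%:R - 1 :> R by rewrite -!natr1 -addnn natrD; ring.
by move=> ->; nra.
Qed.

(** The weights [q] do not depend on [j], so the whole density is sampled at once. The constant is
    [(3 / 2)^2]: one factor from Cauchy-Schwarz, one from averaging the bound [M]. *)
Lemma sampling_density (S : finType) J (lam : 'I_J -> R) (m : S -> nat)
    (z : 'I_J -> S -> R[i]) (M : R) :
  let u j s := \sum_k z j k * cexp ((m k)%:R * s) in
  (forall j, 0 <= lam j) -> (forall k, m k <= D)%N ->
  (forall b : 'I_P, \sum_j lam j * normc (u j (b%:R / P%:R)) ^+ 2 <= M) ->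
  \sum_j lam j * normc (u j t) ^+ 2 <= 9 / 4 * M.
Proof.
move=> u lam0 mD HM.
have P0 : 0 < P%:R :> R by rewrite ltr0n; exact: leq_trans DP.
have q0 b : 0 <= q b by exact: normc_ge0.
have ut j : u j t = P%:R^-1 * \sum_(b < P) u j (b%:R / P%:R) * V (t - b%:R / P%:R).
  rewrite /u; under eq_bigr do rewrite sampling_reproduces // mulrCA.
  rewrite -mulr_sumr; congr (_ * _).
  under eq_bigr do rewrite mulr_sumr.
  rewrite exchange_big /=; apply: eq_bigr => b _.
  move: (V _) => w; rewrite [RHS]mulr_suml; apply: eq_bigr => k _; exact: mulrA.
have un j : normc (u j t) ^+ 2 <=
    3 / 2 * (P%:R^-1 * \sum_(b < P) q b * normc (u j (b%:R / P%:R)) ^+ 2).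
  apply: (@le_trans _ _ ((P%:R^-1 * \sum_(b < P) q b * normc (u j (b%:R / P%:R))) ^+ 2)).
    rewrite ler_sqr ?nnegrE ?normc_ge0 //; last first.
      apply: mulr_ge0; first by rewrite invr_ge0 ltW.
      by apply: sumr_ge0 => b _; rewrite mulr_ge0 ?normc_ge0.
    rewrite ut normcM normcV normc_nat ler_pM2l ?invr_gt0 //.
    apply: le_trans (normc_sum _ _ _) _; apply: ler_sum => b _.
    by rewrite normcM mulrC.
  rewrite exprMn; apply: (@le_trans _ _ (P%:R^-1 ^+ 2 * ((\sum_b q b) *
      \sum_(b < P) q b * normc (u j (b%:R / P%:R)) ^+ 2))).
    by rewrite ler_wpM2l ?sqr_ge0 // cauchy_schwarz_weight.
  rewrite expr2 mulrACA ler_wpM2r ?sampling_weight_le //.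
  apply: mulr_ge0; first by rewrite invr_ge0 ltW.
  by apply: sumr_ge0 => b _; rewrite mulr_ge0 ?sqr_ge0.
apply: (@le_trans _ _ (3 / 2 * (P%:R^-1 * \sum_(b < P) q b *
    \sum_j lam j * normc (u j (b%:R / P%:R)) ^+ 2))).
  apply: (@le_trans _ _ (\sum_j lam j * (3 / 2 * (P%:R^-1 *
     \sum_(b < P) q b * normc (u j (b%:R / P%:R)) ^+ 2)))).
    by apply: ler_sum => j _; rewrite ler_wpM2l.
  rewrite le_eqVlt; apply/orP; left; apply/eqP.
  under [in RHS]eq_bigr do rewrite mulr_sumr.
  rewrite exchange_big /= !mulr_sumr; apply: eq_bigr => j _.
  rewrite !mulr_sumr; apply: eq_bigr => b _; ring.
rewrite (_ : 9 / 4 * M = 3 / 2 * (3 / 2 * M)); last by field.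
rewrite ler_pM2l //.
have M0 : 0 <= M.
  by apply: le_trans (HM (Ordinal (leq_trans (ltn0Sn _) DP))); apply: sumr_ge0 => j _;
      rewrite mulr_ge0 ?sqr_ge0.
apply: (@le_trans _ _ (P%:R^-1 * (\sum_b q b) * M)).
  rewrite -mulrA ler_pM2l ?invr_gt0 // mulr_suml; apply: ler_sum => b _.
  by rewrite ler_wpM2l.
by rewrite ler_wpM2r // sampling_weight_le.
Qed.

End kernel.
End sampling.

(** * Dirichlet kernels on the torus *)

Section torus_orthogonality.
Context (R : realType).

Lemma is_derive_primitive_cos (a b c x : R) : a != 0 ->
  is_derive x 1 (fun y : R => y + a^-1 * sin (a * y + b)) (1 + cos (a * x + b)).
Proof.
move=> a0.
have h1 : is_derive x 1 (fun y : R => a * y + b) a.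
  apply: is_derive_eq; rewrite addr0; exact: mulr1.
have h2 : is_derive x 1 (fun y : R => sin (a * y + b)) (cos (a * x + b) * a).
  exact: (@is_derive1_comp _ (fun z => sin z) (fun y => a * y + b)).
have h3 : is_derive x 1 (fun y : R => a^-1 * sin (a * y + b)) (a^-1 * (cos (a * x + b) * a)).
  exact: (@is_deriveZ _ _ _ (fun y => sin (a * y + b)) a^-1 x 1 _ h2).
have -> : 1 + cos (a * x + b) = 1 + a^-1 * (cos (a * x + b) * a) by field.
exact: (@is_deriveD _ _ _ id (fun y => a^-1 * sin (a * y + b))).
Qed.

Lemma measurable_cos_affine (a b : R) : measurable_fun setT (fun x : R => cos (a * x + b)).
Proof.
apply: (measurableT_comp (continuous_measurable_fun (@continuous_cos R))).
by apply: measurable_funD => //; exact: measurable_funM.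
Qed.

Lemma bmeas_cos_comp d (T : measurableType d) (f : T -> R) : measurable_fun setT f ->
  bmeas (fun x => cos (f x)).
Proof.
move=> mf; split; last by exists 1 => x; rewrite ler_norml cos_geN1 cos_le1.
exact: (measurableT_comp (continuous_measurable_fun (@continuous_cos R))).
Qed.

Lemma bmeas_sin_comp d (T : measurableType d) (f : T -> R) : measurable_fun setT f ->
  bmeas (fun x => sin (f x)).
Proof.
move=> mf; split; last by exists 1 => x; rewrite ler_norml sin_geN1 sin_le1.
exact: (measurableT_comp (continuous_measurable_fun (@continuous_sin R))).
Qed.

Lemma circle_cos (k : int) (b : R) : k != 0 ->
  \int[circle R]_x cos (2 * pi * (k%:~R * x + b)) = 0.
Proof.
move=> k0; set a : R := 2 * pi * k%:~R.
have a0 : a != 0 by rewrite mulf_neq0 ?intr_eq0 // mulf_neq0 // gt_eqF // pi_gt0.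
have E x : cos (2 * pi * (k%:~R * x + b)) = cos (a * x + 2 * pi * b).
  by congr cos; rewrite /a; ring.
under eq_Rintegral do rewrite E.
set f := fun x : R => cos (a * x + 2 * pi * b).
have mf : measurable_fun setT f by exact: measurable_cos_affine.
have bf : bmeas (T := measurableTypeR R) f.
  by split => //; exists 1 => x; rewrite ler_norml cos_geN1 cos_le1.
(* Adding 1 makes the integrand nonnegative, as [integral_uniform] requires. *)
have : \int[circle R]_x (1 + f x) = 1.
  rewrite /Rintegral integral_uniform; last 2 first.
  - by apply/measurable_EFinP; apply: measurable_funD.
  - by move=> x; rewrite lee_fin -lerBlDl sub0r cos_geN1.
  rewrite subr0 invr1 mul1e.
  pose F := fun y : R => y + a^-1 * sin (a * y + 2 * pi * b).
  have dF (x : R) : is_derive x 1 F (1 + f x) by exact: is_derive_primitive_cos.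
  have cF : continuous F.
    move=> x; apply: differentiable_continuous; apply/derivable1_diffP.
    by have := dF x => -[].
  have cf : continuous (fun x : R => 1 + f x).
    move=> x; apply: cvgD; first exact: cvg_cst.
    apply: (@continuous_comp _ _ _ (fun x : R => a * x + 2 * pi * b) cos); last exact:
        continuous_cos.
    by apply: cvgD; [apply: cvgMr; exact: cvg_id|exact: cvg_cst].
  rewrite (@continuous_FTC2 R (fun x : R => 1 + f x) F 0 1) //.
  - have sF : sin (a * 1 + 2 * pi * b) = sin (a * 0 + 2 * pi * b).
      have h := @cexpDint R b k; have := congr1 (@complex.Im R) h.
      rewrite /= (_ : 2 * pi * (b + k%:~R) = a * 1 + 2 * pi * b); last by rewrite /a; ring.
      by move=> ->; rewrite mulr0 add0r.
    by rewrite /F sF /= add0r addrK.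
  - exact: continuous_subspaceT.
  - split.
    + by move=> x _; have := dF x => -[].
    + by apply: cvg_at_right_filter; exact: cF.
    + by apply: cvg_at_left_filter; exact: cF.
  - by move=> x _; rewrite derive1E; have := dF x => -[].
rewrite RintD //; last exact: bmeas_cst.
by rewrite (Rint_cst (circle R) 1); lra.
Qed.

Lemma measurable_dotp d (k : d.-tuple int) :
  measurable_fun setT (fun x : d.-tuple (measurableTypeR R) => dotp k x).
Proof.
apply: measurable_sum => i; apply: measurable_funM => //; exact: measurable_tnth.
Qed.

Lemma dotp_cons d (k0 : int) (k : d.-tuple int) (x0 : measurableTypeR R)
    (x : d.-tuple (measurableTypeR R)) :
  dotp [tuple of k0 :: k] [tuple of x0 :: x] = k0%:~R * x0 + dotp k x.
Proof.
rewrite /dotp big_ord_recl !tnth0; congr (_ + _).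
by apply: eq_bigr => i _; rewrite !tnthS.
Qed.

(** Induction on the dimension. If the tail of [k] is nonzero, the inner integral vanishes, the
    first coordinate being absorbed into the free phase [b]; otherwise the integrand depends on the
    first coordinate only. *)
Lemma torus_cos d (k : d.-tuple int) (b : R) : (exists i, tnth k i != 0) ->
  \int[torus R d]_x cos (2 * pi * (dotp k x + b)) = 0.
Proof.
elim: d k b => [|d IH] k b; first by case=> -[].
case/tupleP: k => k0 k [i ki].
have mphi (n : nat) (l : n.-tuple int) c : measurable_fun setT
    (fun x : n.-tuple (measurableTypeR R) => 2 * pi * (dotp l x + c)).
  by apply: measurable_funM => //; apply: measurable_funD => //; exact: measurable_dotp.
have bf (n : nat) (l : n.-tuple int) c : bmeas (fun x : n.-tuple (measurableTypeR R) => cos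
    (2 * pi * (dotp l x + c))).
  by apply: bmeas_cos_comp; exact: mphi.
pose h (z : measurableTypeR R * d.-tuple (measurableTypeR R)) : R :=
  cos (2 * pi * (k0%:~R * z.1 + dotp k z.2 + b)).
have bh : bmeas h.
  apply: bmeas_cos_comp; apply: measurable_funM => //; apply: measurable_funD => //.
  apply: measurable_funD; first by apply: measurable_funM => //; exact: measurable_fst.
  by apply: (measurableT_comp (measurable_dotp k)); exact: measurable_snd.
have -> : \int[torus R d.+1]_x cos (2 * pi * (dotp [tuple of k0 :: k] x + b)) =
    \int[(circle R \x torus R d)%E]_z h z.
  rewrite /torus /= /Rintegral integral_distribution; first last.
  - have := bmeas_integrable (circle R \x torus R d)%E (bmeas_comp (measurable_tuple_cons
      (n := d)) (bf _ [tuple of k0 :: k] b)).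
    by [].
  - by apply/measurable_EFinP; apply: bmeas_measurable; exact: bf.
  congr fine; apply: eq_integral => -[x0 x] _ /=.
  by rewrite /h /tuple_cons dotp_cons.
have FE : \int[(circle R \x torus R d)%E]_z h z = \int[circle R]_x \int[torus R d]_y h (x, y).
  rewrite /Rintegral; congr fine.
  rewrite -(integral12_prod_meas1 (bmeas_integrable (circle R \x torus R d)%E bh)).
  by apply: eq_integral => x _; rewrite /fubini_F; exact/esym/(EFin_Rint (torus R d)
      (bmeas_section1 bh x)).
rewrite FE.
have [[j kj]|nk] := pselect (exists j, tnth k j != 0).
  rewrite -[RHS](Rint_cst (circle R) 0); apply: eq_Rintegral => x _ /=.
  have := IH k (k0%:~R * x + b) (ex_intro _ j kj) => <-.
  by apply: eq_Rintegral => y _; rewrite /h /=; congr cos; ring.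
have kz j : tnth k j = 0 by apply/eqP/negPn/negP => kj; apply: nk; exists j.
have k00 : k0 != 0.
  by move: ki; case: (unliftP ord0 i) => [j|] ->; rewrite ?tnthS ?tnth0 // kz eqxx.
rewrite -[RHS](@circle_cos k0 b) //; apply: eq_Rintegral => x _ /=.
rewrite -[RHS](Rint_cst (torus R d)); apply: eq_Rintegral => y _ /=.
rewrite /h /= /dotp big1 ?addr0 // => j _; by rewrite kz mul0r.
Qed.

End torus_orthogonality.

(** * Kernels of frequency boxes and their maximal estimate *)

Section box_kernel.
Context (R : realType) (d N : nat).
Implicit Types (t : R) (v : 'I_d -> R).

Local Notation n := N.*2.+1.

Definition box := {ffun 'I_d -> 'I_n}.

Definition box_freq (f : box) : d.-tuple int := [tuple (f i)%:Z - N%:Z | i < d].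

Lemma box_freq_inj : injective box_freq.
Proof.
move=> f g fg; apply/ffunP => i; apply/val_inj/eqP; rewrite -eqz_nat; apply/eqP.
by have /(congr1 (fun k => tnth k i)) := fg; rewrite !tnth_mktuple => /addIr.
Qed.

Lemma box_freqE f i : (tnth (box_freq f) i)%:~R = (f i)%:R - N%:R :> R.
Proof. by rewrite tnth_mktuple rmorphB /= -!pmulrn. Qed.

Definition box_kernel v t : R[i] :=
  \sum_(f : box) cexp (\sum_i (tnth (box_freq f) i)%:~R * v i + t * sqnorm R (box_freq f)).

Lemma box_kernel_prod v t : box_kernel v t =
  \prod_i \sum_(a < n) cexp ((a%:R - N%:R) * v i + t * (a%:R - N%:R) ^+ 2).
Proof.
rewrite bigA_distr_bigA /=; apply: eq_bigr => f _.
rewrite -cexp_sum /sqnorm mulr_sumr -big_split /=; congr cexp.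
by apply: eq_bigr => i _; rewrite box_freqE.
Qed.

Lemma box_kernel_opp v t : box_kernel (fun i => - v i) t = box_kernel v t.
Proof.
rewrite !box_kernel_prod; apply: eq_bigr => i _.
rewrite (reindex_inj rev_ord_inj) /=; apply: eq_bigr => a _; congr cexp.
have -> : (n - a.+1)%:R = N%:R + N%:R - a%:R :> R.
  rewrite subSS natrB; last by rewrite -ltnS ltn_ord.
  by congr (_ - _); rewrite -addnn natrD.
ring.
Qed.

(** [|k|^2] is an integer; this allows differences of grid times to be reduced modulo 1. *)
Lemma box_kernel_period v t (k : int) : box_kernel v (t + k%:~R) = box_kernel v t.
Proof.
rewrite /box_kernel; apply: eq_bigr => f _.
have -> : sqnorm R (box_freq f) = (\sum_i (tnth (box_freq f) i) ^+ 2)%:~R.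
  by rewrite /sqnorm rmorph_sum /=; apply: eq_bigr => i _; rewrite rmorphXn.
by rewrite mulrDl addrA -[k%:~R * _]intrM cexpDint.
Qed.

(** The kernel factors over coordinates. Recentring [a - N] to [a] changes the linear phase to
    [v i - 2 N t] and adds a unimodular factor, harmless because Weyl's bound is uniform in the
    linear phase. *)
Lemma box_kernel_weyl v t :
  normc (box_kernel v t) ^+ 2 <= weyl_majorant n t ^+ d.
Proof.
rewrite box_kernel_prod (big_morph (@normc R) (@normcM R) (normc1 R)).
rewrite -prodrXl -[X in _ <= _ ^+ X](card_ord d) -prodr_const.
apply: ler_prod => i _; rewrite sqr_ge0 /=.
apply: le_trans (weyl_sum_le n (v i - 2 * N%:R * t) t).
rewrite le_eqVlt; apply/orP; left; apply/eqP; congr (_ ^+ 2).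
transitivity (normc (cexp (N%:R ^+ 2 * t - N%:R * v i) *
    \sum_(a < n) cexp (a%:R * (v i - 2 * N%:R * t) + a%:R ^+ 2 * t))); last first.
  by rewrite normcM normc_cexp mul1r.
rewrite mulr_sumr; congr normc; apply: eq_bigr => a _; rewrite -cexpD; congr cexp; ring.
Qed.

End box_kernel.

Section box_maximal.
Context (R : realType) (d N P : nat).
Local Notation n := N.*2.+1.
Local Notation point := (d.-tuple (measurableTypeR R)).
Local Notation freq := (@box_freq d N).

Lemma dotp_diffl (k : d.-tuple int) (x y : point) :
  \sum_i (tnth k i)%:~R * (tnth x i - tnth y i) = dotp k x - dotp k y :> R.
Proof. by rewrite /dotp -sumrB; apply: eq_bigr => i _; rewrite mulrBr. Qed.

Lemma dotp_diffr (k l : d.-tuple int) (y : point) :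
  dotp [tuple tnth k i - tnth l i | i < d] y = dotp k y - dotp l y.
Proof.
by rewrite /dotp -sumrB; apply: eq_bigr => i _; rewrite tnth_mktuple rmorphB mulrBl.
Qed.

Definition phase (b : nat) (f : box d N) (x : point) : R :=
  dotp (freq f) x + b%:R / P%:R * sqnorm R (freq f).

Lemma measurable_phase b f : measurable_fun setT (phase b f).
Proof. by apply: measurable_funD => //; exact: measurable_dotp. Qed.

(* A complex amplitude is a real vector indexed by [box d N * bool]: pairing it with
   [wave i] gives the real ([i] even) or imaginary ([i] odd) part of the
   exponential sum at the time [i./2 / P]. *)
Definition wave (i : 'I_(P.*2)) (k : box d N * bool) (x : point) : R :=
  let th := 2 * pi * phase (i./2) k.1 x in
  if odd i then (if k.2 then cos th else sin th) else (if k.2 then - sin th else cos th).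

Lemma bmeas_wave i k : bmeas (wave i k).
Proof.
have m2 : measurable_fun setT (fun x => 2 * pi * phase (i./2) k.1 x).
  by apply: measurable_funM => //; exact: measurable_phase.
rewrite /wave; case: (odd i); case: k.2; [exact: bmeas_cos_comp|exact: bmeas_sin_comp|
    |exact: bmeas_cos_comp].
by under eq_fun do rewrite -mulN1r; apply: bmeasZ; exact: bmeas_sin_comp.
Qed.

Lemma sum_bool_pair (F : box d N * bool -> R) :
  \sum_k F k = \sum_f (F (f, false) + F (f, true)).
Proof.
rewrite (eq_bigr (fun k => F (k.1, k.2))) => [|[f b] _] //.
rewrite -(pair_bigA _ (fun f b => F (f, b))) /=.
by apply: eq_bigr => f _; rewrite big_bool addrC.
Qed.

(** Up to sign, the real inner product is the real or the imaginary part of the complex kernel,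
    according to the parities of [i] and [l]. *)
Lemma wave_product (i l : 'I_(P.*2)) x y :
  (\sum_k wave i k x * wave l k y) ^+ 2 <=
  normc (box_kernel N (fun j => tnth x j - tnth y j) ((i./2)%:R / P%:R - (l./2)%:R / P%:R)) ^+ 2.
Proof.
have -> : box_kernel N (fun j => tnth x j - tnth y j) ((i./2)%:R / P%:R - (l./2)%:R / P%:R) =
    \sum_f cexp (phase (i./2) f x - phase (l./2) f y).
  apply: eq_bigr => f _; congr cexp; rewrite dotp_diffl /phase; ring.
have E f : let z := cexp (phase (i./2) f x - phase (l./2) f y) in
   let p := 2 * pi * phase (i./2) f x in let q := 2 * pi * phase (l./2) f y in
   complex.Re z = cos p * cos q + sin p * sin q /\ complex.Im z = sin p * cos q - cos p * sin q.
  by rewrite /= mulrBr cosB sinB.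
rewrite normc_sqrE sum_bool_pair /wave Re_sum Im_sum /=.
case: (odd i); case: (odd l).
- have -> : \sum_f complex.Re (cexp (phase (i./2) f x - phase (l./2) f y)) =
      \sum_f (sin (2 * pi * phase i./2 f x) * sin (2 * pi * phase l./2 f y) +
       cos (2 * pi * phase i./2 f x) * cos (2 * pi * phase l./2 f y)).
    by apply: eq_bigr => f _; rewrite (E f).1 addrC.
  by rewrite lerDl sqr_ge0.
- have -> : \sum_f complex.Im (cexp (phase (i./2) f x - phase (l./2) f y)) =
      \sum_f (sin (2 * pi * phase i./2 f x) * cos (2 * pi * phase l./2 f y) +
       cos (2 * pi * phase i./2 f x) * - sin (2 * pi * phase l./2 f y)).
    by apply: eq_bigr => f _; rewrite (E f).2 mulrN.
  by rewrite lerDr sqr_ge0.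
- have -> : \sum_f complex.Im (cexp (phase (i./2) f x - phase (l./2) f y)) =
      - \sum_f (cos (2 * pi * phase i./2 f x) * sin (2 * pi * phase l./2 f y) +
       - sin (2 * pi * phase i./2 f x) * cos (2 * pi * phase l./2 f y)).
    by rewrite -sumrN; apply: eq_bigr => f _; rewrite (E f).2; ring.
  by rewrite sqrrN lerDr sqr_ge0.
- have -> : \sum_f complex.Re (cexp (phase (i./2) f x - phase (l./2) f y)) =
      \sum_f (cos (2 * pi * phase i./2 f x) * cos (2 * pi * phase l./2 f y) +
       - sin (2 * pi * phase i./2 f x) * - sin (2 * pi * phase l./2 f y)).
    by apply: eq_bigr => f _; rewrite (E f).1 mulrNN.
  by rewrite lerDl sqr_ge0.
Qed.

Lemma normc_sum_cexp_sqr (S : finType) (th : S -> R) :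
  normc (\sum_f cexp (th f)) ^+ 2 = \sum_f \sum_g cos (2 * pi * (th f - th g)).
Proof.
transitivity (complex.Re ((\sum_f cexp (th f)) * (\sum_f cexp (th f))^*)).
  by rewrite -normc_sqr_conj.
rewrite rmorph_sum /= big_distrlr Re_sum /=; apply: eq_bigr => f _.
by rewrite Re_sum; apply: eq_bigr => g _; rewrite -cexpN -cexpD.
Qed.

Lemma measurable_dotp_diff (k : d.-tuple int) : measurable_fun setT
  (fun z : point * point => \sum_i (tnth k i)%:~R * (tnth z.1 i - tnth z.2 i) : R).
Proof.
apply: measurable_sum => i; apply: measurable_funM => //; apply: measurable_funB.
- by apply: (measurableT_comp (measurable_tnth i)); exact: measurable_fst.
- by apply: (measurableT_comp (measurable_tnth i)); exact: measurable_snd.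
Qed.

Lemma bmeas_kernel_sqr t :
  bmeas (fun z : point * point => normc (box_kernel N (fun j => tnth z.1 j - tnth z.2 j) t) ^+ 2).
Proof.
under eq_fun do rewrite normc_sum_cexp_sqr.
apply: bmeas_sum => f; apply: bmeas_sum => g; apply: bmeas_cos_comp.
apply: measurable_funM => //; apply: measurable_funB;
  by apply: measurable_funD => //; exact: measurable_dotp_diff.
Qed.

(** Parseval: distinct frequencies integrate to 0, so each frequency of the box contributes 1,
    whatever [x] and [t]. *)
Lemma Rint_kernel_sqr (x : point) t :
  \int[torus R d]_y (normc (box_kernel N (fun j => tnth x j - tnth y j) t) ^+ 2) = n%:R ^+ d.
Proof.
under eq_Rintegral do rewrite normc_sum_cexp_sqr.
have E (f g : box d N) : exists b : R, forall y : point,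
   \sum_i (tnth (freq f) i)%:~R * (tnth x i - tnth y i) + t * sqnorm R (freq f) -
   (\sum_i (tnth (freq g) i)%:~R * (tnth x i - tnth y i) + t * sqnorm R (freq g)) =
   dotp [tuple tnth (freq g) i - tnth (freq f) i | i < d] y + b.
  exists (dotp (freq f) x + t * sqnorm R (freq f) - (dotp (freq g) x + t * sqnorm R (freq g))) => y.
  by rewrite dotp_diffr !dotp_diffl; ring.
have mE (k : d.-tuple int) b : bmeas (fun y : point => cos (2 * pi * (dotp k y + b))).
  apply: bmeas_cos_comp; apply: measurable_funM => //.
  by apply: measurable_funD => //; exact: measurable_dotp.
have bE f g : bmeas (fun y : point => cos (2 * pi *
   (\sum_i (tnth (freq f) i)%:~R * (tnth x i - tnth y i) + t * sqnorm R (freq f) -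
   (\sum_i (tnth (freq g) i)%:~R * (tnth x i - tnth y i) + t * sqnorm R (freq g))))).
  have [b Eb] := E f g; under eq_fun do rewrite Eb; exact: mE.
rewrite Rint_sum; last by move=> f; exact: bmeas_sum.
transitivity (\sum_(f : box d N) (1 : R)); last first.
  by rewrite sumr_const card_ffun !card_ord natrX.
apply: eq_bigr => f _; rewrite Rint_sum // (bigD1 f) //= big1 ?addr0 => [|g gf].
  rewrite -[RHS](Rint_cst (torus R d) 1); apply: eq_Rintegral => y _.
  by rewrite subrr mulr0 cos0.
have [b Eb] := E f g; under eq_Rintegral do rewrite Eb; apply: torus_cos.
apply/existsP; rewrite -negb_forall; apply: contra gf => /forallP h.
apply/eqP; apply: (@box_freq_inj d N); apply: eq_from_tnth => i.
by apply/eqP; have := h i; rewrite tnth_mktuple subr_eq0.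
Qed.

Variable mu : R.
Hypothesis mu_gt0 : 0 < mu.
Hypothesis nP : (4 * n ^ 2 <= P)%N.

Let major (b : 'I_P) := mu < weyl_majorant n (b%:R / P%:R).

(* At the times where Weyl's inequality gives nothing better than [mu], the maximum
   of the kernels is replaced by their sum; these times are few. *)
Definition kernel_majorant (z : point * point) : R :=
  mu ^+ d + \sum_(b < P) (if major b then
    normc (box_kernel N (fun j => tnth z.1 j - tnth z.2 j) (b%:R / P%:R)) ^+ 2 else 0).

(** The quotient by [mu ^+ 2] is Chebyshev's bound for the number of exceptional times, and
    [n%:R ^+ d] is the mass of the kernel at each of them. *)
Definition kernel_mass : R :=
  mu ^+ d + 2 ^+ 13 * P%:R * n%:R ^+ 2 * harmonic_sum R n ^+ 3 / mu ^+ 2 * n%:R ^+ d.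

Lemma kernel_majorant_ge0 z : 0 <= kernel_majorant z.
Proof.
apply: addr_ge0; first by rewrite exprn_ge0 // ltW.
by apply: sumr_ge0 => b _; case: ifP; rewrite ?sqr_ge0.
Qed.

Lemma bmeas_kernel_majorant : bmeas kernel_majorant.
Proof.
apply: bmeasD; first exact: bmeas_cst.
apply: bmeas_sum => b; case: (major b); [exact: bmeas_kernel_sqr|exact: bmeas_cst].
Qed.

Lemma kernel_majorantC x y : kernel_majorant (x, y) = kernel_majorant (y, x).
Proof.
rewrite /kernel_majorant; congr (_ + _); apply: eq_bigr => b _.
rewrite -box_kernel_opp /=; congr (if _ then normc (box_kernel _ _ _) ^+ 2 else _).
by apply/funext => j; rewrite opprB.
Qed.

Lemma Rint_kernel_majorant x : \int[torus R d]_y kernel_majorant (x, y) <= kernel_mass.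
Proof.
have bk b : bmeas (fun y : point => if major b then
    normc (box_kernel N (fun j => tnth x j - tnth y j) (b%:R / P%:R)) ^+ 2 else 0).
  case: (major b); last exact: bmeas_cst.
  exact: (bmeas_section1 (bmeas_kernel_sqr (b%:R / P%:R)) x).
rewrite /kernel_majorant RintD; [|exact: bmeas_cst|exact: bmeas_sum].
rewrite (Rint_cst (torus R d) (mu ^+ d)) lerD2l Rint_sum //.
rewrite (eq_bigr (fun b => (major b)%:R * n%:R ^+ d)); last first.
  move=> b _; case: (major b); last by rewrite mul0r (Rint_cst (torus R d) 0).
  by rewrite mul1r Rint_kernel_sqr.
rewrite -mulr_suml ler_wpM2r ?exprn_ge0 // ler_pdivlMr ?exprn_gt0 //.
apply: le_trans (weyl_majorant_moment R (ltn0Sn _) nP).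
rewrite mulr_suml; apply: ler_sum => b _; rewrite /major.
case: ltP => h; last by rewrite mul0r sqr_ge0.
by rewrite mul1r ler_sqr ?nnegrE ?weyl_majorant_ge0 // ltW.
Qed.

Lemma wave_product_le i l x y :
  (\sum_k wave i k x * wave l k y) ^+ 2 <= kernel_majorant (x, y).
Proof.
apply: le_trans (wave_product i l x y) _.
have hb (j : 'I_P.*2) : (j./2 < P)%N by rewrite ltn_half_double.
have P0 : P%:R != 0 :> R by rewrite pnatr_eq0 -lt0n; exact: leq_ltn_trans (hb i).
(* The difference of two grid times is a grid time up to an integer, so the maximum over pairs of
   times runs over a single grid. *)
have [b [k E]] : exists (b : 'I_P) (k : int),
    (i./2)%:R / P%:R - (l./2)%:R / P%:R = b%:R / P%:R + k%:~R :> R.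
  case: (leqP l./2 i./2) => li.
    have bP : (i./2 - l./2 < P)%N by apply: leq_ltn_trans (hb i); exact: leq_subr.
    by exists (Ordinal bP), 0; rewrite /= addr0 natrB // mulrBl.
  have bP : (P + i./2 - l./2 < P)%N by move: (hb i) (hb l) li; clear; lia.
  exists (Ordinal bP), (-1); rewrite /= natrB; last by rewrite (leq_trans (ltnW (hb l))) //
      leq_addr.
  by rewrite natrD rmorphN1; field.
rewrite E box_kernel_period /kernel_majorant /=.
case: (boolP (major b)) => mb.
  rewrite (bigD1 b) //= mb addrCA lerDl addr_ge0 ?exprn_ge0 ?(ltW mu_gt0) //.
  by apply: sumr_ge0 => c _; case: ifP; rewrite ?sqr_ge0.
rewrite -[leLHS]addr0 lerD //; last by apply: sumr_ge0 => c _; case: ifP; rewrite ?sqr_ge0.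
apply: le_trans (box_kernel_weyl _ _ _) _.
by rewrite lerXn2r ?nnegrE ?weyl_majorant_ge0 ?(ltW mu_gt0) // leNgt.
Qed.

Variables (J : nat) (z : 'I_J -> box d N -> R[i]) (lam : 'I_J -> R).
Hypothesis bessel : forall phi : box d N -> R[i],
  \sum_j normc (\sum_f z j f * phi f) ^+ 2 <= \sum_f normc (phi f) ^+ 2.
Hypothesis lam_ge0 : forall j, 0 <= lam j.

Definition box_density (b : nat) (x : point) : R :=
  \sum_j lam j * normc (\sum_f z j f * cexp (phase b f x)) ^+ 2.

Lemma box_density_ge0 b x : 0 <= box_density b x.
Proof. by apply: sumr_ge0 => j _; rewrite mulr_ge0 ?sqr_ge0. Qed.

Let G (j : 'I_J) (k : box d N * bool) : R :=
  if k.2 then complex.Im (z j k.1) else complex.Re (z j k.1).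

Lemma box_density_split (b : 'I_P) x : exists i l : 'I_(P.*2),
  box_density b x = density wave G lam i x + density wave G lam l x.
Proof.
have h1 : (b.*2 < P.*2)%N by rewrite ltn_double.
have h2 : (b.*2.+1 < P.*2)%N by rewrite ltn_Sdouble.
exists (Ordinal h1), (Ordinal h2); rewrite /density -big_split /=; apply: eq_bigr => j _.
rewrite -mulrDr normc_sqrE Re_sum Im_sum !sum_bool_pair /wave /= odd_double /= doubleK
    uphalf_double.
congr (_ * (_ ^+ 2 + _ ^+ 2)); apply: eq_bigr => f _; rewrite /G /=.
  by case: (z j f) => u v /=; ring.
by case: (z j f) => u v /=; ring.
Qed.

Lemma bmeas_box_density (b : nat) : bmeas (box_density b).
Proof.
apply: bmeas_sum => j; apply: bmeasZ.
have -> : (fun x => normc (\sum_f z j f * cexp (phase b f x)) ^+ 2) =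
  (fun x => (\sum_f complex.Re (z j f * cexp (phase b f x))) ^+ 2 +
            (\sum_f complex.Im (z j f * cexp (phase b f x))) ^+ 2).
  by apply/funext => x; rewrite normc_sqrE Re_sum Im_sum.
have m2 f : measurable_fun setT (fun x => 2 * pi * phase b f x).
  by apply: measurable_funM => //; exact: measurable_phase.
apply: bmeasD; apply: bmeasX; apply: bmeas_sum => f; case: (z j f) => u v /=.
- apply: bmeasD; first by apply: bmeasZ; exact: bmeas_cos_comp.
  by under eq_fun do rewrite -mulN1r; do 2 apply: bmeasZ; exact: bmeas_sin_comp.
- apply: bmeasD; first by apply: bmeasZ; exact: bmeas_sin_comp.
  by apply: bmeasZ; exact: bmeas_cos_comp.
Qed.

(** Each complex density is the sum of two real ones, so its maximum is at most twice the real
    maximum; squaring gives the factor 4. *)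
Lemma box_maximal :
  \int[torus R d]_x (\big[Num.max/0]_(b < P) box_density b x) ^+ 2 <=
  4 * kernel_mass * \sum_j lam j ^+ 2.
Proof.
have G_bessel (phi : box d N * bool -> R) :
    \sum_j (\sum_k phi k * G j k) ^+ 2 <= \sum_k phi k ^+ 2.
  (* With [p - i q] as test vector, the real part of the complex pairing is the real pairing of
     [(p, q)] with [G]; the imaginary part is discarded. *)
  have := bessel (fun f => phi (f, false) -i* phi (f, true)).
  under [X in _ <= X -> _]eq_bigr do rewrite normc_sqrE /= sqrrN.
  rewrite -(sum_bool_pair (fun k => phi k ^+ 2)); apply: le_trans.
  apply: ler_sum => j _; rewrite normc_sqrE Re_sum sum_bool_pair -[leLHS]addr0 lerD ?sqr_ge0 //.
  rewrite le_eqVlt; apply/orP; left; apply/eqP; congr (_ ^+ 2); apply: eq_bigr => f _.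
  by rewrite /G; case: (z j f) => u v /=; ring.
have bw := @bmeas_wave.
have key := hs_maximal (mu := torus R d) bw G_bessel bmeas_kernel_majorant kernel_majorantC
   wave_product_le Rint_kernel_majorant kernel_majorant_ge0 lam_ge0.
have bmax : bmeas (fun x => \big[Num.max/0]_(b < P) box_density b x).
  by apply: bmeas_bigmax => b; exact: bmeas_box_density.
have bmax2 : bmeas (fun x => \big[Num.max/0]_i density wave G lam i x).
  by apply: bmeas_bigmax => i; exact: bmeas_density.
apply: (@le_trans _ _ (\int[torus R d]_x (4 * (\big[Num.max/0]_i density wave G lam i x) ^+ 2))).
  apply: Rint_le => [||x]; [exact: bmeasX|by apply: bmeasZ; exact: bmeasX|].
  have m0 : 0 <= \big[Num.max/0]_i density wave G lam i x.
    elim/big_ind: _ => [//|u v u0 v0|i _]; first by rewrite le_max u0.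
    by apply: sumr_ge0 => j _; rewrite mulr_ge0 ?sqr_ge0.
  have b0 : 0 <= \big[Num.max/0]_(b < P) box_density b x.
    by elim/big_ind: _ => // [u v u0 v0|b _]; rewrite ?le_max ?u0 ?box_density_ge0.
  have h : \big[Num.max/0]_(b < P) box_density b x <= 2 * \big[Num.max/0]_i density wave G lam i x.
    elim/big_ind: _ => [|u v u0 v0|b _]; first by rewrite mulr_ge0.
      by rewrite ge_max u0.
    have [i [l ->]] := box_density_split b x.
    have := le_bigmax 0 (fun i => density wave G lam i x) i.
    have := le_bigmax 0 (fun i => density wave G lam i x) l.
    lra.
  nra.
rewrite RintZ; last exact: bmeasX.
by rewrite -mulrA ler_pM2l.
Qed.

End box_maximal.

(** * The choice of the threshold at dyadic scales *)

Section dyadic_scale.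
Context (R : realType).

Lemma harmonic_sum_mono m n : (m <= n)%N -> harmonic_sum R m <= harmonic_sum R n.
Proof.
move=> mn; rewrite /harmonic_sum (big_ord_widen n (fun L => L.+1%:R^-1) mn) big_mkcond /=.
by apply: ler_sum => i _; case: ifP => // _; rewrite invr_ge0.
Qed.

Lemma harmonic_sum_exp2 k : harmonic_sum R (2 ^ k) <= k.+1%:R.
Proof.
elim: k => [|k IH]; first by rewrite expn0 /harmonic_sum big_ord1 invr1.
rewrite expnS mul2n -addnn /harmonic_sum big_split_ord /= -natr1 lerD //.
rewrite [leRHS](_ : 1 = \sum_(i < 2 ^ k) ((2 ^ k)%:R^-1 : R)); last first.
  by rewrite sumr_const card_ord -[RHS]mulr_natr mulVf // pnatr_eq0 expn_eq0.
apply: ler_sum => i _; rewrite lef_pV2 ?posrE ?ltr0n ?expn_gt0 //.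
by rewrite ler_nat -addnS leq_addr.
Qed.

Lemma cube_le_exp (eta : R) : 0 < eta ->
  exists2 C : R, 0 < C & forall m, m.+3%:R ^+ 3 <= C * 2 `^ (m%:R * eta).
Proof.
move=> eta0; pose a := eta / 3 * ln 2 : R.
have ln2 : 0 < ln 2 :> R by rewrite ln_gt0 // ltr1n.
have a0 : 0 < a by rewrite !mulr_gt0 // invr_gt0.
exists ((3 + a^-1) ^+ 3); first by rewrite exprn_gt0 // addr_gt0 // invr_gt0.
move=> m.
have -> : 2 `^ (m%:R * eta) = (2 `^ (m%:R * eta / 3)) ^+ 3.
  by rewrite -powR_mulrn ?powR_ge0 // -powRrM mulfVK.
rewrite -exprMn lerXn2r ?nnegrE //.
  by rewrite mulr_ge0 ?powR_ge0 // addr_ge0 // invr_ge0 ltW.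
apply: (@le_trans _ _ ((3 + a^-1) * (1 + m%:R * a))).
  have -> : (3 + a^-1) * (1 + m%:R * a) = 3 + 3 * (m%:R * a) + a^-1 + m%:R.
    by field; rewrite gt_eqF.
  rewrite -(addn3 m) natrD.
  have : 0 <= a^-1 by rewrite invr_ge0 ltW.
  have : 0 <= 3 * (m%:R * a) by rewrite !mulr_ge0 // ltW.
  lra.
apply: ler_wpM2l; first by rewrite addr_ge0 // invr_ge0 ltW.
rewrite /powR pnatr_eq0 /=; apply: le_trans (expR_ge1Dx _).
by rewrite /a lerD2l -!mulrA.
Qed.

Variable d : nat.

(* The number of sampling times at scale [2 ^ m]: it exceeds both the bandwidth
   required for sampling and the one required by the second moment of Weyl sums. *)
Definition samples m : nat := (37 + d.*2) * (2 ^ m) ^ 2.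

(** Up to logarithms the mass at scale N is [mu^d + N^(d+4) / mu^2]. The two terms agree for
    [mu^(d+2) = N^(d+4)], that is [mu = N^(2 - d/(d+2))], and their common value is N to the power
    [loss]. *)
Definition loss : R := d%:R + 2 * d%:R / (d%:R + 2).

Lemma kernel_mass_dyadic (eta : R) : 0 < eta ->
  exists2 C : R, 0 < C & forall m, exists2 mu : R, 0 < mu &
    kernel_mass d (2 ^ m) (samples m) mu <= C * 2 `^ (m%:R * (loss + eta)).
Proof.
move=> eta0; have [C0 C00 HC0] := cube_le_exp eta0.
have d2 : d%:R + 2 != 0 :> R by rewrite -natrD pnatr_eq0 addn2.
(* The factors [9 * 3 ^+ d] come from [2 * 2 ^ m + 1 <= 3 * 2 ^ m], raised to the powers 2 and
   [d]. *)
pose C1 : R := 2 ^+ 13 * (37 + 2 * d%:R) * 9 * 3 ^+ d.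
have C10 : 0 < C1.
  by rewrite /C1 !mulr_gt0 ?exprn_gt0 // -natrM -natrD ltr0n.
exists (1 + C1 * C0); first by rewrite addr_gt0 // mulr_gt0.
move=> m; pose ex : R := 2 - d%:R / (d%:R + 2).
pose X := 2 `^ (m%:R : R); have X0 : 0 < X by rewrite powR_gt0.
have XE : X = (2 ^ m)%:R by rewrite /X powR_mulrn // natrX.
exists (2 `^ (m%:R * ex)); first exact: powR_gt0.
rewrite /kernel_mass.
have -> : (2 `^ (m%:R * ex)) ^+ d = 2 `^ (m%:R * loss).
  rewrite -powR_mulrn ?powR_ge0 // -powRrM; congr (_ `^ _).
  by rewrite /ex /loss; field.
have N1 : (1 <= 2 ^ m)%N by rewrite expn_gt0.
have n3 : ((2 ^ m).*2.+1)%:R <= 3 * X.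
  by rewrite XE -natrM ler_nat; move: N1; lia.
have H : harmonic_sum R (2 ^ m).*2.+1 <= m.+3%:R.
  apply: le_trans (harmonic_sum_exp2 m.+2); apply: harmonic_sum_mono.
  by rewrite !expnS; move: N1; lia.
have H0 : 0 <= harmonic_sum R (2 ^ m).*2.+1.
  by apply: sumr_ge0 => i _; rewrite invr_ge0.
have -> : 2 `^ (m%:R * (loss + eta)) = 2 `^ (m%:R * loss) * 2 `^ (m%:R * eta) :> R.
  by rewrite mulrDr powRD // pnatr_eq0 implybT.
have E1 : 1 <= 2 `^ (m%:R * eta) :> R.
  by rewrite -[leLHS](powRr0 2); apply: ler_powR; rewrite ?ler1n // mulr_ge0 // ltW.
rewrite mulrDl mul1r lerD //; first by rewrite ler_peMr ?powR_ge0.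
have PE : (samples m)%:R = (37 + 2 * d%:R) * X ^+ 2 :> R.
  by rewrite /samples natrM natrX XE -mul2n natrD natrM.
rewrite PE.
have step : 2 ^+ 13 * ((37 + 2 * d%:R) * X ^+ 2) * ((2 ^ m).*2.+1)%:R ^+ 2 *
    harmonic_sum R (2 ^ m).*2.+1 ^+ 3 / (2 `^ (m%:R * ex)) ^+ 2 * ((2 ^ m).*2.+1)%:R ^+ d <=
   2 ^+ 13 * ((37 + 2 * d%:R) * X ^+ 2) * (3 * X) ^+ 2 *
    m.+3%:R ^+ 3 / (2 `^ (m%:R * ex)) ^+ 2 * (3 * X) ^+ d.
  have c0 : 0 <= 2 ^+ 13 * ((37 + 2 * d%:R) * X ^+ 2).
    apply: mulr_ge0; first exact: exprn_ge0.
    by apply: mulr_ge0; [have := ler0n R d; lra|exact: sqr_ge0].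
  have c1 : 0 <= ((2 `^ (m%:R * ex)) ^+ 2)^-1 by rewrite invr_ge0 sqr_ge0.
  have X3 : 0 <= 3 * X by rewrite mulr_ge0 // ltW.
  have s1 : ((2 ^ m).*2.+1)%:R ^+ 2 <= (3 * X) ^+ 2 by rewrite lerXn2r ?nnegrE.
  have s2 : harmonic_sum R (2 ^ m).*2.+1 ^+ 3 <= m.+3%:R ^+ 3 by rewrite lerXn2r ?nnegrE.
  have s3 : ((2 ^ m).*2.+1)%:R ^+ d <= (3 * X) ^+ d by rewrite lerXn2r ?nnegrE.
  have p1 := mulr_ge0 c0 (sqr_ge0 ((2 ^ m).*2.+1)%:R).
  have p2 := exprn_ge0 3 H0.
  apply: ler_pM; [by apply: mulr_ge0 => //; exact: mulr_ge0|exact: exprn_ge0| |exact: s3].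
  apply: ler_wpM2r => //; apply: ler_pM; [exact: p1|exact: p2| |exact: s2].
  exact: ler_wpM2l.
apply: le_trans step _.
have -> : 2 ^+ 13 * ((37 + 2 * d%:R) * X ^+ 2) * (3 * X) ^+ 2 *
    m.+3%:R ^+ 3 / (2 `^ (m%:R * ex)) ^+ 2 * (3 * X) ^+ d =
   C1 * m.+3%:R ^+ 3 * (X ^+ (4 + d) / (2 `^ (m%:R * ex)) ^+ 2).
  by rewrite /C1 !exprMn exprD; field; rewrite gt_eqF // powR_gt0.
have -> : X ^+ (4 + d) / (2 `^ (m%:R * ex)) ^+ 2 = 2 `^ (m%:R * loss).
  rewrite -!powR_mulrn ?powR_ge0 // /X -!powRrM -powRN -powRD ?pnatr_eq0 ?implybT //.
  by congr (_ `^ _); rewrite natrD /ex /loss; field.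
rewrite [leRHS](_ : _ = C1 * (C0 * 2 `^ (m%:R * eta)) * 2 `^ (m%:R * loss)); last by ring.
by rewrite ler_wpM2r ?powR_ge0 // ler_pM2l.
Qed.

End dyadic_scale.

(** * Bessel's inequality in Sobolev spaces *)

Section summable_families.
Context (R : realType) (I : choiceType).
Implicit Types (a b : I -> R) (K L : {fset I}).

Lemma big_fset_subset (V : nmodType) K L (F : I -> V) : (K `<=` L)%fset ->
  \sum_(i <- L) F i = \sum_(i <- K) F i + \sum_(i <- L | i \notin K) F i.
Proof.
move=> KL; rewrite (bigID (mem K)) /=; congr (_ + _).
rewrite -big_filter; apply: perm_big; apply: uniq_perm; rewrite ?filter_uniq ?fset_uniq //.
by move=> i; rewrite mem_filter andb_idr // => iK; exact: (fsubsetP KL).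
Qed.

Lemma esum_ge_fset b K : (forall i, 0 <= b i) ->
  ((\sum_(i <- K) b i)%:E <= \esum_(i in [set: I]) (b i)%:E)%E.
Proof.
move=> b0; apply: esum_ge; exists [set` K]; first by split.
by rewrite fsbig_finite //= set_fsetK sumEFin.
Qed.

Lemma fset_sum_le b K L : (forall i, 0 <= b i) -> (K `<=` L)%fset ->
  \sum_(i <- K) b i <= \sum_(i <- L) b i.
Proof.
move=> b0 KL; rewrite (big_fset_subset _ KL) lerDl; exact: sumr_ge0.
Qed.

Lemma esum_approx b : (forall i, 0 <= b i) ->
  (\esum_(i in [set: I]) (b i)%:E < +oo)%E -> forall e : R, 0 < e ->
  exists K, forall L, (K `<=` L)%fset ->
    `|fine (\esum_(i in [set: I]) (b i)%:E) - \sum_(i <- L) b i| <= e.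
Proof.
move=> b0 bfin e e0; set p := esum _ _.
have pge0 : (0 <= p)%E by apply: esum_ge0 => i _; rewrite lee_fin.
have pfin : p \is a fin_num by rewrite ge0_fin_numE.
have : (p - e%:E < p)%E by rewrite lteBlDr // lteDl // lte_fin.
move=> /ereal_sup_gt[_ [A [finA _] <-]] h.
exists (fset_set A) => L AL.
have leL : \sum_(i <- L) b i <= fine p by rewrite -lee_fin fineK //; exact: esum_ge_fset.
rewrite ger0_norm ?subr_ge0 // lerBlDr addrC -lerBlDr.
apply: le_trans (fset_sum_le b0 AL).
rewrite -lee_fin EFinB fineK //; apply: ltW; apply: lt_le_trans h _.
by rewrite fsbig_finite //= sumEFin.
Qed.

Lemma rsum_approx a : (\esum_(i in [set: I]) `|a i|%:E < +oo)%E ->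
  forall e : R, 0 < e -> exists K, forall L, (K `<=` L)%fset ->
    `|rsum a - \sum_(i <- L) a i| <= e.
Proof.
move=> afin e e0.
pose p i := Num.max (a i) 0; pose q i := Num.max (- a i) 0.
have p0 i : 0 <= p i by rewrite le_max lexx orbT.
have q0 i : 0 <= q i by rewrite le_max lexx orbT.
have pa i : p i <= `|a i| by rewrite ge_max normr_ge0 ler_norm.
have qa i : q i <= `|a i| by rewrite ge_max normr_ge0 -normrN ler_norm.
have apq i : a i = p i - q i.
  by rewrite /p /q; case: (lerP (a i) 0) => h; case: (lerP (- a i) 0) => h'; lra.
have fp : (\esum_(i in [set: I]) (p i)%:E < +oo)%E.
  by apply: le_lt_trans afin; apply: le_esum => i _; rewrite lee_fin.
have fq : (\esum_(i in [set: I]) (q i)%:E < +oo)%E.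
  by apply: le_lt_trans afin; apply: le_esum => i _; rewrite lee_fin.
have e2 : 0 < e / 2 by rewrite divr_gt0.
have [K1 H1] := esum_approx p0 fp e2; have [K2 H2] := esum_approx q0 fq e2.
exists (K1 `|` K2)%fset => L; rewrite fsubUset => /andP[/H1 h1 /H2 h2].
have -> : rsum a = fine (\esum_(i in [set: I]) (p i)%:E) - fine (\esum_(i in [set: I]) (q i)%:E).
  rewrite /rsum -fineB.
  - congr (fine (_ - _)); apply: eq_esum => i _; rewrite ?funeposE ?funenegE /=.
      by rewrite -EFin_max.
    by rewrite -EFin_max.
  - by rewrite ge0_fin_numE // esum_ge0 // => i _; rewrite lee_fin.
  - by rewrite ge0_fin_numE // esum_ge0 // => i _; rewrite lee_fin.
have -> : \sum_(i <- L) a i = \sum_(i <- L) p i - \sum_(i <- L) q i.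
  by rewrite -sumrB; apply: eq_bigr => i _; exact: apq.
move: h1 h2; set P := fine _; set Q := fine _; set SP := \sum_(i <- L) p i.
set SQ := \sum_(i <- L) q i => h1 h2.
have -> : P - Q - (SP - SQ) = (P - SP) - (Q - SQ) by ring.
by apply: le_trans (ler_normB _ _) _; lra.
Qed.

Lemma csum_approx (a : I -> R[i]) : csummable a ->
  forall e : R, 0 < e -> exists K, forall L, (K `<=` L)%fset ->
    normc (csum a - \sum_(i <- L) a i) <= e.
Proof.
move=> afin e e0; have e2 : 0 < e / 2 by rewrite divr_gt0.
have sub (g : I -> R) : (forall i, `|g i| <= normc (a i)) ->
    (\esum_(i in [set: I]) `|g i|%:E < +oo)%E.
  move=> ga; apply: le_lt_trans afin; apply: le_esum => i _.
  by rewrite /= lee_fin (le_trans (ga i)) // ler_norm.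
have [K1 H1] := rsum_approx (sub _ (fun i => normRe_le (a i))) e2.
have [K2 H2] := rsum_approx (sub _ (fun i => normIm_le (a i))) e2.
exists (K1 `|` K2)%fset => L; rewrite fsubUset => /andP[/H1 h1 /H2 h2].
apply: le_trans (normc_le_ReIm _) _.
have -> : complex.Re (csum a - \sum_(i <- L) a i) =
    rsum (fun i => complex.Re (a i)) - \sum_(i <- L) complex.Re (a i).
  by rewrite -Re_sum /csum; case: (\sum_(i <- L) a i).
have -> : complex.Im (csum a - \sum_(i <- L) a i) =
    rsum (fun i => complex.Im (a i)) - \sum_(i <- L) complex.Im (a i).
  by rewrite -Im_sum /csum; case: (\sum_(i <- L) a i).
lra.
Qed.

Lemma normc_csum_le (a : I -> R[i]) (B : R) :
  (forall K, \sum_(i <- K) normc (a i) <= B) -> csummable a /\ normc (csum a) <= B.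
Proof.
move=> HB; have sa : csummable a.
  apply: (@le_lt_trans _ _ B%:E); last exact: ltry.
  apply: ge_ereal_sup => _ [A [finA _] <-].
  rewrite fsbig_finite //=; under eq_bigr do rewrite ger0_norm ?normc_ge0 //.
  by rewrite sumEFin lee_fin.
split=> //; apply/ler_addgt0Pr => e e0.
have [K HK] := csum_approx sa e0; have := HK K (fsubset_refl K) => h.
have -> : csum a = \sum_(i <- K) a i + (csum a - \sum_(i <- K) a i) by rewrite addrC subrK.
apply: le_trans (le_normcD _ _) _; apply: lerD => //.
exact: le_trans (normc_sum _ _ _) (HB K).
Qed.

End summable_families.

Section bessel_inequality.
Context (R : realType) (I : choiceType) (J : nat).
Variable F : 'I_J -> I -> R[i].
Hypothesis F_summable : forall i j, csummable (fun k => F i k * (F j k)^*).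
Hypothesis F_orthonormal : forall i j, csum (fun k => F i k * (F j k)^*) = (i == j)%:R.

(** The usual expansion of the squared residual [psi - \sum_j (c j)^* F_j]. The orthonormality
    relations are infinite series, so it is carried out on a finite [L] containing [K] on which they
    hold up to a small error. *)
Lemma bessel_fset (K : {fset I}) (phi : I -> R[i]) :
  \sum_j normc (\sum_(k <- K) F j k * phi k) ^+ 2 <= \sum_(k <- K) normc (phi k) ^+ 2.
Proof.
pose c j := \sum_(k <- K) F j k * phi k.
apply/ler_addgt0Pr => e e0.
pose T := \sum_i \sum_j normc (c i) * normc (c j).
have T0 : 0 <= T by apply: sumr_ge0 => i _; apply: sumr_ge0 => j _; rewrite mulr_ge0 ?normc_ge0.
(* The total error is at most [T * (e / (T + 1)) <= e], also when [T = 0]. *)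
have eT : 0 < e / (T + 1) by rewrite divr_gt0 // ltr_wpDl.
have [L [KL HL]] : exists L : {fset I}, (K `<=` L)%fset /\ forall i j,
    normc ((i == j)%:R - \sum_(k <- L) F i k * (F j k)^*) <= e / (T + 1).
  have ex i j : {M : {fset I} | forall L, (M `<=` L)%fset ->
      normc ((i == j)%:R - \sum_(k <- L) F i k * (F j k)^*) <= e / (T + 1)}.
    apply: cid; have [M HM] := csum_approx (F_summable i j) eT.
    by exists M => L /HM; rewrite F_orthonormal.
  exists (K `|` \big[fsetU/fset0]_i \big[fsetU/fset0]_j sval (ex i j))%fset; split.
    exact: fsubsetUl.
  move=> i j; apply: (svalP (ex i j)).
  apply: fsubset_trans (fsubsetUr _ _).
  rewrite (bigD1 i) //= (bigD1 j) //= -fsetUA; exact: fsubsetUl.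
pose psi k : R[i] := if k \in K then (phi k)^* else 0.
pose r k := psi k - \sum_j (c j)^* * F j k.
have cE j : c j = \sum_(k <- L) F j k * (psi k)^*.
  rewrite (big_fset_subset _ KL) [X in _ + X]big1 ?addr0 => [|k /negbTE kK].
    by apply: eq_fbigr => k kK _; rewrite /psi kK conjCK.
  by rewrite /psi kK rmorph0 mulr0.
have pE : \sum_(k <- K) normc (phi k) ^+ 2 = \sum_(k <- L) normc (psi k) ^+ 2.
  rewrite (big_fset_subset _ KL) [X in _ + X]big1 ?addr0 => [|k /negbTE kK].
    by apply: eq_fbigr => k kK _; rewrite /psi kK normc_conj.
  by rewrite /psi kK normc0 expr0n.
have key : (\sum_(k <- L) normc (r k) ^+ 2)%:C =
   (\sum_(k <- L) normc (psi k) ^+ 2)%:C - (\sum_j normc (c j) ^+ 2)%:C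
   - \sum_i \sum_j (c i)^* * c j * ((i == j)%:R - \sum_(k <- L) F i k * (F j k)^*).
  have E k : (normc (r k) ^+ 2)%:C = (normc (psi k) ^+ 2)%:C
     - \sum_j (c j) * (F j k * (psi k)^*)^* - \sum_j (c j)^* * (F j k * (psi k)^*)
     + \sum_i \sum_j (c i)^* * c j * (F i k * (F j k)^*).
    rewrite !normc_sqr_conj /r rmorphB rmorph_sum /=.
    rewrite mulrBl !mulrBr mulr_sumr mulr_suml big_distrlr /=.
    rewrite opprB addrA [in RHS]addrAC -!addrA; congr (_ + _).
    have -> : \sum_i psi k * ((c i)^* * F i k)^* = \sum_j c j * (F j k * (psi k)^*)^*.
      by apply: eq_bigr => j _; rewrite !rmorphM /= !conjCK; ring.
    have -> : \sum_i (c i)^* * F i k * (psi k)^* = \sum_j (c j)^* * (F j k * (psi k)^*).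
      by apply: eq_bigr => j _; rewrite mulrA.
    have -> : \sum_i \sum_j (c i)^* * F i k * ((c j)^* * F j k)^* =
       \sum_i \sum_j (c i)^* * c j * (F i k * (F j k)^*).
      by apply: eq_bigr => i _; apply: eq_bigr => j _; rewrite !rmorphM /= !conjCK; ring.
    ring.
  rewrite rmorph_sum /=; under eq_bigr do rewrite E.
  rewrite big_split /= !sumrB -rmorph_sum /=.
  have -> : \sum_(k <- L) \sum_j c j * (F j k * (psi k)^*)^* = (\sum_j normc (c j) ^+ 2)%:C.
    rewrite exchange_big /= rmorph_sum /=; apply: eq_bigr => j _.
    by rewrite -mulr_sumr -rmorph_sum /= -cE normc_sqr_conj.
  have -> : \sum_(k <- L) \sum_j (c j)^* * (F j k * (psi k)^*) = (\sum_j normc (c j) ^+ 2)%:C.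
    rewrite exchange_big /= rmorph_sum /=; apply: eq_bigr => j _.
    by rewrite -mulr_sumr -cE normc_sqr_conj mulrC.
  have -> : \sum_(k <- L) \sum_i \sum_j (c i)^* * c j * (F i k * (F j k)^*) =
     \sum_i \sum_j (c i)^* * c j * \sum_(k <- L) F i k * (F j k)^*.
    rewrite exchange_big /=; apply: eq_bigr => i _; rewrite exchange_big /=.
    by apply: eq_bigr => j _; rewrite -mulr_sumr.
  have -> : \sum_i \sum_j (c i)^* * c j * ((i == j)%:R - \sum_(k <- L) F i k * (F j k)^*) =
     \sum_i \sum_j (c i)^* * c j * (i == j)%:R -
     \sum_i \sum_j (c i)^* * c j * \sum_(k <- L) F i k * (F j k)^*.
    by rewrite -sumrB; apply: eq_bigr => i _; rewrite -sumrB; apply: eq_bigr => j _; rewrite mulrBr.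
  have -> : \sum_i \sum_j (c i)^* * c j * (i == j)%:R = (\sum_j normc (c j) ^+ 2)%:C.
    rewrite rmorph_sum /=; apply: eq_bigr => i _; rewrite (bigD1 i) //= big1 => [|j ji].
      by rewrite eqxx mulr1 addr0 normc_sqr_conj mulrC.
    by rewrite eq_sym (negbTE ji) mulr0.
  ring.
have : 0 <= \sum_(k <- L) normc (r k) ^+ 2 by apply: sumr_ge0 => k _; exact: sqr_ge0.
have := congr1 (@complex.Re R) key; set E := \sum_i \sum_j (c i)^* * c j * _.
have -> : complex.Re ((\sum_(k <- L) normc (psi k) ^+ 2)%:C - (\sum_j normc (c j) ^+ 2)%:C - E) =
   \sum_(k <- L) normc (psi k) ^+ 2 - \sum_j normc (c j) ^+ 2 - complex.Re E by case: E.
rewrite [complex.Re _%:C]/= => ->; rewrite -pE => h.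
have : normc E <= e.
  apply: (@le_trans _ _ (T * (e / (T + 1)))); last first.
    rewrite mulrA ler_pdivrMr ?ltr_wpDl //; nra.
  apply: le_trans (normc_sum _ _ _) _; rewrite mulr_suml; apply: ler_sum => i _.
  apply: le_trans (normc_sum _ _ _) _; rewrite mulr_suml; apply: ler_sum => j _.
  rewrite !normcM normc_conj ler_wpM2l ?mulr_ge0 ?normc_ge0 //; exact: HL.
have := normRe_le E; rewrite ler_norml => /andP[h1 h2] h3; lra.
Qed.

End bessel_inequality.

(** * Frequency shells *)

Section frequency_shells.
Context (d : nat).
Local Notation freq := (d.-tuple int).

Definition cube (N : nat) : {fset freq} :=
  [fset k in [seq @box_freq d N f | f <- enum {: box d N}]]%fset.

Lemma sum_cube (V : nmodType) N (F : freq -> V) :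
  \sum_(k <- cube N) F k = \sum_(f : box d N) F (box_freq f).
Proof.
transitivity (\sum_(k <- [seq @box_freq d N f | f <- enum {: box d N}]) F k).
  apply: perm_big; apply: uniq_perm; first exact: fset_uniq.
    by rewrite map_inj_uniq ?enum_uniq //; exact: box_freq_inj.
  by move=> k; rewrite inE.
by rewrite big_map big_enum.
Qed.

Lemma mem_cube N k : (k \in cube N) = [forall i, (`|tnth k i| <= N)%N].
Proof.
rewrite inE; apply/mapP/forallP => [[f _ ->] i|kN].
  rewrite tnth_mktuple; move: (nat_of_ord (f i)) (ltn_ord (f i)) => a; clear; lia.
have kl i : (`|(tnth k i + N%:Z)%R|%N < N.*2.+1)%N by have := kN i; lia.
exists [ffun i => Ordinal (kl i)]; first by rewrite mem_enum.
apply: eq_from_tnth => i; rewrite tnth_mktuple ffunE /=.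
by move: (kN i); move: (tnth k i) => z; clear; lia.
Qed.

Lemma cube_sub (A : {fset freq}) : exists M, (A `<=` cube (2 ^ M))%fset.
Proof.
exists (\sum_(k <- A) \sum_i `|tnth k i|)%N.
apply/fsubsetP => k kA; rewrite mem_cube; apply/forallP => i.
apply: leq_trans (ltnW (ltn_expl _ (leqnn 2))).
by rewrite (big_fsetD1 k) //= (bigD1 i) //= -addnA leq_addr.
Qed.

Lemma cube_mono M M' : (M <= M')%N -> (cube (2 ^ M) `<=` cube (2 ^ M'))%fset.
Proof.
move=> MM; apply/fsubsetP => k; rewrite !mem_cube => /forallP h; apply/forallP => i.
by apply: leq_trans (h i) _; rewrite leq_exp2l.
Qed.

(** Used only inside the cube of side [2 ^ m]. The exemption at [m = 0] keeps the whole innermost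
    cube; there [m.-1] is 0 as well and nothing would be left. *)
Definition shell m (k : freq) : bool := (m == 0)%N || (k \notin cube (2 ^ m.-1)).

Lemma sum_cube_shells (V : nmodType) M (F : freq -> V) :
  \sum_(k <- cube (2 ^ M)) F k =
  \sum_(m < M.+1) \sum_(f : box d (2 ^ m)) if shell m (box_freq f) then F (box_freq f) else 0.
Proof.
elim: M => [|M IH]; first by rewrite big_ord1 sum_cube.
rewrite big_ord_recr /= -IH (big_fset_subset _ (cube_mono (leqnSn M))); congr (_ + _).
by rewrite -(sum_cube (2 ^ M.+1) (fun k => if shell M.+1 k then F k else 0)) -big_mkcond.
Qed.

Lemma one_le_sqnorm (R : realType) (k : freq) : 1 <= 1 + sqnorm R k.
Proof. by rewrite lerDl sumr_ge0 // => i _; rewrite sqr_ge0. Qed.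

(** Outside the smaller cube some coordinate exceeds [2 ^ (m - 1)]. At [m = 0] the exponent is
    really -1 and the bound reads [1 / 4 <= 1 + |k|^2]. *)
Lemma shell_sqnorm (R : realType) m (k : freq) : shell m k -> (2 `^ (m%:R - 1) : R) ^+ 2 <=
    1 + sqnorm R k.
Proof.
case: m => [_|m].
  apply: le_trans (one_le_sqnorm _ k); rewrite sub0r expr_le1 ?powR_ge0 //.
  by rewrite -[leRHS](powRr0 2); apply: ler_powR; rewrite ?ler1n // lerN10.
rewrite /shell /= mem_cube negb_forall => /fintype.existsP[i0]; rewrite -ltnNge => ki.
have -> : m.+1%:R - 1 = m%:R :> R by rewrite -natr1 addrK.
rewrite powR_mulrn // -natrX.
apply: (@le_trans _ _ ((tnth k i0)%:~R ^+ 2)).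
  rewrite -[leRHS]real_normK ?num_real // lerXn2r ?nnegrE // -intr_norm.
  by rewrite -abszE -pmulrn ler_nat ltnW.
rewrite /sqnorm (bigD1 i0) //= addrCA lerDl addr_ge0 // sumr_ge0 // => j _.
exact: sqr_ge0.
Qed.

Lemma shell_weight (R : realType) (s : R) m (k : freq) : 0 <= s -> shell m k ->
  2 `^ (s * (m%:R - 1)) <= (1 + sqnorm R k) `^ (s / 2).
Proof.
move=> s0 /(shell_sqnorm R) h.
have -> : 2 `^ (s * (m%:R - 1)) = ((2 `^ (m%:R - 1)) ^+ 2) `^ (s / 2) :> R.
  by rewrite -powR_mulrn ?powR_ge0 // -!powRrM; congr (_ `^ _); field.
have s2 : 0 <= s / 2 by rewrite divr_ge0.
have n1 : (2 `^ (m%:R - 1) : R) ^+ 2 \is Num.nneg by rewrite nnegrE sqr_ge0.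
have n2 : 1 + sqnorm R k \is Num.nneg by rewrite nnegrE (le_trans ler01) // one_le_sqnorm.
exact: (ge0_ler_powR s2 n1 n2 h).
Qed.

Definition sqnorm_nat (k : freq) : nat := \sum_i `|tnth k i| ^ 2.

Lemma sqnorm_natE (R : realType) k : (sqnorm_nat k)%:R = sqnorm R k.
Proof.
rewrite /sqnorm_nat natr_sum; apply: eq_bigr => i _.
by rewrite natrX pmulrn abszE intr_norm real_normK ?num_real.
Qed.

Lemma sqnorm_nat_box N (f : box d N) : (sqnorm_nat (box_freq f) <= d * N ^ 2)%N.
Proof.
have -> : (d * N ^ 2 = \sum_(i < d) N ^ 2)%N by rewrite sum_nat_const card_ord.
apply: leq_sum => i _; rewrite leq_exp2r //.
have : box_freq f \in cube N.
  by rewrite inE; apply: map_f; rewrite mem_enum.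
by rewrite mem_cube => /forallP.
Qed.

End frequency_shells.

(** * From orthonormality in the Sobolev space to one shell *)

Section strichartz_majorant.
Context (R : realType) (d : nat) (s : R).
Local Notation point := (d.-tuple (measurableTypeR R)).
Local Notation freq := (d.-tuple int).
Variable f : nat -> point -> R[i].
Hypothesis f_orthonormal : orthonormal_Hs s f.

(** With this weight, orthonormality in [H^s] becomes orthonormality in [l^2] of the frequencies. *)
Let F (j : nat) (k : freq) : R[i] := ((1 + sqnorm R k) `^ (s / 2))%:C * fourier (f j) k.

Let F_sqr_fin j : (\esum_(k in [set: freq]) (normc (F j k) ^+ 2)%:E < +oo)%E.
Proof.
have [[_ _ +] _] := conj (f_orthonormal.1 j) I.
rewrite /Hs_norm => /lty_poweRy h; apply: le_lt_trans (h _) => //.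
apply: le_esum => k _; rewrite lee_fin /F normcM normc_real ger0_norm ?powR_ge0 //.
Qed.

Let F_summable i j : csummable (fun k => F i k * (F j k)^*).
Proof.
apply: (@le_lt_trans _ _ (\esum_(k in [set: freq]) (normc (F i k) ^+ 2)%:E +
   \esum_(k in [set: freq]) (normc (F j k) ^+ 2)%:E)%E); last exact: lte_add_pinfty.
rewrite -esumD; [|by move=> k _; rewrite lee_fin sqr_ge0|by move=> k _; rewrite lee_fin sqr_ge0].
have pw k : (`|(normc (F i k * (F j k)^*))%:E| <=
    (normc (F i k) ^+ 2)%:E + (normc (F j k) ^+ 2)%:E)%E.
  rewrite gee0_abs ?lee_fin ?normc_ge0 // normcM normc_conj.
  have := normc_ge0 (F i k); have := normc_ge0 (F j k).
  have := sqr_ge0 (normc (F i k) - normc (F j k)); nra.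
by apply: le_esum => k _; exact: pw.
Qed.

Let F_orthonormal i j : csum (fun k => F i k * (F j k)^*) = (i == j)%:R.
Proof.
rewrite -(f_orthonormal.2 i j) /Hs_inner; congr csum; apply/funext => k.
have -> : ((1 + sqnorm R k) `^ s)%:C = ((1 + sqnorm R k) `^ (s / 2))%:C * ((1 + sqnorm R k)
    `^ (s / 2))%:C :> R[i].
  rewrite -rmorphM /=; congr _%:C; rewrite -powRD; first by congr (_ `^ _); field.
  have h0 : 1 + sqnorm R k != 0 by rewrite gt_eqF // (lt_le_trans ltr01) // one_le_sqnorm.
  by rewrite h0 implybT.
rewrite /F rmorphM /=.
have -> : ((1 + sqnorm R k) `^ (s / 2))%:C^* = ((1 + sqnorm R k) `^ (s / 2))%:C :> R[i].
  by apply/eqP; rewrite eq_complex /= oppr0 !eqxx.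
ring.
Qed.

Definition shell_weight_at m : R := 2 `^ (s * (m%:R - 1)).

(* On the [m]-th shell the weight is at most [(1 + |k|^2)^(s/2)], hence these
   coefficients inherit Bessel's inequality from the orthonormality in [H^s]. *)
Definition shell_coef m (j : nat) (b : box d (2 ^ m)) : R[i] :=
  if shell m (box_freq b) then (shell_weight_at m)%:C * fourier (f j) (box_freq b) else 0.

Hypothesis s_ge0 : 0 <= s.

Lemma shell_coef_bessel m J (phi : box d (2 ^ m) -> R[i]) :
  \sum_(j < J) normc (\sum_b @shell_coef m j b * phi b) ^+ 2 <= \sum_b normc (phi b) ^+ 2.
Proof.
pose q (k : freq) : R := if shell m k then shell_weight_at m / (1 + sqnorm R k) `^ (s / 2) else 0.
have p0 k : 0 < (1 + sqnorm R k) `^ (s / 2).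
  by rewrite powR_gt0 // (lt_le_trans ltr01) // one_le_sqnorm.
have q01 k : 0 <= q k <= 1.
  rewrite /q; case: ifP => [sh|_]; last by rewrite lexx ler01.
  by rewrite divr_ge0 ?powR_ge0 //= ler_pdivrMr // mul1r shell_weight.
(* The sum has at most one term, as [box_freq] is injective: it transports [phi] to frequencies
   without choosing an inverse. *)
pose psi k := (q k)%:C * \sum_(b | box_freq b == k) phi b.
have psiE b : psi (box_freq b) = (q (box_freq b))%:C * phi b.
  rewrite /psi (big_pred1 b) // => b' /=; exact: (inj_eq (@box_freq_inj d (2 ^ m))).
have := bessel_fset (fun i j : 'I_J => F_summable i j) (fun i j : 'I_J => F_orthonormal i j)
  (cube d (2 ^ m)) psi.
rewrite sum_cube => h.
apply: (@le_trans _ _ (\sum_(b : box d (2 ^ m)) normc (psi (box_freq b)) ^+ 2)).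
  apply: le_trans h; apply: ler_sum => j _; rewrite sum_cube.
  rewrite le_eqVlt; apply/orP; left; apply/eqP; congr (normc _ ^+ 2); apply: eq_bigr => b _.
  rewrite psiE /shell_coef /F /q; case: ifP => _; last first.
    by rewrite (mul0r (phi b) : 0%:C * phi b = 0) mulr0.
  rewrite mulrACA mulrA -rmorphM /= mulrCA mulrV ?mulr1 ?unitfE ?gt_eqF //.
apply: ler_sum => b _; rewrite psiE normcM normc_real exprMn.
have /andP[h0 h1] := q01 (box_freq b).
rewrite -[leRHS]mul1r ler_wpM2r ?sqr_ge0 // ger0_norm // expr_le1 //.
Qed.

Variable l : nat -> R.
Hypothesis l_ge0 : forall j, 0 <= l j.

Definition shell_density m J b (x : point) : R :=
  box_density (samples d m) (fun j : 'I_J => @shell_coef m j) (fun j : 'I_J => l j) b x.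

Definition shell_max m J (x : point) : R :=
  \big[Num.max/0]_(b < samples d m) shell_density m J b x.

Lemma shell_max_ge0 m J x : 0 <= shell_max m J x.
Proof.
rewrite /shell_max; elim/big_ind: _ => [//|u v u0 v0|b _]; first by rewrite le_max u0.
exact: box_density_ge0.
Qed.

Lemma bmeas_shell_max m J : bmeas (shell_max m J).
Proof. by apply: bmeas_bigmax => b; exact: bmeas_box_density. Qed.

Lemma shell_max_mono m J J' x : (J <= J')%N -> shell_max m J x <= shell_max m J' x.
Proof.
move=> JJ; apply: le_bigmax2 => b _.
rewrite /shell_density /box_density.
rewrite (big_ord_widen J' (fun j => l j * normc (\sum_f0 @shell_coef m j f0 * cexp (phase
    (samples d m) b f0 x)) ^+ 2) JJ).
rewrite big_mkcond /=; apply: ler_sum => j _; case: ifP => // _.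
by rewrite mulr_ge0 ?sqr_ge0.
Qed.

Definition shell_piece m (j : nat) (t : R) (x : point) : R[i] :=
  \sum_(b : box d (2 ^ m)) if shell m (box_freq b) then
    cexp (dotp (box_freq b) x + t * sqnorm R (box_freq b)) * fourier (f j) (box_freq b) else 0.

(** Sampling applies because [|k|^2] is a natural number at most [d * (2 ^ m) ^ 2], the bandwidth in
    time. The weight is constant on the shell and is divided out. *)
Lemma shell_piece_density m J t x :
  \sum_(j < J) l j * normc (shell_piece m j t x) ^+ 2 <=
  (shell_weight_at m)^-1 ^+ 2 * (9 / 4 * shell_max m J x).
Proof.
have w0 : 0 < shell_weight_at m by rewrite powR_gt0.
have DP : ((d * (2 ^ m) ^ 2).*2 < samples d m)%N.
  rewrite /samples doubleMl; apply: (@leq_trans ((1 + d.*2) * (2 ^ m) ^ 2)).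
    by rewrite mulnDl mul1n -add1n leq_add2r sqrn_gt0 expn_gt0.
  by rewrite leq_mul2r leq_add2r orbT.
have := @sampling_density R _ _ t DP (box d (2 ^ m)) J (fun j => l j)
  (fun b => sqnorm_nat (box_freq b))
  (fun j b => @shell_coef m j b * cexp (dotp (box_freq b) x)) (shell_max m J x).
rewrite /= => /(_ (fun j => l_ge0 j) (fun b => sqnorm_nat_box b)) h.
have UE j : \sum_b @shell_coef m j b * cexp (dotp (box_freq b) x) *
    cexp ((sqnorm_nat (box_freq b))%:R * t) = (shell_weight_at m)%:C * shell_piece m j t x.
  rewrite mulr_sumr; apply: eq_bigr => b _.
  rewrite /shell_coef sqnorm_natE; case: ifP => _; last by rewrite !mul0r mulr0.
  rewrite cexpD (mulrC t); ring.
apply: (@le_trans _ _ ((shell_weight_at m)^-1 ^+ 2 * \sum_(j < J) l j * normc (\sum_b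
    @shell_coef m j b * cexp (dotp (box_freq b) x) *
    cexp ((sqnorm_nat (box_freq b))%:R * t)) ^+ 2)).
  rewrite le_eqVlt; apply/orP; left; apply/eqP; rewrite mulr_sumr; apply: eq_bigr => j _.
  rewrite UE normcM normc_real gtr0_norm //; field; exact: lt0r_neq0.
rewrite ler_wpM2l ?sqr_ge0 //; apply: h.
move=> b; apply: le_trans (le_bigmax 0 (fun b : 'I_(samples d m) => shell_density m J b x) b).
rewrite le_eqVlt; apply/orP; left; apply/eqP; apply: eq_bigr => j _.
congr (_ * normc _ ^+ 2); apply: eq_bigr => k _.
by rewrite -mulrA -cexpD /phase sqnorm_natE mulrC (mulrC _ (sqnorm R _)) mulrC.
Qed.

End strichartz_majorant.

(** * Recombination of the shells *)

Section square_function.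
Context (R : realType) (d : nat) (s eta C : R).
Local Notation point := (d.-tuple (measurableTypeR R)).
Hypothesis s_ge0 : 0 <= s.
Hypothesis eta_gt0 : 0 < eta.
Hypothesis s_eta : 4 * s = loss R d + 5 * eta.
Hypothesis C_gt0 : 0 < C.
Hypothesis mass : forall m, exists2 mu : R, 0 < mu &
  kernel_mass d (2 ^ m) (samples d m) mu <= C * 2 `^ (m%:R * (loss R d + eta)).

Definition ratio : R := 2 `^ (- eta).
Let q := ratio.
Let Q := (1 - q)^-1.

Lemma ratio_gt0 : 0 < q. Proof. by rewrite powR_gt0. Qed.

Lemma ratio_lt1 : q < 1.
Proof.
rewrite /q /ratio powRN invf_lt1 ?powR_gt0 //.
by rewrite /powR pnatr_eq0 /= expR_gt1 mulr_gt0 // ln_gt0 // ltr1n.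
Qed.

Lemma geometric_sum_le M : \sum_(m < M) q ^+ m <= Q.
Proof.
have q1 : 0 < 1 - q by rewrite subr_gt0 ratio_lt1.
rewrite /Q -[leRHS]mul1r ler_pdivlMr // mulrC -opprB mulNr -subrX1 opprB.
by rewrite gerBl exprn_ge0 // ltW // ratio_gt0.
Qed.

Let Q_ge0 : 0 <= Q.
Proof. by rewrite invr_ge0 subr_ge0 ltW // ratio_lt1. Qed.

(* [ratio ^+ m] is the slack in the estimate of the [m]-th shell; it is spent on two
   uses of the Cauchy-Schwarz inequality over the shells. *)
Definition square_weight m : R := (q ^+ m)^-1 ^+ 3 * (shell_weight_at s m)^-1 ^+ 4.

Lemma square_weight_ge0 m : 0 <= square_weight m.
Proof.
rewrite mulr_ge0 // exprn_ge0 // invr_ge0 ?powR_ge0 //.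
by rewrite exprn_ge0 // ltW // ratio_gt0.
Qed.

Lemma square_weightE m :
  square_weight m * 2 `^ (m%:R * (loss R d + eta)) = 2 `^ (4 * s) * q ^+ m.
Proof.
rewrite /square_weight /shell_weight_at /q /ratio.
rewrite -[(2 `^ (- eta)) ^+ m]powR_mulrn ?powR_ge0 // -powRrM -!powRN.
rewrite -![_ ^+ 3]powR_mulrn ?powR_ge0 // -![_ ^+ 4]powR_mulrn ?powR_ge0 // -!powRrM.
rewrite -!powRD ?pnatr_eq0 ?implybT //; congr (_ `^ _).
have -> : loss R d = 4 * s - 5 * eta by rewrite s_eta addrK.
ring.
Qed.

Variables (f : nat -> point -> R[i]) (l : nat -> R).
Hypothesis f_orthonormal : orthonormal_Hs s f.
Hypothesis l_ge0 : forall j, 0 <= l j.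

Lemma schrodinger_sum_shells M j t x :
  schrodinger_sum (f j) (cube d (2 ^ M)) t x = \sum_(m < M.+1) shell_piece f m j t x.
Proof. by rewrite /schrodinger_sum sum_cube_shells. Qed.

(** The first Cauchy-Schwarz, inside the modulus, costs [Q] and [(q ^+ m)^-1]. The second, on the
    square of the resulting sum written as [q ^+ m * ((q ^+ m)^-1 ^+ 2 * G m)], leaves
    [(q ^+ m)^-1 ^+ 3]; the total factor is [Q ^+ 2 * Q]. *)
Lemma schrodinger_sum_le M J t x :
  (\sum_(j < J) l j * normc (schrodinger_sum (f j) (cube d (2 ^ M)) t x) ^+ 2) ^+ 2 <=
  Q ^+ 3 * (9 / 4) ^+ 2 * \sum_(m < M.+1) square_weight m * shell_max s f l m J x ^+ 2.
Proof.
have q0 := ratio_gt0; have qm m : 0 < q ^+ m by rewrite exprn_gt0.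
have qn m : q ^+ m != 0 by rewrite gt_eqF.
have wn m : shell_weight_at s m != 0 by rewrite gt_eqF // powR_gt0.
have g0 m : 0 <= shell_max s f l m J x by exact: shell_max_ge0.
pose G m := (shell_weight_at s m)^-1 ^+ 2 * shell_max s f l m J x.
have step1 j : normc (schrodinger_sum (f j) (cube d (2 ^ M)) t x) ^+ 2 <=
    Q * \sum_(m < M.+1) (q ^+ m)^-1 * normc (shell_piece f m j t x) ^+ 2.
  rewrite schrodinger_sum_shells.
  apply: (@le_trans _ _ ((\sum_(m < M.+1) q ^+ m * ((q ^+ m)^-1 * normc (shell_piece f m j
      t x))) ^+ 2)).
    rewrite lerXn2r ?nnegrE ?normc_ge0 //.
      by apply: sumr_ge0 => m _; rewrite !mulr_ge0 ?invr_ge0 ?normc_ge0 // ltW.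
    apply: le_trans (normc_sum _ _ _) _; apply: ler_sum => m _.
    by rewrite mulrA mulfV ?mul1r.
  apply: le_trans (cauchy_schwarz_weight _ _) _; first by move=> m; exact: ltW.
  apply: ler_pM; [by apply: sumr_ge0 => m _; exact: ltW| |exact: geometric_sum_le|].
    by apply: sumr_ge0 => m _; rewrite mulr_ge0 ?sqr_ge0 // ltW.
  by apply: ler_sum => m _; rewrite exprMn expr2 !mulrA mulfV // mul1r.
have step2 : \sum_(j < J) l j * normc (schrodinger_sum (f j) (cube d (2 ^ M)) t x) ^+ 2 <=
    Q * (9 / 4) * \sum_(m < M.+1) (q ^+ m)^-1 * G m.
  apply: (@le_trans _ _ (\sum_(j < J) l j *
      (Q * \sum_(m < M.+1) (q ^+ m)^-1 * normc (shell_piece f m j t x) ^+ 2))).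
    by apply: ler_sum => j _; rewrite ler_wpM2l.
  under eq_bigr do rewrite mulrCA.
  rewrite -mulr_sumr -mulrA ler_wpM2l //.
  under eq_bigr do rewrite mulr_sumr.
  rewrite exchange_big /= mulr_sumr; apply: ler_sum => m _.
  under eq_bigr do rewrite mulrCA.
  rewrite -mulr_sumr [leRHS]mulrCA ler_wpM2l ?invr_ge0 ?(ltW (qm _)) //.
  apply: le_trans (shell_piece_density s f l_ge0 m J t x) _.
  by rewrite /G mulrCA.
apply: (@le_trans _ _ ((Q * (9 / 4) * \sum_(m < M.+1) (q ^+ m)^-1 * G m) ^+ 2)).
  rewrite lerXn2r ?nnegrE //.
    by apply: sumr_ge0 => j _; rewrite mulr_ge0 ?sqr_ge0.
  by apply: le_trans step2; apply: sumr_ge0 => j _; rewrite mulr_ge0 ?sqr_ge0.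
rewrite exprMn; apply: (@le_trans _ _ ((Q * (9 / 4)) ^+ 2 * (Q *
    \sum_(m < M.+1) square_weight m * shell_max s f l m J x ^+ 2))); last first.
  by rewrite le_eqVlt; apply/orP; left; apply/eqP; ring.
rewrite ler_wpM2l ?sqr_ge0 //.
rewrite (eq_bigr (fun m : 'I_M.+1 => q ^+ m * ((q ^+ m)^-1 ^+ 2 * G m))); last first.
  by move=> m _; field.
apply: le_trans (cauchy_schwarz_weight _ _) _; first by move=> m; exact: ltW.
apply: ler_pM; [by apply: sumr_ge0 => m _; exact: ltW| |exact: geometric_sum_le|].
  by apply: sumr_ge0 => m _; rewrite mulr_ge0 ?sqr_ge0 // ltW.
apply: ler_sum => m _; rewrite /G /square_weight le_eqVlt; apply/orP; left; apply/eqP.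
by field; rewrite qn wn.
Qed.

(** The full series, with values in the extended reals, is a majorant independent of the truncation
    [M]. *)
Definition square_fun J (x : point) : \bar R :=
  (\sum_(m <oo) (square_weight m * shell_max s f l m J x ^+ 2)%:E)%E.

Let term_ge0 m J x : (0 <= (square_weight m * shell_max s f l m J x ^+ 2)%:E)%E.
Proof. by rewrite lee_fin mulr_ge0 ?square_weight_ge0 ?sqr_ge0. Qed.

Lemma square_fun_ge0 J x : (0 <= square_fun J x)%E.
Proof. by apply: nneseries_ge0 => m _ _; exact: term_ge0. Qed.

Lemma square_fun_mono J J' x : (J <= J')%N -> (square_fun J x <= square_fun J' x)%E.
Proof.
move=> JJ; apply: lee_nneseries => [m _ _|m _]; first exact: term_ge0.
rewrite lee_fin ler_wpM2l ?square_weight_ge0 // lerXn2r ?nnegrE ?shell_max_ge0 //.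
exact: shell_max_mono.
Qed.

Let bterm m J : bmeas (fun x : point => square_weight m * shell_max s f l m J x ^+ 2).
Proof. by apply: bmeasZ; apply: bmeasX; exact: bmeas_shell_max. Qed.

Lemma measurable_square_fun J : measurable_fun setT (square_fun J).
Proof.
apply: ge0_emeasurable_sum => [m x _ _|m _]; first exact: term_ge0.
by apply/measurable_EFinP; exact: bmeas_measurable.
Qed.

Lemma density_le_square_fun M J t x :
  (((\sum_(j < J) l j * normc (schrodinger_sum (f j) (cube d (2 ^ M)) t x) ^+ 2) ^+ 2)%:E
    <= (Q ^+ 3 * (9 / 4) ^+ 2)%:E * square_fun J x)%E.
Proof.
apply: (@le_trans _ _ ((Q ^+ 3 * (9 / 4) ^+ 2)%:E *
    (\sum_(m < M.+1) square_weight m * shell_max s f l m J x ^+ 2)%:E)%E).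
  by rewrite -EFinM lee_fin; exact: schrodinger_sum_le.
apply: lee_wpmul2l; first by rewrite lee_fin mulr_ge0 ?sqr_ge0 // exprn_ge0.
rewrite -sumEFin -(big_mkord predT (fun m => (square_weight m * shell_max s f l m J x ^+ 2)%:E)).
by apply: nneseries_lim_ge => m _ _; exact: term_ge0.
Qed.

Lemma integral_square_fun J :
  (\int[torus R d]_x square_fun J x <=
    (4 * C * 2 `^ (4 * s) * Q)%:E * (\sum_(j < J) l j ^+ 2)%:E)%E.
Proof.
rewrite integral_nneseries //; last first.
  by move=> m; apply/measurable_EFinP; exact: bmeas_measurable.
have S0 : 0 <= \sum_(j < J) l j ^+ 2 by apply: sumr_ge0 => j _; exact: sqr_ge0.
have K0 : 0 <= 4 * C * 2 `^ (4 * s) by rewrite !mulr_ge0 ?powR_ge0 // ltW.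
have bnd m : (\int[torus R d]_x (square_weight m * shell_max s f l m J x ^+ 2)%:E <=
    (4 * C * 2 `^ (4 * s) * (\sum_(j < J) l j ^+ 2) * q ^+ m)%:E)%E.
  rewrite -EFin_Rint // RintZ; last by apply: bmeasX; exact: bmeas_shell_max.
  rewrite lee_fin; have [mu mu0 Hmu] := mass m.
  (* [4 * (2 N + 1)^2 <= 36 * N^2] for [N >= 1]. *)
  have nP : (4 * (2 ^ m).*2.+1 ^ 2 <= samples d m)%N.
    have : (1 <= 2 ^ m)%N by rewrite expn_gt0.
    rewrite /samples; move: (2 ^ m)%N => N N1; nia.
  have := box_maximal mu0 nP (@shell_coef_bessel _ _ _ _ f_orthonormal s_ge0 m J)
    (fun j : 'I_J => l_ge0 j).
  rewrite -/(shell_max s f l m J) => h.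
  apply: (@le_trans _ _ (square_weight m * (4 * (C * 2 `^ (m%:R * (loss R d + eta))) *
      \sum_(j < J) l j ^+ 2))).
    rewrite ler_wpM2l ?square_weight_ge0 //; apply: le_trans h _.
    by rewrite ler_wpM2r // ler_wpM2l.
  rewrite [leLHS](_ : _ = 4 * C * (square_weight m * 2 `^ (m%:R * (loss R d + eta))) *
      \sum_(j < J) l j ^+ 2); last by ring.
  by rewrite square_weightE le_eqVlt; apply/orP; left; apply/eqP; ring.
apply: lime_le.
  by apply: is_cvg_nneseries => m _ _; apply: integral_ge0 => x _; exact: term_ge0.
near=> M; rewrite big_mkord.
apply: (@le_trans _ _ (\sum_(m < M) (4 * C * 2 `^ (4 * s) * (\sum_(j < J) l j ^+ 2) * q ^+
    m)%:E)%E).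
  by apply: lee_sum => m _; exact: bnd.
rewrite sumEFin -EFinM lee_fin -mulr_sumr [leRHS]mulrAC ler_wpM2l ?geometric_sum_le //.
  by rewrite mulr_ge0.
Unshelve. all: by end_near.
Qed.

End square_function.

(** * Passage to almost every time *)

Section integral_lemmas.
Context d (T : measurableType d) (R : realType) (mu : {measure set T -> \bar R}).

(** The integral of a nonnegative function is a supremum over simple functions below it, hence
    monotone without measurability. This matters for the essential supremum in [t], whose
    measurability in [x] is not established. *)
Lemma ge0_le_integral_nonmeasurable (f g : T -> \bar R) : (forall x, 0 <= f x)%E ->
  (forall x, f x <= g x)%E -> (\int[mu]_x f x <= \int[mu]_x g x)%E.
Proof.
move=> f0 fg; have g0 x : (0 <= g x)%E by exact: le_trans (fg x).
rewrite !ge0_integralTE //; apply: ge_ereal_sup => _ [h hf <-].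
by apply: ereal_sup_ubound; exists h => // x; exact: le_trans (fg x).
Qed.

Lemma cLnorm2_le (v : T -> R[i]) (e : R) : 0 <= e -> (cLnorm mu 2%:E v <= e%:E)%E ->
  (\int[mu]_x (normc (v x) ^+ 2)%:E <= (e ^+ 2)%:E)%E.
Proof.
move=> e0; rewrite /cLnorm unlock.
have -> : (\int[mu]_x `|(normc (v x))%:E| `^ 2 = \int[mu]_x (normc (v x) ^+ 2)%:E)%E.
  apply: eq_integral => x _; rewrite gee0_abs ?lee_fin ?normc_ge0 //.
  by rewrite poweR_EFin powR_mulrn ?normc_ge0.
set X := (\int[mu]_x _)%E => h.
have X0 : (0 <= X)%E by apply: integral_ge0 => x _; rewrite lee_fin sqr_ge0.
have -> : X = ((X `^ 2^-1) `^ 2)%E by rewrite -poweRrM mulVf // poweRe1.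
rewrite -[(e ^+ 2)%:E]/((e ^+ 2)%:E) -powR_mulrn // -poweR_EFin.
by apply: gt0_ler_poweR => //; rewrite in_itv /= ?poweR_ge0 ?lee_fin ?e0 leey.
Qed.

End integral_lemmas.

Section time_slices.
Context (R : realType) (d : nat).
Local Notation point := (d.-tuple (measurableTypeR R)).
Variables (f : nat -> point -> R[i]) (u : nat -> point * measurableTypeR R -> R[i]).
Variables (l : nat -> R) (Gam : nat -> point -> \bar R) (B : R).
Hypothesis l_ge0 : forall j, 0 <= l j.
Hypothesis fu : forall j, schrodinger (f j) (u j).
Hypothesis mGam : forall J, measurable_fun setT (Gam J).
Hypothesis Gam_ge0 : forall J x, (0 <= Gam J x)%E.
Hypothesis Gam_mono : forall J J' x, (J <= J')%N -> (Gam J x <= Gam J' x)%E.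
Hypothesis Gam_bound : forall M J t x,
  (((\sum_(j < J) l j * normc (schrodinger_sum (f j) (cube d (2 ^ M)) t x) ^+ 2) ^+ 2)%:E
    <= Gam J x)%E.
Hypothesis Gam_int : forall J, (\int[torus R d]_x Gam J x <= B%:E)%E.

Definition total_density J z : R := \sum_(j < J) l j * normc (u j z) ^+ 2.

Lemma cmeasurable_normc_sqr d' (T : measurableType d') (v : T -> R[i]) : cmeasurable v ->
  measurable_fun setT (fun x => normc (v x) ^+ 2).
Proof.
move=> [mr mi]; under eq_fun do rewrite normc_sqrE.
by apply: measurable_funD; exact: measurable_funX.
Qed.

Lemma measurable_total_density J : measurable_fun setT (total_density J).
Proof.
apply: measurable_sum => j; apply: measurable_funM => //.
by apply: cmeasurable_normc_sqr; have [] := fu j.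
Qed.

Lemma cmeasurable_schrodinger_sum j A t : cmeasurable (schrodinger_sum (f j) A t).
Proof.
have m2 k : measurable_fun setT (fun x : point => 2 * pi * (dotp k x + t * sqnorm R k)).
  by apply: measurable_funM => //; apply: measurable_funD => //; exact: measurable_dotp.
have mc k := bmeas_measurable (bmeas_cos_comp (m2 k)).
have ms k := bmeas_measurable (bmeas_sin_comp (m2 k)).
split; rewrite /schrodinger_sum.
- under eq_fun do rewrite Re_sum.
  apply: measurable_sum => k; case: (fourier (f j) k) => a b /=.
  by apply: measurable_funB; exact: measurable_funM.
- under eq_fun do rewrite Im_sum.
  apply: measurable_sum => k; case: (fourier (f j) k) => a b /=.
  by apply: measurable_funD; exact: measurable_funM.
Qed.

Lemma cmeasurableB d' (T : measurableType d') (v w : T -> R[i]) :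
  cmeasurable v -> cmeasurable w -> cmeasurable (fun x => v x - w x).
Proof.
move=> [vr vi] [wr wi]; split.
- have -> : (fun x => complex.Re (v x - w x)) = (fun x => complex.Re (v x) - complex.Re (w x)).
    by apply/funext => x; case: (v x); case: (w x).
  exact: measurable_funB.
- have -> : (fun x => complex.Im (v x - w x)) = (fun x => complex.Im (v x) - complex.Im (w x)).
    by apply/funext => x; case: (v x); case: (w x).
  exact: measurable_funB.
Qed.

Lemma cmeasurable_slice j t : cmeasurable (fun x => u j (x, t)).
Proof.
have [[mr mi] _] := fu j; split.
- exact: (measurableT_comp mr (pair2_measurable t)).
- exact: (measurableT_comp mi (pair2_measurable t)).
Qed.

Definition root_majorant J x : \bar R := (Gam J x `^ 2^-1)%E.

Lemma measurable_root_majorant J : measurable_fun setT (root_majorant J).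
Proof. exact: (measurableT_comp (measurable_poweR _) (mGam J)). Qed.

Lemma root_majorant_ge0 J x : (0 <= root_majorant J x)%E.
Proof. exact: poweR_ge0. Qed.

Lemma root_majorant_bound M J t x :
  ((\sum_(j < J) l j * normc (schrodinger_sum (f j) (cube d (2 ^ M)) t x) ^+ 2)%:E
    <= root_majorant J x)%E.
Proof.
set V := \sum_(j < J) _.
have V0 : 0 <= V by apply: sumr_ge0 => j _; rewrite mulr_ge0 ?sqr_ge0.
have -> : V%:E = ((V ^+ 2)%:E `^ 2^-1)%E.
  by rewrite poweR_EFin -powR_mulrn // -powRrM mulfV // powRr1.
apply: gt0_ler_poweR; last exact: Gam_bound.
- by rewrite invr_ge0.
- by rewrite in_itv /= lee_fin sqr_ge0 leey.
- by rewrite in_itv /= Gam_ge0 leey.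
Qed.

(* The density is only known to be a limit in [L^1] of densities of truncated sums,
   which are bounded pointwise; the excess over this bound therefore integrates to 0. *)
Definition excess J (z : point * measurableTypeR R) : \bar R :=
  maxe ((total_density J z)%:E - 2%:E * root_majorant J z.1)%E 0%E.

Lemma excess_ge0 J z : (0 <= excess J z)%E.
Proof. by rewrite /excess le_max lexx orbT. Qed.

Lemma measurable_excess J : measurable_fun setT (excess J).
Proof.
apply: measurable_maxe; last exact: measurable_cst.
apply: emeasurable_funB.
  by apply/measurable_EFinP; exact: measurable_total_density.
apply: emeasurable_funM; first exact: measurable_cst.
exact: (measurableT_comp (measurable_root_majorant J) measurable_fst).
Qed.

(** The factor 2 in [excess] comes from [|a|^2 <= 2 |b|^2 + 2 |a - b|^2], where [b] is the truncated
    sum: the first part is covered by the majorant. *)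
Lemma excess_le M J x t : (excess J (x, t) <=
  (\sum_(j < J) 2 * l j * normc (u j (x, t) - schrodinger_sum (f j) (cube d (2 ^ M)) t x)
      ^+ 2)%:E)%E.
Proof.
set W := \sum_(j < J) _.
have W0 : 0 <= W.
  by apply: sumr_ge0 => j _; apply: mulr_ge0; [exact: mulr_ge0|exact: sqr_ge0].
rewrite /excess ge_max lee_fin W0 andbT /=.
have := root_majorant_bound M J t x; set V := \sum_(j < J) _ => h.
have TVW : total_density J (x, t) <= 2 * V + W.
  rewrite /total_density /V /W mulr_sumr -big_split /=; apply: ler_sum => j _.
  set a := u j (x, t); set b := schrodinger_sum _ _ _ _.
  have ab : normc a ^+ 2 <= 2 * normc b ^+ 2 + 2 * normc (a - b) ^+ 2.
    have := le_normcD b (a - b); rewrite addrC subrK.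
    have := normc_ge0 a; have := sqr_ge0 (normc b - normc (a - b)).
    have := normc_ge0 b; have := normc_ge0 (a - b); nra.
  have := ler_wpM2l (l_ge0 j) ab; lra.
have := root_majorant_ge0 J x; move: h; case: (root_majorant J x) => [r| |] //.
- by rewrite !lee_fin => Vr r0; lra.
- by move=> _ _; rewrite gt0_muley ?lte_fin // addeNy leNye.
Qed.

(** Cubes eventually contain any finite set of frequencies, so one cube serves all [j < J], and the
    integral of the error in [excess_le] is arbitrarily small. *)
Lemma ae_excess_slice J :
  {ae circle R, forall t, (\int[torus R d]_x excess J (x, t) = 0)%E}.
Proof.
have : \forall t \ae circle R, forall j, forall e : R, 0 < e ->
    exists A : {fset d.-tuple int}, forall B0 : {fset d.-tuple int}, (A `<=` B0)%fset ->
      (cLnorm (torus R d) 2%:E (fun x => u j (x, t) - schrodinger_sum (f j) B0 t x)%R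
         <= e%:E)%E.
  by apply: ae_foralln => j; have [_] := fu j.
apply: filterS => t ht.
apply/eqP; rewrite eq_le; apply/andP; split; last first.
  by apply: integral_ge0 => x _; exact: excess_ge0.
apply/lee_addgt0Pr => e e0; rewrite add0e.
pose S := \sum_(j < J) 2 * l j.
have S0 : 0 <= S by apply: sumr_ge0 => j _; rewrite mulr_ge0.
pose e1 := Num.sqrt (e / (S + 1)).
have e10 : 0 < e1 by rewrite sqrtr_gt0 divr_gt0 // ltr_wpDl.
have e1E : S * e1 ^+ 2 <= e.
  rewrite sqr_sqrtr; last by rewrite divr_ge0 ?ltW // ltr_wpDl.
  rewrite mulrA ler_pdivrMr ?ltr_wpDl //; nra.
have [M HM] : exists M, forall j : 'I_J,
    (cLnorm (torus R d) 2%:E (fun x => u j (x, t) - schrodinger_sum (f j) (cube d (2 ^ M)) t x)%R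
      <= e1%:E)%E.
  pose A (j : 'I_J) := sval (cid (ht j e1 e10)).
  have [M AM] := cube_sub (\big[fsetU/fset0]_j A j)%fset.
  exists M => j; apply: (svalP (cid (ht j e1 e10))).
  apply: fsubset_trans AM; rewrite (bigD1 j) //=; exact: fsubsetUl.
have mW (j : 'I_J) : measurable_fun setT
    (fun x => normc (u j (x, t) - schrodinger_sum (f j) (cube d (2 ^ M)) t x) ^+ 2).
  apply: cmeasurable_normc_sqr; apply: cmeasurableB; first exact: cmeasurable_slice.
  exact: cmeasurable_schrodinger_sum.
apply: (@le_trans _ _ (\int[torus R d]_x (\sum_(j < J) (2 * l j)%:E *
   (normc (u j (x, t) - schrodinger_sum (f j) (cube d (2 ^ M)) t x) ^+ 2)%:E)%E)%E).
  apply: ge0_le_integral_nonmeasurable => [x|x]; first exact: excess_ge0.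
  apply: le_trans (excess_le M J x t) _; rewrite -sumEFin.
  by apply: lee_sum => j _; rewrite EFinM.
rewrite ge0_integral_sum //; first last.
- by move=> j x _; apply: mule_ge0; rewrite lee_fin; [exact: mulr_ge0|exact: sqr_ge0].
- by move=> j; apply: emeasurable_funM => //; exact/measurable_EFinP.
apply: (@le_trans _ _ (\sum_(j < J) (2 * l j * e1 ^+ 2)%:E)%E).
  apply: lee_sum => j _; rewrite ge0_integralZl //; last first.
  - by rewrite lee_fin mulr_ge0.
  - by move=> x _; rewrite lee_fin sqr_ge0.
  - exact/measurable_EFinP.
  rewrite [leRHS]EFinM; apply: lee_wpmul2l; first by rewrite lee_fin mulr_ge0.
  by apply: cLnorm2_le (HM j); exact: ltW.
by rewrite sumEFin lee_fin -mulr_suml.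
Qed.

(** The vanishing is known for almost every [t]; Tonelli's theorem makes it available for almost
    every [x]. *)
Lemma excess_integral_swap J :
  (\int[torus R d]_x \int[circle R]_t excess J (x, t) = 0)%E.
Proof.
rewrite (fubini_tonelli (m1 := torus R d) (m2 := circle R) (excess J)) //; last 2 first.
- exact: measurable_excess.
- exact: excess_ge0.
rewrite (@ge0_ae_eq_integral _ _ _ (circle R) setT _ (cst 0%E)) //.
- by rewrite integral0.
- apply: measurable_fun_fubini_tonelli_G; [exact: measurable_excess|exact: excess_ge0].
- by move=> t _; apply: integral_ge0 => x _; exact: excess_ge0.
- by have := ae_excess_slice J; apply: filterS => t h _.
Qed.

Lemma ge0_integral_eq0_ae d' (T : measurableType d') (mu : {measure set T -> \bar R})
    (g : T -> \bar R) : measurable_fun setT g -> (forall x, 0 <= g x)%E ->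
  (\int[mu]_x g x = 0)%E -> {ae mu, forall x, g x = 0%E}.
Proof.
move=> mg g0 h.
have : (\int[mu]_x `|g x| = 0)%E by under eq_integral do rewrite gee0_abs //.
by move=> /(ae_eq_integral_abs mu measurableT mg); apply: filterS => x; apply.
Qed.

Lemma excess_eq0 J z : excess J z = 0%E ->
  ((total_density J z)%:E <= 2%:E * root_majorant J z.1)%E.
Proof.
rewrite /excess => h; have : ((total_density J z)%:E - 2%:E * root_majorant J z.1 <= 0)%E.
  by rewrite -h le_max lexx.
have := root_majorant_ge0 J z.1; case: (root_majorant J z.1) => [r| |] //.
- by move=> _; rewrite -EFinM -EFinB !lee_fin subr_le0.
- by move=> _ _; rewrite gt0_muley ?lte_fin // leey.
Qed.

Lemma ae_density_spacetime : {ae spacetime R d, forall z, forall J,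
  ((total_density J z)%:E <= 2%:E * root_majorant J z.1)%E}.
Proof.
apply: ae_foralln => J.
have : (\int[spacetime R d]_z excess J z = 0)%E.
  rewrite /spacetime (fubini_tonelli1 (m1 := torus R d) (m2 := circle R)) //.
  - exact: excess_integral_swap.
  - exact: measurable_excess.
  - exact: excess_ge0.
move=> /(ge0_integral_eq0_ae (measurable_excess J) (excess_ge0 J)).
by apply: filterS => z; exact: excess_eq0.
Qed.

(** The essential supremum in the mixed norm is taken on slices of fixed [x], so the exceptional
    times must be null on almost every slice. *)
Lemma ae_density_slices : {ae torus R d, forall x, {ae circle R, forall t, forall J,
  ((total_density J (x, t))%:E <= 2%:E * root_majorant J x)%E}}.
Proof.
have : {ae torus R d, forall x, forall J, (\int[circle R]_t excess J (x, t) = 0)%E}.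
  apply: ae_foralln => J.
  apply: ge0_integral_eq0_ae (excess_integral_swap J).
  - apply: (measurable_fun_fubini_tonelli_F (m2 := circle R)); [exact:
      measurable_excess|exact: excess_ge0].
  - by move=> x; apply: integral_ge0 => t _; exact: excess_ge0.
apply: filterS => x hx; apply: ae_foralln => J.
have : {ae circle R, forall t, excess J (x, t) = 0%E}.
  apply: ge0_integral_eq0_ae (hx J).
  - exact: (measurableT_comp (measurable_excess J) (pair1_measurable x)).
  - by move=> t; exact: excess_ge0.
by apply: filterS => t; exact: excess_eq0.
Qed.

Definition limit_majorant x : \bar R := limn (Gam^~ x).

Lemma cvg_Gam x : cvgn (Gam^~ x).
Proof. by apply: ereal_nondecreasing_is_cvgn => n m nm; exact: Gam_mono. Qed.

Lemma Gam_le_limit J x : (Gam J x <= limit_majorant x)%E.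
Proof.
apply: lime_ge; first exact: cvg_Gam.
by near=> n; apply: Gam_mono; near: n; exact: nbhs_infty_ge.
Unshelve. all: by end_near.
Qed.

Lemma limit_majorant_ge0 x : (0 <= limit_majorant x)%E.
Proof. exact: le_trans (Gam_ge0 0 x) (Gam_le_limit 0 x). Qed.

Lemma measurable_limit_majorant : measurable_fun setT limit_majorant.
Proof.
apply: (emeasurable_fun_cvg Gam) => // x _; exact: cvg_Gam.
Qed.

Lemma integral_limit_majorant : (\int[torus R d]_x limit_majorant x <= B%:E)%E.
Proof.
rewrite monotone_convergence //; last by move=> x _ n m nm; exact: Gam_mono.
apply: lime_le; last by near=> n; exact: Gam_int.
apply: ereal_nondecreasing_is_cvgn => n m nm.
by apply: ge0_le_integral_nonmeasurable => x //; exact: Gam_mono.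
Unshelve. all: by end_near.
Qed.

Lemma root_majorant_le J x : (root_majorant J x <= limit_majorant x `^ 2^-1)%E.
Proof.
apply: gt0_ler_poweR; last exact: Gam_le_limit.
- by rewrite invr_ge0.
- by rewrite in_itv /= Gam_ge0 leey.
- by rewrite in_itv /= limit_majorant_ge0 leey.
Qed.

End time_slices.

Section lebesgue_sequence_norm.
Context (R : realType).

Lemma ell_norm_ge0 (p : R) (lam : nat -> R[i]) : (0 <= ell_norm p lam)%E.
Proof. by rewrite /ell_norm unlock poweR_ge0. Qed.

Lemma sum_sqr_le_ell_norm (p : R) (lam : nat -> R[i]) (L : R) J : 1 <= p <= 2 ->
  ell_norm p lam = L%:E -> \sum_(j < J) normc (lam j) ^+ 2 <= L ^+ 2.
Proof.
move=> /andP[p1 p2] h.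
have p0 : 0 < p by apply: lt_le_trans p1.
have L0 : 0 <= L by rewrite -lee_fin -h ell_norm_ge0.
have sum_le n : \sum_(j < n) normc (lam j) `^ p <= L `^ p.
  rewrite -lee_fin -poweR_EFin -h /ell_norm Lnorm_counting // -poweRrM mulVf ?gt_eqF //.
  rewrite poweRe1; last by apply: nneseries_ge0 => k _ _; exact: poweR_ge0.
  apply: le_trans (nneseries_lim_ge n (fun k _ _ => poweR_ge0 _ _)).
  rewrite big_mkord -sumEFin le_eqVlt; apply/orP; left; apply/eqP; apply: eq_bigr => j _.
  by rewrite gee0_abs ?lee_fin ?normc_ge0.
have le_L j : normc (lam j) <= L.
  have lj : normc (lam j) `^ p <= L `^ p.
    apply: le_trans (sum_le j.+1); rewrite big_ord_recr /= lerDr.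
    by apply: sumr_ge0 => i _; exact: powR_ge0.
  rewrite leNgt; apply/negP => Ll; move: lj; apply/negP; rewrite -ltNge.
  by apply: gt0_ltr_powR => //; rewrite nnegrE ?normc_ge0.
have powE x : 0 <= x -> x ^+ 2 = x `^ p * x `^ (2 - p).
  move=> x0; rewrite -powR_mulrn // -powRD ?subrKC ?pnatr_eq0 //.
apply: (@le_trans _ _ (\sum_(j < J) normc (lam j) `^ p * L `^ (2 - p))).
  apply: ler_sum => j _; rewrite powE ?normc_ge0 //; apply: ler_wpM2l; first exact: powR_ge0.
  by apply: ge0_ler_powR; rewrite ?subr_ge0 // nnegrE ?normc_ge0.
by rewrite -mulr_suml powE // ler_wpM2r ?powR_ge0.
Qed.

End lebesgue_sequence_norm.

(** * Summability of the density and the mixed norm *)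

Section strichartz_assembly.
Context (R : realType) (d : nat).
Local Notation point := (d.-tuple (measurableTypeR R)).
Variables (f : nat -> point -> R[i]) (u : nat -> point * measurableTypeR R -> R[i]).
Variables (lam : nat -> R[i]) (Gam : nat -> point -> \bar R) (B : R).
Local Notation l := (fun j => normc (lam j)).
Hypothesis fu : forall j, schrodinger (f j) (u j).
Hypothesis mGam : forall J, measurable_fun setT (Gam J).
Hypothesis Gam_ge0 : forall J x, (0 <= Gam J x)%E.
Hypothesis Gam_mono : forall J J' x, (J <= J')%N -> (Gam J x <= Gam J' x)%E.
Hypothesis Gam_bound : forall M J t x,
  (((\sum_(j < J) l j * normc (schrodinger_sum (f j) (cube d (2 ^ M)) t x) ^+ 2) ^+ 2)%:E
    <= Gam J x)%E.
Hypothesis Gam_int : forall J, (\int[torus R d]_x Gam J x <= B%:E)%E.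

Let l_ge0 j : 0 <= l j. Proof. exact: normc_ge0. Qed.
Let Ginf := limit_majorant Gam.

Lemma density_summable z : (Ginf z.1 < +oo)%E ->
  (forall J, ((total_density u l J z)%:E <= 2%:E * root_majorant Gam J z.1)%E) ->
  csummable (density_term lam u z) /\
  ((normc (csum (density_term lam u z)))%:E <= 2%:E * (Ginf z.1 `^ 2^-1))%E.
Proof.
move=> Gfin HT; have G0 := limit_majorant_ge0 Gam_ge0 Gam_mono z.1.
have [h hE] : exists h : R, (Ginf z.1 `^ 2^-1 = h%:E)%E.
  exists (fine (Ginf z.1 `^ 2^-1)%E); rewrite fineK // ge0_fin_numE ?poweR_ge0 //.
  exact: poweR_lty.
have HT' J : total_density u l J z <= 2 * h.
  rewrite -lee_fin; apply: le_trans (HT J) _; rewrite EFinM -hE.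
  by apply: lee_wpmul2l; rewrite ?lee_fin // root_majorant_le.
rewrite hE -EFinM lee_fin; apply: normc_csum_le => K.
have norm_term j : normc (density_term lam u z j) = l j * normc (u j z) ^+ 2.
  by rewrite /density_term normcM normc_real ger0_norm ?sqr_ge0.
(* A number exceeding every element of [K]. *)
pose J := (\sum_(j <- K) j.+1)%N.
apply: le_trans (HT' J).
have KJ (j : nat) : j \in K -> (j < J)%N.
  by move=> jK; rewrite /J (big_fsetD1 j jK) /= leq_addr.
have -> : \sum_(i <- K) normc (density_term lam u z i) =
    \sum_(i < J | (i : nat) \in K) normc (density_term lam u z i).
  rewrite -(big_mkord (fun i => i \in K) (fun i => normc (density_term lam u z i))).
  rewrite -[RHS]big_filter; apply: perm_big; apply: uniq_perm.
  - exact: fset_uniq.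
  - by rewrite filter_uniq // iota_uniq.
  - move=> i; rewrite mem_filter mem_index_iota /=.
    by case iK : (i \in K) => //=; rewrite KJ.
rewrite big_mkcond /=; apply: ler_sum => i _; case: ifP => _; rewrite ?norm_term //.
by rewrite mulr_ge0 ?sqr_ge0.
Qed.

(** The limit majorant is integrable, hence finite almost everywhere, and there it bounds all finite
    sums of the moduli. *)
Lemma ae_csummable : {ae spacetime R d, forall z, csummable (density_term lam u z)}.
Proof.
have h1 := ae_density_spacetime l_ge0 fu mGam Gam_ge0 Gam_bound.
have mG := measurable_limit_majorant mGam Gam_mono.
have G0 := limit_majorant_ge0 Gam_ge0 Gam_mono.
have mG1 : measurable_fun setT (fun z : point * measurableTypeR R => Ginf z.1).
  exact: (measurableT_comp mG measurable_fst).
have iG : (spacetime R d).-integrable setT (fun z => Ginf z.1).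
  apply/integrableP; split=> //.
  under eq_integral do rewrite gee0_abs //.
  rewrite /spacetime (fubini_tonelli1 (m1 := torus R d) (m2 := circle R)) //.
  apply: le_lt_trans (ltry B).
  apply: le_trans (integral_limit_majorant mGam Gam_ge0 Gam_mono Gam_int).
  rewrite le_eqVlt; apply/orP; left; apply/eqP; apply: eq_integral => x _.
  rewrite /fubini_F [LHS](_ : _ = \int[circle R]_t cst (Ginf x) t)%E //.
  rewrite integral_cst // [X in (_ * X)%E](_ : _ = 1%E) ?mule1 //.
  exact: probability_setT.
have := integrable_ae measurableT iG.
apply: filterS2 h1 => z h1 h2; apply: (density_summable _ h1).1.
by have := h2 I; rewrite ge0_fin_numE.
Qed.

Lemma mixed_norm_le :
  (mixed_norm (fun z => csum (density_term lam u z)) <= (2 * Num.sqrt B)%:E)%E.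
Proof.
have G0 := limit_majorant_ge0 Gam_ge0 Gam_mono.
have mG := measurable_limit_majorant mGam Gam_mono.
have B0 : 0 <= B.
  rewrite -lee_fin; apply: le_trans (Gam_int 0); apply: integral_ge0 => x _; exact: Gam_ge0.
pose F x := cLnorm (circle R) +oo%E (fun t => csum (density_term lam u (x, t))).
have F0 x : (0 <= F x)%E.
  rewrite /F /cLnorm unlock; case: ifP => // c0; apply: ess_sup_gee => //.
  by apply: nearW => t; exact: abse_ge0.
have Fle : {ae torus R d, forall x, (F x `^ 2 <= 4%:E * Ginf x)%E}.
  have := ae_density_slices l_ge0 fu mGam Gam_ge0 Gam_bound.
  apply: filterS => x hx.
  have [Gfin|] := ltP (Ginf x) +oo%E; last first.
    by rewrite leye_eq => /eqP ->; rewrite gt0_muley ?lte_fin // leey.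
  have F2 : (F x <= 2%:E * (Ginf x `^ 2^-1))%E.
    rewrite /F /cLnorm unlock; case: ifP => [_|_]; last first.
      by rewrite mule_ge0 ?poweR_ge0 // lee_fin.
    apply/ess_supP; apply: filterS hx => t ht.
    rewrite -[leLHS]/(`|(normc (csum (density_term lam u (x, t))))%:E|%E).
    rewrite gee0_abs; last by rewrite lee_fin normc_ge0.
    exact: (@density_summable (x, t) Gfin ht).2.
  have -> : (4%:E * Ginf x = (2%:E * (Ginf x `^ 2^-1)) `^ 2)%E.
    rewrite poweRM ?poweR_ge0 ?lee_fin // -poweRrM mulVf // poweRe1 ?G0 //.
    by rewrite poweR_EFin powR_mulrn // -natrX.
  by apply: gt0_ler_poweR => //; rewrite in_itv /= ?F0 ?leey ?mule_ge0 ?poweR_ge0 ?lee_fin.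
have [N [mN N0 HN]] := Fle.
(* Setting [+oo] on the null set [N] makes the inequality hold everywhere, so that only the
   measurable [G] has to be integrated. *)
pose G x : \bar R := if x \in N then +oo%E else (4%:E * Ginf x)%E.
have FG x : (F x `^ 2 <= G x)%E.
  rewrite /G; case: ifPn => [_|xN]; first exact: leey.
  apply: contrapT => nF; move: xN; rewrite notin_setE => xN; exact/xN/HN.
have m4 : measurable_fun setT (fun x => 4%:E * Ginf x)%E.
  by apply: emeasurable_funM => //; exact: measurable_cst.
have g4 x : (0 <= 4%:E * Ginf x)%E by rewrite mule_ge0 ?lee_fin // G0.
have mGG : measurable_fun setT G.
  apply: measurable_fun_ifT; [|exact: measurable_cst|exact: m4].
  apply: (measurable_fun_bool true).
  rewrite setTI (_ : _ @^-1` _ = N) //.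
  by apply/seteqP; split => x /=; [move=> /set_mem|move=> /mem_set].
have intG : (\int[torus R d]_x G x <= (4 * B)%:E)%E.
  rewrite (@ge0_ae_eq_integral _ _ _ (torus R d) setT G (fun x => 4%:E * Ginf x)%E) //.
  - rewrite ge0_integralZl // ?lee_fin // EFinM; apply: lee_wpmul2l; first by rewrite lee_fin.
    exact: integral_limit_majorant.
  - by move=> x _; rewrite /G; case: ifP.
  - exists N; split=> // x /=; rewrite /G => h; apply: contrapT => xN; apply: h => _.
    by rewrite memNset.
rewrite /mixed_norm unlock.
have -> : (2 * Num.sqrt B)%:E = (((4 * B)%:E) `^ 2^-1)%E.
  rewrite poweR_EFin powR12_sqrt ?mulr_ge0 // sqrtrM //.
  by rewrite (_ : 4 = 2 ^+ 2) ?sqrtr_sqr ?ger0_norm // -natrX.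
apply: gt0_ler_poweR; rewrite ?invr_ge0 ?in_itv /= ?leey ?andbT //.
- by apply: integral_ge0 => x _; exact: poweR_ge0.
- by rewrite lee_fin mulr_ge0.
apply: le_trans intG; apply: ge0_le_integral_nonmeasurable => x; first exact: poweR_ge0.
by rewrite gee0_abs; [exact: FG|exact: F0].
Qed.

End strichartz_assembly.

Theorem theorem1p7 (R : realType) (d : nat) (s alpha : R)
    (hd : (1 <= d)%N)
    (hs : d%:R / 4 + d%:R / (2 * (d%:R + 2)) < s)
    (halpha : 1 <= alpha <= 2) :
  exists C : R,
    forall (f : nat -> d.-tuple (measurableTypeR R) -> R[i])
      (u : nat -> d.-tuple (measurableTypeR R) * measurableTypeR R -> R[i])
      (lam : nat -> R[i]),
      orthonormal_Hs s f ->
      (forall j : nat, schrodinger (f j) (u j)) ->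
      (ell_norm alpha lam < +oo)%E ->
      {ae spacetime R d, forall z, csummable (density_term lam u z)} /\
      (mixed_norm (fun z => csum (density_term lam u z))
         <= C%:E * ell_norm alpha lam)%E.
Proof.
have d2 : 0 < d%:R + 2 :> R by rewrite ltr_wpDl.
have lossE : d%:R / 4 + d%:R / (2 * (d%:R + 2)) = loss R d / 4.
  by rewrite /loss; field; rewrite gt_eqF.
have loss0 : 0 <= loss R d by rewrite addr_ge0 // divr_ge0 ?mulr_ge0 // ltW.
(* A fifth of the surplus; positivity is exactly the hypothesis on [s], the threshold being
   [loss R d / 4]. *)
pose eta : R := (4 * s - loss R d) / 5.
have eta0 : 0 < eta by rewrite divr_gt0 // subr_gt0; move: hs; rewrite lossE; lra.
have s0 : 0 <= s by move: hs; rewrite lossE; lra.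
have s_eta : 4 * s = loss R d + 5 * eta by rewrite /eta; field.
have [C C0 mass] := kernel_mass_dyadic d eta0.
pose A : R := (1 - ratio eta)^-1 ^+ 3 * (9 / 4) ^+ 2.
pose K : R := 4 * C * 2 `^ (4 * s) * (1 - ratio eta)^-1.
have Q0 : 0 <= (1 - ratio eta)^-1.
  by rewrite invr_ge0 subr_ge0 ltW // ratio_lt1.
have A0 : 0 <= A by rewrite mulr_ge0 ?sqr_ge0 // exprn_ge0.
have K0 : 0 <= K by rewrite !mulr_ge0 ?powR_ge0 // ltW.
(* [A] is the pointwise cost of recombining the shells, [K] bounds the integral of the square
   function, and 2 comes from [excess]. *)
exists (2 * Num.sqrt (A * K)) => f u lam fO fu lamfin.
have lam0 := ell_norm_ge0 alpha lam.
set L := fine (ell_norm alpha lam).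
have LE : ell_norm alpha lam = L%:E by rewrite fineK // ge0_fin_numE.
have L0 : 0 <= L by rewrite fine_ge0.
pose l j := normc (lam j).
have l0 j : 0 <= l j by exact: normc_ge0.
pose Gam J x : \bar R := (A%:E * square_fun s eta f l J x)%E.
have mGam J : measurable_fun setT (Gam J).
  by apply: emeasurable_funM; [exact: measurable_cst|exact: measurable_square_fun].
have Gam0 J x : (0 <= Gam J x)%E.
  by rewrite mule_ge0 ?lee_fin // square_fun_ge0.
have Gam_mono J J' x : (J <= J')%N -> (Gam J x <= Gam J' x)%E.
  by move=> JJ; apply: lee_wpmul2l; rewrite ?lee_fin //; exact: square_fun_mono.
have Gam_bound M J t x :
  (((\sum_(j < J) l j * normc (schrodinger_sum (f j) (cube d (2 ^ M)) t x) ^+ 2) ^+ 2)%:E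
    <= Gam J x)%E by exact: density_le_square_fun.
have Gam_int J : (\int[torus R d]_x Gam J x <= (A * K * L ^+ 2)%:E)%E.
  rewrite ge0_integralZl ?lee_fin //; last 2 first.
  - exact: measurable_square_fun.
  - by move=> x _; exact: square_fun_ge0.
  rewrite -mulrA [leRHS]EFinM; apply: lee_wpmul2l; first by rewrite lee_fin.
  apply: le_trans (integral_square_fun s0 eta0 s_eta C0 mass fO l0 J) _.
  rewrite -EFinM lee_fin ler_wpM2l //; exact: sum_sqr_le_ell_norm LE.
split; first exact: ae_csummable fu mGam Gam0 Gam_mono Gam_bound Gam_int.
apply: le_trans (mixed_norm_le fu mGam Gam0 Gam_mono Gam_bound Gam_int) _.
rewrite LE -EFinM lee_fin (sqrtrM _ (mulr_ge0 A0 K0)) sqrtr_sqr ger0_norm //.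
by rewrite mulrA.
Qed.
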